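(* Let $q\in(0,1)$ and let $n\ge 1$ be an integer. For any $l\in\mathbb{N}=\{1,2,\ldots\}$ the linear operator $\Box_q^{\,l}:\mathbb{C}[M_n]_q\to\mathbb{C}[M_n]_q$ intertwines the $U_q\mathfrak{sl}_{2n}$-actions $\pi_{n-l}$ and $\pi_{n+l}$: $$\Box_q^{\,l}\cdot\pi_{n-l}(\xi)=\pi_{n+l}(\xi)\cdot\Box_q^{\,l},\qquad \xi\in U_q\mathfrak{sl}_{2n}.$$ In other words, $\Box_q^{\,l}:\mathcal{P}_{n-l}\to\mathcal{P}_{n+l}$ is a morphism of $U_q\mathfrak{sl}_{2n}$-modules.
   Context: **Quantum matrices.** $\mathbb{C}[M_n]_q$ is the unital algebra with generators $z_a^\alpha$, $a,\alpha=1,\ldots,n$, and relations: $z_a^\alpha z_b^\beta=q z_b^\beta z_a^\alpha$ if ($a=b$ and $\alpha<\beta$) or ($a<b$ and $\alpha=\beta$); $z_a^\alpha z_b^\beta=z_b^\beta z_a^\alpha$ if $a<b$ and $\alpha>\beta$; $z_a^\alpha z_b^\beta=z_b^\beta z_a^\alpha+(q-q^{-1})z_a^\beta z_b^\alpha$ if $a<b$ and $\alpha<\beta$. **The Hopf algebra $U_q\mathfrak{sl}_{2n}$.** Generators $E_i,F_i,K_i^{\pm1}$, $i=1,\ldots,2n-1$; relations $K_iK_j=K_jK_i$, $K_iK_i^{-1}=K_i^{-1}K_i=1$, $K_iE_j=q^{a_{ij}}E_jK_i$, $K_iF_j=q^{-a_{ij}}F_jK_i$, $E_iF_j-F_jE_i=\delta_{ij}(K_i-K_i^{-1})/(q-q^{-1})$,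 $E_i^2E_j-(q+q^{-1})E_iE_jE_i+E_jE_i^2=0$ and the same for $F$ if $|i-j|=1$, and $[E_i,E_j]=[F_i,F_j]=0$ if $|i-j|\neq1$, where $(a_{ij})$ is the Cartan matrix of type $A_{2n-1}$. Comultiplication: $\Delta(E_i)=E_i\otimes1+K_i\otimes E_i$, $\Delta(F_i)=F_i\otimes K_i^{-1}+1\otimes F_i$, $\Delta(K_i)=K_i\otimes K_i$; counit $\varepsilon(E_i)=\varepsilon(F_i)=0$, $\varepsilon(K_i)=1$; antipode $S(E_i)=-K_i^{-1}E_i$, $S(F_i)=-F_iK_i$, $S(K_i)=K_i^{-1}$. A module algebra over a Hopf algebra $A$ is a unital algebra that is an $A$-module with $\xi(1)=\varepsilon(\xi)1$ and with multiplication a morphism of $A$-modules. **Initial action.** It is known that there is a unique $U_q\mathfrak{sl}_{2n}$-module algebra structure on $\mathbb{C}[M_n]_q$ with the following action on generators. For $1\le i\le n-1$: $K_iz_a^\alpha=qz_a^\alpha$ if $a=i$, $q^{-1}z_a^\alpha$ if $a=i+1$, $z_a^\alpha$ otherwise; $F_iz_a^\alpha=q^{1/2}z_{a+1}^\alpha$ if $a=i$, $0$ otherwise; $E_iz_a^\alpha=q^{-1/2}z_{a-1}^\alpha$ if $a=i+1$, $0$ otherwise. For $1\le j\le n-1$: $K_{n+j}z_a^\alpha=qz_a^\alpha$ if $\alpha=n-j$, $q^{-1}z_a^\alpha$ if $\alpha=n-j+1$, $z_a^\alpha$ otherwise; $F_{n+j}z_a^\alpha=q^{1/2}z_a^{\alpha+1}$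 if $\alpha=n-j$, $0$ otherwise; $E_{n+j}z_a^\alpha=q^{-1/2}z_a^{\alpha-1}$ if $\alpha=n-j+1$, $0$ otherwise. Finally $K_nz_a^\alpha=q^2z_a^\alpha$ if $a=\alpha=n$, $qz_a^\alpha$ if exactly one of $a,\alpha$ equals $n$, $z_a^\alpha$ otherwise; $F_nz_a^\alpha=q^{1/2}$ if $a=\alpha=n$, $0$ otherwise; $E_nz_a^\alpha=-q^{-1/2}z_a^nz_n^\alpha$ if $a\ne n$ and $\alpha\neq n$, $-q^{1/2}(z_n^n)^2$ if $a=\alpha=n$, $-q^{1/2}z_n^nz_a^\alpha$ otherwise. **Twisted actions.** For $\lambda\in\mathbb{R}$ the $U_q\mathfrak{sl}_{2n}$-action $\pi_\lambda$ on $\mathbb{C}[M_n]_q$ is given in terms of the initial action by $\pi_\lambda(K_j^{\pm1})=K_j^{\pm1}$, $\pi_\lambda(F_j)=F_j$, $\pi_\lambda(E_j)=E_j$ for $j\neq n$, and $$\pi_\lambda(K_n^{\pm1})f=q^{\pm\lambda}K_n^{\pm1}f,\quad \pi_\lambda(F_n)f=q^{-\lambda}F_nf,\quad \pi_\lambda(E_n)f=E_nf-q^{1/2}\frac{1-q^{2\lambda}}{1-q^2}(K_nf)z_n^n.$$ $\mathcal{P}_\lambda$ denotes $\mathbb{C}[M_n]_q$ with the action $\pi_\lambda$. **$q$-derivatives and $\Box_q$.** Let $\Omega^1(M_n)_q$ be the $\mathbb{C}[M_n]_q$-bimodule with generators $dz_a^\alpha$ and relations $$z_b^\beta\,dz_a^\alpha=\sum_{\alpha',\beta',a',b'=1}^nR_{\beta\alpha}^{\beta'\alpha'}R_{ba}^{b'a'}\,dz_{a'}^{\alpha'}\cdot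 z_{b'}^{\beta'},$$ where $R_{ba}^{b'a'}=q^{-1}$ if $a=b=a'=b'$; $1$ if $a\ne b$, $a=a'$, $b=b'$; $q^{-1}-q$ if $a<b$, $a=b'$, $b=a'$; $0$ otherwise. The map $z_a^\alpha\mapsto dz_a^\alpha$ extends to a linear map $d:\mathbb{C}[M_n]_q\to\Omega^1(M_n)_q$ with $d(f_1f_2)=d(f_1)f_2+f_1d(f_2)$. The operators $\partial/\partial z_a^\alpha$ on $\mathbb{C}[M_n]_q$ are defined by $df=\sum_{a,\alpha}\frac{\partial f}{\partial z_a^\alpha}\cdot dz_a^\alpha$. The $q$-wave operator is $$\Box_q=\sum_{s\in S_n}(-q)^{l(s)}\frac{\partial}{\partial z_1^{s(1)}}\frac{\partial}{\partial z_2^{s(2)}}\cdots\frac{\partial}{\partial z_n^{s(n)}},$$ with $l(s)$ the length of the permutation $s$. *)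

(* Defs.v *)
From HB Require Import structures.
From mathcomp Require Import all_boot all_order all_algebra perm.
From mathcomp Require Import boolp reals exp.
From mathcomp Require Import complex ring.

Set Implicit Arguments.
Unset Strict Implicit.
Unset Printing Implicit Defensive.

Import Order.TTheory GRing.Theory Num.Theory.
Local Open Scope ring_scope.
Local Open Scope quotient_scope.

Section Terms.
Variable k : fieldType.

Inductive term (X : Type) : Type :=
| Gen of X
| Cst of k
| TAdd of term X & term X
| TMul of term X & term X.

Fixpoint eval (X : Type) (B : algType k) (f : X -> B) (t : term X) : B :=
  match t with
  | Gen x => f x
  | Cst c => c%:A
  | TAdd t u => eval f t + eval f u
  | TMul t u => eval f t * eval f u
  end.

Definition respects (X : Type) (rel : term X -> term X -> Prop)
  (B : algType k) (f : X -> B) : Prop :=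
  forall t u, rel t u -> eval f t = eval f u.

(* The presented algebra is the quotient by the congruence [pcong] below. As
   [algType] requires 1 != 0, a presentation carries a character of the
   presented algebra, given by its values [aug] on the generators. It serves
   only to show that the quotient is not the zero ring. *)
Record presentation := Presentation {
  gens : Type;
  rels : term gens -> term gens -> Prop;
  aug : gens -> k;
  augP : respects rels (aug : gens -> k^o)
}.

Section Congruence.
Variable P : presentation.
Local Notation T := (term (gens P)).

Inductive pcong : T -> T -> Prop :=
| pc_rel t u : rels t u -> pcong t u
| pc_refl t : pcong t t
| pc_sym t u : pcong t u -> pcong u t
| pc_trans t u v : pcong t u -> pcong u v -> pcong t v
| pc_add t t' u u' : pcong t t' -> pcong u u' -> pcong (TAdd t u) (TAdd t' u')
| pc_mul t t' u u' : pcong t t' -> pcong u u' -> pcong (TMul t u) (TMul t' u')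
| pc_addA t u v : pcong (TAdd t (TAdd u v)) (TAdd (TAdd t u) v)
| pc_addC t u : pcong (TAdd t u) (TAdd u t)
| pc_add0 t : pcong (TAdd (Cst _ 0) t) t
| pc_addN t : pcong (TAdd (TMul (Cst _ (-1)) t) t) (Cst _ 0)
| pc_mulA t u v : pcong (TMul t (TMul u v)) (TMul (TMul t u) v)
| pc_mul1l t : pcong (TMul (Cst _ 1) t) t
| pc_mulDl t u v : pcong (TMul (TAdd t u) v) (TAdd (TMul t v) (TMul u v))
| pc_mulDr t u v : pcong (TMul t (TAdd u v)) (TAdd (TMul t u) (TMul t v))
| pc_cstD c d : pcong (Cst _ (c + d)) (TAdd (Cst _ c) (Cst _ d))
| pc_cstM c d : pcong (Cst _ (c * d)) (TMul (Cst _ c) (Cst _ d))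
| pc_cstC c t : pcong (TMul (Cst _ c) t) (TMul t (Cst _ c)).

HB.instance Definition _ := gen_eqMixin T.
HB.instance Definition _ := gen_choiceMixin T.

Definition pcongb (t u : T) : bool := `[< pcong t u >].

Lemma pcongb_refl : reflexive pcongb.
Proof. by move=> t; apply/asboolP/pc_refl. Qed.

Lemma pcongb_sym : symmetric pcongb.
Proof. by move=> t u; apply/asboolP/asboolP => /pc_sym. Qed.

Lemma pcongb_trans : transitive pcongb.
Proof.
by move=> u t v /asboolP tu /asboolP uv; apply/asboolP/(pc_trans tu uv).
Qed.

Canonical pcong_equiv := EquivRel pcongb pcongb_refl pcongb_sym pcongb_trans.

Definition pres_alg : Type := {eq_quot pcong_equiv}.

HB.instance Definition _ : EqQuotient T pcong_equiv pres_alg :=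
  EqQuotient.on pres_alg.
HB.instance Definition _ := Choice.on pres_alg.

Definition pclass (t : T) : pres_alg := \pi_pres_alg t.

Lemma pclassP t u : pclass t = pclass u <-> pcong t u.
Proof. by split=> [/eqmodP/asboolP|tu]; [|apply/eqmodP/asboolP]. Qed.

Lemma pclass_ind (Q : pres_alg -> Prop) :
  (forall t, Q (pclass t)) -> forall x, Q x.
Proof. by move=> Qt x; rewrite -[x]reprK; apply: Qt. Qed.

Definition pres_add (x y : pres_alg) := pclass (TAdd (repr x) (repr y)).
Definition pres_opp (x : pres_alg) := pclass (TMul (Cst _ (-1)) (repr x)).
Definition pres_mul (x y : pres_alg) := pclass (TMul (repr x) (repr y)).
Definition pres_scale (c : k) (x : pres_alg) :=
  pclass (TMul (Cst _ c) (repr x)).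

Lemma repr_pclass t : pcong (repr (pclass t)) t.
Proof. by apply/pclassP; rewrite {1}/pclass reprK. Qed.

Lemma pres_addE t u : pres_add (pclass t) (pclass u) = pclass (TAdd t u).
Proof. by apply/pclassP/pc_add; apply: repr_pclass. Qed.

Lemma pres_mulE t u : pres_mul (pclass t) (pclass u) = pclass (TMul t u).
Proof. by apply/pclassP/pc_mul; apply: repr_pclass. Qed.

Lemma pres_oppE t : pres_opp (pclass t) = pclass (TMul (Cst _ (-1)) t).
Proof. by apply/pclassP/pc_mul; [apply: pc_refl | apply: repr_pclass]. Qed.

Lemma pres_scaleE c t : pres_scale c (pclass t) = pclass (TMul (Cst _ c) t).
Proof. by apply/pclassP/pc_mul; [apply: pc_refl | apply: repr_pclass]. Qed.

Let presE := (pres_addE, pres_mulE, pres_oppE, pres_scaleE).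

Fact pres_addA : associative pres_add.
Proof.
elim/pclass_ind=> t; elim/pclass_ind=> u; elim/pclass_ind=> v.
by rewrite !presE; apply/pclassP/pc_addA.
Qed.

Fact pres_addC : commutative pres_add.
Proof.
elim/pclass_ind=> t; elim/pclass_ind=> u.
by rewrite !presE; apply/pclassP/pc_addC.
Qed.

Fact pres_add0 : left_id (pclass (Cst _ 0)) pres_add.
Proof. by elim/pclass_ind=> t; rewrite !presE; apply/pclassP/pc_add0. Qed.

Fact pres_addN : left_inverse (pclass (Cst _ 0)) pres_opp pres_add.
Proof. by elim/pclass_ind=> t; rewrite !presE; apply/pclassP/pc_addN. Qed.

HB.instance Definition _ :=
  GRing.isZmodule.Build pres_alg pres_addA pres_addC pres_add0 pres_addN.

Fact pres_mulA : associative pres_mul.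
Proof.
elim/pclass_ind=> t; elim/pclass_ind=> u; elim/pclass_ind=> v.
by rewrite !presE; apply/pclassP/pc_mulA.
Qed.

Fact pres_mul1l : left_id (pclass (Cst _ 1)) pres_mul.
Proof. by elim/pclass_ind=> t; rewrite !presE; apply/pclassP/pc_mul1l. Qed.

Fact pres_mul1r : right_id (pclass (Cst _ 1)) pres_mul.
Proof.
elim/pclass_ind=> t; rewrite !presE; apply/pclassP.
exact: pc_trans (pc_sym (pc_cstC _ _)) (pc_mul1l _).
Qed.

Fact pres_mulDl : left_distributive pres_mul +%R.
Proof.
elim/pclass_ind=> t; elim/pclass_ind=> u; elim/pclass_ind=> v.
by rewrite /+%R/= !presE; apply/pclassP/pc_mulDl.
Qed.

Fact pres_mulDr : right_distributive pres_mul +%R.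
Proof.
elim/pclass_ind=> t; elim/pclass_ind=> u; elim/pclass_ind=> v.
by rewrite /+%R/= !presE; apply/pclassP/pc_mulDr.
Qed.

Lemma pcong_eval (B : algType k) (f : gens P -> B) :
  respects (@rels P) f -> forall t u, pcong t u -> eval f t = eval f u.
Proof.
move=> hf t u; elim=> {t u} //=.
- by move=> t u v _ -> _ ->.
- by move=> t t' u u' _ -> _ ->.
- by move=> t t' u u' _ -> _ ->.
- by move=> t u v; rewrite addrA.
- by move=> t u; rewrite addrC.
- by move=> t; rewrite scale0r add0r.
- by move=> t; rewrite scaleN1r mulN1r addNr scale0r.
- by move=> t u v; rewrite mulrA.
- by move=> t; rewrite scale1r mul1r.
- by move=> t u v; rewrite mulrDl.
- by move=> t u v; rewrite mulrDr.
- by move=> c d; rewrite scalerDl.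
- by move=> c d; rewrite -scalerAl mul1r scalerA.
- by move=> c t; rewrite -scalerAl -scalerAr mul1r mulr1.
Qed.

Fact pres_1neq0 : pclass (Cst _ 1) != 0.
Proof.
apply/eqP => /pclassP/(pcong_eval (@augP P)) /= /eqP.
by rewrite scale1r scale0r oner_eq0.
Qed.

HB.instance Definition _ := GRing.Zmodule_isNzRing.Build pres_alg
  pres_mulA pres_mul1l pres_mul1r pres_mulDl pres_mulDr pres_1neq0.

Fact pres_scaleA c d x : pres_scale c (pres_scale d x) = pres_scale (c * d) x.
Proof.
elim/pclass_ind: x => t; rewrite !presE; apply/pclassP.
apply: pc_trans (pc_mulA _ _ _) _.
by apply: pc_mul; [apply/pc_sym/pc_cstM | apply: pc_refl].
Qed.

Fact pres_scale1 : left_id 1 pres_scale.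
Proof. by elim/pclass_ind=> t; rewrite !presE; apply/pclassP/pc_mul1l. Qed.

Fact pres_scaleDr : right_distributive pres_scale +%R.
Proof.
move=> c; elim/pclass_ind=> t; elim/pclass_ind=> u.
by rewrite /+%R/= !presE; apply/pclassP/pc_mulDr.
Qed.

Fact pres_scaleDl x : {morph pres_scale^~ x : c d / c + d}.
Proof.
move=> c d; elim/pclass_ind: x => t.
rewrite [in RHS]/+%R/= !presE; apply/pclassP.
apply: pc_trans (pc_mulDl _ _ _).
by apply: pc_mul; [apply: pc_cstD | apply: pc_refl].
Qed.

HB.instance Definition _ := GRing.Zmodule_isLmodule.Build k pres_alg
  pres_scaleA pres_scale1 pres_scaleDr pres_scaleDl.

Fact pres_scaleAl (c : k) (x y : pres_alg) : c *: (x * y) = (c *: x) * y.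
Proof.
elim/pclass_ind: x => t; elim/pclass_ind: y => u.
by rewrite /*:%R/= /*%R/= !presE; apply/pclassP/pc_mulA.
Qed.

HB.instance Definition _ := GRing.Lmodule_isLalgebra.Build k pres_alg
  pres_scaleAl.

Fact pres_scaleAr (c : k) (x y : pres_alg) : c *: (x * y) = x * (c *: y).
Proof.
elim/pclass_ind: x => t; elim/pclass_ind: y => u.
rewrite /*:%R/= /*%R/= !presE; apply/pclassP.
apply: pc_trans (pc_mulA _ _ _) _; apply/pc_sym.
apply: pc_trans (pc_mulA _ _ _) _.
by apply: pc_mul; [apply/pc_sym/pc_cstC | apply: pc_refl].
Qed.

HB.instance Definition _ := GRing.Lalgebra_isAlgebra.Build k pres_alg
  pres_scaleAr.

Definition pgen (x : gens P) : pres_alg := pclass (Gen x).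

Lemma pclassD t u : pclass (TAdd t u) = pclass t + pclass u.
Proof. by rewrite [RHS]/+%R/= presE. Qed.

Lemma pclassM t u : pclass (TMul t u) = pclass t * pclass u.
Proof. by rewrite [RHS]/*%R/= presE. Qed.

Lemma pclassC c : pclass (Cst _ c) = c%:A.
Proof.
rewrite [RHS]/*:%R/= [1%R](_ : _ = pclass (Cst _ 1)) // !presE.
apply/pclassP/pc_sym; apply: pc_trans (pc_cstC _ _) _; exact: pc_mul1l.
Qed.

Lemma pclassE t : pclass t = eval pgen t.
Proof.
elim: t => //= [c|t IHt u IHu|t IHt u IHu]; first exact: pclassC.
  by rewrite pclassD IHt IHu.
by rewrite pclassM IHt IHu.
Qed.

Lemma pgen_rels : respects (@rels P) pgen.
Proof. by move=> t u tu; rewrite -!pclassE; apply/pclassP/pc_rel. Qed.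

Section Lift.
Variables (B : algType k) (f : gens P -> B) (hf : respects (@rels P) f).

Definition lift_of (_ : respects (@rels P) f) (x : pres_alg) : B :=
  eval f (repr x).
Local Notation lift := (lift_of hf).

Lemma lift_pclass t : lift (pclass t) = eval f t.
Proof. exact/(pcong_eval hf)/repr_pclass. Qed.

Lemma lift_gen x : lift (pgen x) = f x.
Proof. exact: lift_pclass. Qed.

Fact lift_linear : linear lift.
Proof.
move=> c x y; elim/pclass_ind: x => t; elim/pclass_ind: y => u.
rewrite [X in lift (X + _)]/*:%R/= presE [X in lift X]/+%R/= presE.
by rewrite !lift_pclass /= -scalerAl mul1r.
Qed.

Fact lift_monoid : monoid_morphism lift.
Proof.
split=> [|x y]; first by rewrite [1%R]/(pclass (Cst _ 1)) lift_pclass /= scale1r.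
elim/pclass_ind: x => t; elim/pclass_ind: y => u.
by rewrite [X in lift X]/*%R/= presE !lift_pclass.
Qed.

HB.instance Definition _ := GRing.isLinear.Build k pres_alg B *:%R lift
  lift_linear.
HB.instance Definition _ := GRing.isMonoidMorphism.Build pres_alg B lift
  lift_monoid.

End Lift.
End Congruence.
End Terms.

Arguments Cst {k X}.
Arguments Gen {k X}.
Arguments pgen {k}.

Declare Scope pterm_scope.
Delimit Scope pterm_scope with PT.
Bind Scope pterm_scope with term.
Notation "t + u" := (TAdd t u) : pterm_scope.
Notation "t * u" := (TMul t u) : pterm_scope.
Notation "c *: t" := (TMul (Cst c) t) : pterm_scope.
Notation "t - u" := (TAdd t (TMul (Cst (-1)) u)) : pterm_scope.
Notation "0" := (Cst 0) : pterm_scope.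
Notation "1" := (Cst 1) : pterm_scope.

Section Tensor.
Variable k : fieldType.

Fixpoint tmap (X Y : Type) (g : X -> Y) (t : term k X) : term k Y :=
  match t with
  | Gen x => Gen (g x)
  | Cst c => Cst c
  | TAdd t u => TAdd (tmap g t) (tmap g u)
  | TMul t u => TMul (tmap g t) (tmap g u)
  end.

Lemma eval_tmap (X Y : Type) (g : X -> Y) (B : algType k) (f : Y -> B) t :
  eval f (tmap g t) = eval (f \o g) t.
Proof. by elim: t => //= t -> u ->. Qed.

Variables P Q : presentation k.

(* The tensor product of two algebras is the algebra generated by both of them
   subject to the condition that they commute with each other. *)
Inductive tens_rel :
  term k (gens P + gens Q) -> term k (gens P + gens Q) -> Prop :=
| tens_rell t u : rels t u -> tens_rel (tmap inl t) (tmap inl u)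
| tens_relr t u : rels t u -> tens_rel (tmap inr t) (tmap inr u)
| tens_comm x y : tens_rel (Gen (inl x) * Gen (inr y)) (Gen (inr y) * Gen (inl x)).

Definition tens_aug (x : gens P + gens Q) : k :=
  match x with inl x => aug x | inr y => aug y end.

Fact tens_augP : respects tens_rel (tens_aug : _ -> k^o).
Proof.
move=> _ _ [t u tu|t u tu|x y] /=; rewrite ?eval_tmap.
- exact: (@augP _ P).
- exact: (@augP _ Q).
- exact: mulrC.
Qed.

Definition tens : presentation k := Presentation tens_augP.

Fact tensl_subproof :
  respects (@rels _ P) (fun x => pgen tens (inl x)).
Proof.
move=> t u tu; have := pgen_rels (tens_rell tu : @rels _ tens _ _).
by rewrite !eval_tmap.
Qed.

Fact tensr_subproof :
  respects (@rels _ Q) (fun y => pgen tens (inr y)).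
Proof.
move=> t u tu; have := pgen_rels (tens_relr tu : @rels _ tens _ _).
by rewrite !eval_tmap.
Qed.

Definition tensl := lift_of tensl_subproof.
Definition tensr := lift_of tensr_subproof.

HB.instance Definition _ := GRing.LRMorphism.on tensl.
HB.instance Definition _ := GRing.LRMorphism.on tensr.

Definition tensor (x : pres_alg P) (y : pres_alg Q) : pres_alg tens :=
  tensl x * tensr y.
Local Notation "x ⊗ y" := (tensor x y) (at level 40).

Lemma tensC x y : tensr y * tensl x = tensl x * tensr y.
Proof.
elim/pclass_ind: x => t; elim/pclass_ind: y => u.
elim: t => [x|c|t IHt t' IHt'|t IHt t' IHt'].
- elim: u => [y|c|u IHu u' IHu'|u IHu u' IHu'].
  + rewrite /tensl /tensr !lift_pclass /=; apply/esym.
    exact: (pgen_rels (tens_comm x y : @rels _ tens _ _)).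
  + by rewrite !pclassC !linearZ /= !rmorph1 -scalerAl -scalerAr mulr1 mul1r.
  + by rewrite !pclassD !raddfD /= mulrDl mulrDr IHu IHu'.
  + by rewrite !pclassM !rmorphM /= -mulrA IHu' !mulrA IHu.
- by rewrite !pclassC !linearZ /= !rmorph1 -scalerAl -scalerAr mulr1 mul1r.
- by rewrite !pclassD !raddfD /= mulrDl mulrDr IHt IHt'.
- by rewrite !pclassM !rmorphM /= !mulrA IHt -!mulrA IHt'.
Qed.

Lemma tensorM x y x' y' : (x ⊗ y) * (x' ⊗ y') = (x * x') ⊗ (y * y').
Proof.
by rewrite /tensor !rmorphM /= -!mulrA (mulrA (tensr y) (tensl x')) tensC -!mulrA.
Qed.

Lemma tensorDl x x' y : (x + x') ⊗ y = x ⊗ y + x' ⊗ y.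
Proof. by rewrite /tensor raddfD mulrDl. Qed.
Lemma tensorDr x y y' : x ⊗ (y + y') = x ⊗ y + x ⊗ y'.
Proof. by rewrite /tensor raddfD mulrDr. Qed.
Lemma tensorZl c x y : (c *: x) ⊗ y = c *: (x ⊗ y).
Proof. by rewrite /tensor linearZ /= scalerAl. Qed.
Lemma tensorZr c x y : x ⊗ (c *: y) = c *: (x ⊗ y).
Proof. by rewrite /tensor linearZ /= scalerAr. Qed.
Lemma tensorBl x x' y : (x - x') ⊗ y = x ⊗ y - x' ⊗ y.
Proof. by rewrite /tensor raddfB mulrBl. Qed.
Lemma tensorBr x y y' : x ⊗ (y - y') = x ⊗ y - x ⊗ y'.
Proof. by rewrite /tensor raddfB mulrBr. Qed.
Lemma tensor11 : 1 ⊗ 1 = 1.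
Proof. by rewrite /tensor !rmorph1 mulr1. Qed.
Lemma tensor0l y : 0 ⊗ y = 0.
Proof. by rewrite /tensor raddf0 mul0r. Qed.
Lemma tensor0r x : x ⊗ 0 = 0.
Proof. by rewrite /tensor raddf0 mulr0. Qed.

End Tensor.

Notation "x ⊗ y" := (tensor x y) (at level 40) : ring_scope.

Inductive Uq_gens (r : nat) : Type :=
| gE of 'I_r
| gF of 'I_r
| gK of 'I_r
| gKi of 'I_r.

Section Uq.
Variables (k : fieldType) (r : nat) (q : k).

Definition adjacent (i j : 'I_r) : bool := (i.+1 == j) || (j.+1 == i).

Definition cartan (i j : 'I_r) : int :=
  if i == j then 2 else if adjacent i j then -1 else 0.

Section Rel.
Local Notation E i := (Gen (gE i)).
Local Notation F i := (Gen (gF i)).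
Local Notation K i := (Gen (gK i)).
Local Notation Ki i := (Gen (gKi i)).

Inductive Uq_rel : term k (Uq_gens r) -> term k (Uq_gens r) -> Prop :=
| Uq_KK i j : Uq_rel (K i * K j) (K j * K i)
| Uq_KKi i : Uq_rel (K i * Ki i) 1
| Uq_KiK i : Uq_rel (Ki i * K i) 1
| Uq_KE i j : Uq_rel (K i * E j) (q ^ cartan i j *: (E j * K i))
| Uq_KF i j : Uq_rel (K i * F j) (q ^ (- cartan i j) *: (F j * K i))
| Uq_EF i j : Uq_rel (E i * F j - F j * E i)
                     (((i == j)%:R / (q - q^-1))%R *: (K i - Ki i))
| Uq_EEE i j : adjacent i j ->
    Uq_rel (E i * E i * E j - (q + q^-1)%R *: (E i * E j * E i)
            + E j * E i * E i) 0
| Uq_FFF i j : adjacent i j ->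
    Uq_rel (F i * F i * F j - (q + q^-1)%R *: (F i * F j * F i)
            + F j * F i * F i) 0
| Uq_EE i j : ~~ adjacent i j -> Uq_rel (E i * E j - E j * E i) 0
| Uq_FF i j : ~~ adjacent i j -> Uq_rel (F i * F j - F j * F i) 0.
End Rel.

Definition Uq_aug (x : Uq_gens r) : k :=
  match x with gE _ | gF _ => 0 | gK _ | gKi _ => 1 end.

Fact Uq_augP : respects Uq_rel (Uq_aug : _ -> k^o).
Proof.
move=> _ _ [i j|i|i|i j|i j|i j|i j _|i j _|i j _|i j _] //=;
  rewrite ?(mulr0, mul0r, mulr1, mul1r, scale1r, addr0, scale0r) //.
by rewrite scaleN1r subrr mulr0.
Qed.

Definition Uq_pres : presentation k := Presentation Uq_augP.
(* U_q(sl_(r+1)), with generators indexed by i = 0, ..., r - 1. *)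
Definition Uq : algType k := pres_alg Uq_pres.

Definition UE (i : 'I_r) : Uq := pgen Uq_pres (gE i).
Definition UF (i : 'I_r) : Uq := pgen Uq_pres (gF i).
Definition UK (i : 'I_r) : Uq := pgen Uq_pres (gK i).
Definition UKi (i : 'I_r) : Uq := pgen Uq_pres (gKi i).

End Uq.

(* If (x, y) and (x', y') satisfy the quantum Serre relation, so does
   (x + x', y + y') as soon as x', y' q-commute with x, y as below. *)
Section SerreSum.
Variables (k : fieldType) (W : algType k) (p : k).
Hypothesis p0 : p != 0.

Let c := p + p^-1.
Let B (x x' y : W) := x * x' * y - c *: (x * y * x') + y * x * x'.

Let BDl x1 x2 x' y : B (x1 + x2) x' y = B x1 x' y + B x2 x' y.
Proof.
rewrite /B !(mulrDl, mulrDr) scalerDr opprD.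
by rewrite [RHS]addrACA; congr (_ + _); rewrite addrACA.
Qed.

Let BDm x x1 x2 y : B x (x1 + x2) y = B x x1 y + B x x2 y.
Proof.
rewrite /B !(mulrDl, mulrDr) scalerDr opprD.
by rewrite [RHS]addrACA; congr (_ + _); rewrite addrACA.
Qed.

Let BDr x x' y1 y2 : B x x' (y1 + y2) = B x x' y1 + B x x' y2.
Proof.
rewrite /B !(mulrDl, mulrDr) scalerDr opprD.
by rewrite [RHS]addrACA; congr (_ + _); rewrite addrACA.
Qed.

Lemma serre_sum (x X y Y : W) :
  X * x = p ^+ 2 *: (x * X) -> X * y = p^-1 *: (y * X) ->
  Y * x = p^-1 *: (x * Y) ->
  x * x * y - c *: (x * y * x) + y * x * x = 0 ->
  X * X * Y - c *: (X * Y * X) + Y * X * X = 0 ->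
  (x + X) * (x + X) * (y + Y) - c *: ((x + X) * (y + Y) * (x + X))
    + (y + Y) * (x + X) * (x + X) = 0.
Proof.
move=> Xx Xy Yx Sxy SXY; rewrite -/(B _ _ _).
have A (u v w u' : W) d : u * v = d *: u' -> w * u * v = d *: (w * u').
  by move=> uv; rewrite -mulrA uv scalerAr.
rewrite BDr !BDl !BDm [B x x y]Sxy [B X X Y]SXY.
have -> : B x x Y = 0.
  rewrite /B (A _ _ _ _ _ Yx) Yx -!scalerAl (A _ _ _ _ _ Yx) !mulrA !scalerA.
  rewrite -scaleNr -[X in X + _ + _]scale1r -!scalerDl.
  by rewrite (_ : _ + _ = 0) ?scale0r // /c; field.
have -> : B X X y = 0.
  rewrite /B (A _ _ _ _ _ Xy) !mulrA !Xy -!scalerAl !scalerA.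
  rewrite -scaleNr -[X in _ + _ + X]scale1r -!scalerDl.
  by rewrite (_ : _ + _ = 0) ?scale0r // /c; field.
rewrite !add0r !addr0.
have sum0 (u v : W) a1 a2 a3 b1 b2 b3 : a1 + a2 + a3 = 0 -> b1 + b2 + b3 = 0 ->
    a1 *: u + a2 *: u + b1 *: v + (a3 *: u + b2 *: v + b3 *: v) = 0.
  move=> a0 b0; rewrite -[_ + b3 *: v]addrA addrACA.
  by rewrite -!scalerDl (addrA b1) a0 b0 !scale0r addr0.
have -> : B x X y + B X x y = 0.
  rewrite /B (A _ _ _ _ _ Xy) Xx !Xy -!scalerAl (A _ _ _ _ _ Xy) !mulrA.
  rewrite (A _ _ _ _ _ Xx) !mulrA !scalerA -!scaleNr.
  rewrite -[X in _ + X + _ = _]scale1r.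
  by apply: sum0; rewrite /c; field.
rewrite add0r /B Xx !Yx (A _ _ _ _ _ Yx) (A _ _ _ _ _ Xx) -!scalerAl.
rewrite !mulrA Xx Yx -!scalerAl !scalerA -!scaleNr addrC.
rewrite -[X in _ + (X + _ + _) = _]scale1r.
by apply: sum0; rewrite /c; field.
Qed.

End SerreSum.

Section Coproduct.
Variables (k : fieldType) (r : nat) (q : k).
Hypothesis q0 : q != 0.

Local Notation U := (Uq r q).
Local Notation E := (@UE k r q).
Local Notation F := (@UF k r q).
Local Notation K := (@UK k r q).
Local Notation Ki := (@UKi k r q).
Local Notation a := (@cartan r).

Let rel t u (h : @Uq_rel k r q t u) := @pgen_rels k (Uq_pres r q) t u h.

Lemma UKK i j : K i * K j = K j * K i.
Proof. exact: (rel (Uq_KK q i j)). Qed.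
Lemma UKKi i : K i * Ki i = 1.
Proof. by have := rel (Uq_KKi q i); rewrite /= scale1r. Qed.
Lemma UKiK i : Ki i * K i = 1.
Proof. by have := rel (Uq_KiK q i); rewrite /= scale1r. Qed.
Lemma UKE i j : K i * E j = q ^ a i j *: (E j * K i).
Proof. by have := rel (Uq_KE q i j); rewrite /= -scalerAl mul1r. Qed.
Lemma UKF i j : K i * F j = q ^ (- a i j) *: (F j * K i).
Proof. by have := rel (Uq_KF q i j); rewrite /= -scalerAl mul1r. Qed.
Lemma UEF i j :
  E i * F j - F j * E i = ((i == j)%:R / (q - q^-1)) *: (K i - Ki i).
Proof.
have := rel (Uq_EF q i j).
by rewrite /= -!scalerAl !mul1r !scaleN1r.
Qed.
Lemma UEEE i j : adjacent i j ->
  E i * E i * E j - (q + q^-1) *: (E i * E j * E i) + E j * E i * E i = 0.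
Proof.
move=> ij; have := rel (Uq_EEE q ij).
by rewrite /= -!scalerAl !mul1r !scaleN1r scale0r.
Qed.
Lemma UFFF i j : adjacent i j ->
  F i * F i * F j - (q + q^-1) *: (F i * F j * F i) + F j * F i * F i = 0.
Proof.
move=> ij; have := rel (Uq_FFF q ij).
by rewrite /= -!scalerAl !mul1r !scaleN1r scale0r.
Qed.
Lemma UEE i j : ~~ adjacent i j -> E i * E j = E j * E i.
Proof.
move=> ij; have := rel (Uq_EE q ij).
by rewrite /= -!scalerAl !mul1r !scaleN1r scale0r => /subr0_eq.
Qed.
Lemma UFF i j : ~~ adjacent i j -> F i * F j = F j * F i.
Proof.
move=> ij; have := rel (Uq_FF q ij).
by rewrite /= -!scalerAl !mul1r !scaleN1r scale0r => /subr0_eq.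
Qed.

Lemma UKiF i j : Ki i * F j = q ^ (a i j) *: (F j * Ki i).
Proof.
have XK : F j * K i = q ^ (a i j) *: (K i * F j).
  by rewrite UKF scalerA -expfzDr // subrr expr0z scale1r.
rewrite -[LHS]mulr1 -(UKKi i) mulrA -(mulrA (Ki i)) XK -scalerAr -scalerAl.
by rewrite mulrA UKiK mul1r.
Qed.

Lemma UFKi i j : F j * Ki i = q ^ (- a i j) *: (Ki i * F j).
Proof. by rewrite UKiF scalerA -expfzDr // addNr expr0z scale1r. Qed.

Lemma UKKiC i j : K i * Ki j = Ki j * K i.
Proof.
by rewrite -[LHS]mul1r -(UKiK j) -mulrA (mulrA (K j)) UKK -mulrA UKKi mulr1.
Qed.

Lemma UKiE i j : Ki i * E j = q ^ (- a i j) *: (E j * Ki i).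
Proof.
have XK : E j * K i = q ^ (- a i j) *: (K i * E j).
  by rewrite UKE scalerA -expfzDr // addNr expr0z scale1r.
rewrite -[LHS]mulr1 -(UKKi i) mulrA -(mulrA (Ki i)) XK -scalerAr -scalerAl.
by rewrite mulrA UKiK mul1r.
Qed.

Lemma UKiKi i j : Ki i * Ki j = Ki j * Ki i.
Proof.
have h : Ki j * Ki i * (K i * K j) = 1.
  by rewrite mulrA -(mulrA (Ki j)) UKiK mulr1 UKiK.
by rewrite -[LHS]mul1r -h -!mulrA (mulrA (K i)) UKK -!mulrA
           (mulrA (K i)) UKKi mul1r UKKi mulr1.
Qed.

Lemma cartanC i j : a i j = a j i.
Proof.
rewrite /cartan eq_sym /adjacent orbC.
by rewrite (eq_sym i.+1).
Qed.
Lemma cartan_diag i : a i i = 2.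
Proof. by rewrite /cartan eqxx. Qed.
Lemma cartan_adj i j : adjacent i j -> a i j = -1.
Proof.
rewrite /cartan => ij; case: eqP ij => [->|_ -> //].
by rewrite /adjacent orbb eqn_leq ltnn.
Qed.

Definition comul_gens (x : Uq_gens r) :
    pres_alg (tens (Uq_pres r q) (Uq_pres r q)) :=
  match x with
  | gE i => E i ⊗ 1 + K i ⊗ E i
  | gF i => F i ⊗ Ki i + 1 ⊗ F i
  | gK i => K i ⊗ K i
  | gKi i => Ki i ⊗ Ki i
  end.

Fact comul_subproof : respects (@rels _ (Uq_pres r q)) comul_gens.
Proof.
move=> _ _ [i j|i|i|i j|i j|i j|i j ij|i j ij|i j ij|i j ij] //=;
  rewrite -?scalerAl ?mul1r ?scale1r ?scaleN1r ?scale0r.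
- by rewrite !tensorM UKK.
- by rewrite tensorM UKKi tensor11.
- by rewrite tensorM UKiK tensor11.
- rewrite mulrDr mulrDl !tensorM !UKE mulr1 mul1r tensorZl tensorZr UKK.
  by rewrite scalerDr.
- rewrite mulrDr mulrDl !tensorM !UKF mulr1 mul1r tensorZl tensorZr.
  by rewrite UKKiC scalerDr.
- rewrite !mulrDr !mulrDl !tensorM !mulr1 !mul1r opprD.
  have -> : (K i * F j) ⊗ (E i * Ki j) = (F j * K i) ⊗ (Ki j * E i).
    by rewrite UKF UKiE tensorZl tensorZr cartanC.
  have h (V : zmodType) (u u' v v' x e : V) :
      u + x + (e + v) + (- (u' + e) - (x + v')) = (u - u') + (v - v').
    by rewrite [X in X + _]addrACA [LHS]addrACA (addrC u' e) (addrC x v) !addrKA.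
  rewrite h -tensorBl -tensorBr !UEF; case: eqP => [<-|_]; last first.
    by rewrite !mul0r !scale0r tensor0l tensor0r addr0.
  rewrite tensorZl tensorZr -scalerDr tensorBl tensorBr.
  by rewrite [X in _ *: X]addrC subrKA.
- have aij := cartan_adj ij; have aji : a j i = -1 by rewrite cartanC.
  apply: (@serre_sum _ _ q q0); rewrite ?tensorM ?mulr1 ?mul1r.
  + by rewrite UKE cartan_diag tensorZl.
  + by rewrite UKE aij tensorZl.
  + by rewrite UKE aji tensorZl.
  + by rewrite -tensorZl -tensorBl -tensorDl UEEE ?tensor0l.
  + rewrite -(mulrA (K i)) (UKK i j) mulrA (UKK i j).
    by rewrite -tensorZr -tensorBr -tensorDr UEEE ?tensor0r.
- have aij := cartan_adj ij; have aji : a j i = -1 by rewrite cartanC.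
  have -> : q + q^-1 = q^-1 + q^-1^-1 by rewrite invrK addrC.
  apply: (@serre_sum _ _ q^-1); rewrite ?invr_eq0 ?tensorM ?mulr1 ?mul1r //.
  + by rewrite UFKi cartan_diag tensorZr exprVn.
  + by rewrite UFKi aji tensorZr invrK opprK.
  + by rewrite UFKi aij tensorZr invrK opprK.
  + rewrite -(mulrA (Ki i)) (UKiKi i j) mulrA (UKiKi i j) invrK [_ + q]addrC.
    by rewrite -tensorZl -tensorBl -tensorDl UFFF ?tensor0l.
  + rewrite invrK [_ + q]addrC.
    by rewrite -tensorZr -tensorBr -tensorDr UFFF ?tensor0r.
- have [->|ne] := eqVneq i j; first by rewrite subrr.
  have aij : a i j = 0 by rewrite /cartan (negPf ne) (negPf ij).
  have aji : a j i = 0 by rewrite cartanC.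
  rewrite !mulrDr !mulrDl !tensorM !mulr1 !mul1r !UKE aij aji !expr0z !scale1r.
  by rewrite (UEE ij) (UKK i j) [X in _ - X]addrACA subrr.
- have [->|ne] := eqVneq i j; first by rewrite subrr.
  have aij : a i j = 0 by rewrite /cartan (negPf ne) (negPf ij).
  have aji : a j i = 0 by rewrite cartanC.
  rewrite !mulrDr !mulrDl !tensorM !mulr1 !mul1r !UFKi aij aji oppr0 !expr0z.
  by rewrite !scale1r (UFF ij) (UKiKi i j) [X in _ - X]addrACA subrr.
Qed.

Definition comul := lift_of comul_subproof.
HB.instance Definition _ := GRing.LRMorphism.on comul.

Definition counit : U -> k^o :=
  @lift_of k (Uq_pres r q) k^o (@Uq_aug k r) (@Uq_augP k r q).
HB.instance Definition _ := GRing.LRMorphism.on counit.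

Definition is_module (V : lmodType k) (act : U -> V -> V) : Prop :=
  [/\ forall xi, linear (act xi),
      forall v, linear (act^~ v),
      forall v, act 1 v = v &
      forall xi eta v, act (xi * eta) v = act xi (act eta v)].

(* The last condition is xi (f g) = \sum (xi_(1) f) (xi_(2) g), where the sum
   runs over any expression of Delta(xi) as a finite sum of pure tensors. *)
Definition is_module_algebra (A : algType k) (act : U -> A -> A) : Prop :=
  [/\ is_module act,
      forall xi, act xi 1 = counit xi *: 1 &
      forall (xi : U) (s : seq (U * U)) (f g : A),
        comul xi = \sum_(p <- s) p.1 ⊗ p.2 ->
        act xi (f * g) = \sum_(p <- s) act p.1 f * act p.2 g].

Definition is_module_morphism (V W : lmodType k)
    (actV : U -> V -> V) (actW : U -> W -> W) (h : V -> W) : Prop :=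
  linear h /\ forall xi v, h (actV xi v) = actW xi (h v).

End Coproduct.

Section QuantumMatrices.
Variables (k : fieldType) (n : nat) (q : k).

Section Rel.
Local Notation z a al := (Gen (a, al)).

(* The generator z_a^al is [(a, al)]: lower index first. *)
Inductive qmat_rel : term k ('I_n * 'I_n) -> term k ('I_n * 'I_n) -> Prop :=
| qmat_q (a al b be : 'I_n) :
    (a = b /\ (al < be)%N) \/ ((a < b)%N /\ al = be) ->
    qmat_rel (z a al * z b be) (q *: (z b be * z a al))
| qmat_comm (a al b be : 'I_n) : (a < b)%N -> (al > be)%N ->
    qmat_rel (z a al * z b be) (z b be * z a al)
| qmat_cross (a al b be : 'I_n) : (a < b)%N -> (al < be)%N ->
    qmat_rel (z a al * z b be)
             (z b be * z a al + (q - q^-1)%R *: (z a be * z b al)).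
End Rel.

Fact qmat_augP : respects qmat_rel ((fun=> 0) : _ -> k^o).
Proof. by move=> _ _ [] *; rewrite /= ?mulr0 ?addr0. Qed.

Definition qmat_pres : presentation k := Presentation qmat_augP.
Definition qmat : algType k := pres_alg qmat_pres.
Definition zgen (a al : 'I_n) : qmat := pgen qmat_pres (a, al).

End QuantumMatrices.

Section Bimodule.
Variables (k : fieldType) (A : algType k) (X : Type).

Inductive bterm : Type :=
| BGen of X
| BZero
| BAdd of bterm & bterm
| BL of A & bterm
| BR of bterm & A.

Variable brel : bterm -> bterm -> Prop.

Inductive bcong : bterm -> bterm -> Prop :=
| bc_rel t u : brel t u -> bcong t u
| bc_refl t : bcong t t
| bc_sym t u : bcong t u -> bcong u t
| bc_trans t u v : bcong t u -> bcong u v -> bcong t v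
| bc_add t t' u u' : bcong t t' -> bcong u u' -> bcong (BAdd t u) (BAdd t' u')
| bc_L a t t' : bcong t t' -> bcong (BL a t) (BL a t')
| bc_R a t t' : bcong t t' -> bcong (BR t a) (BR t' a)
| bc_addA t u v : bcong (BAdd t (BAdd u v)) (BAdd (BAdd t u) v)
| bc_addC t u : bcong (BAdd t u) (BAdd u t)
| bc_add0 t : bcong (BAdd BZero t) t
| bc_addN t : bcong (BAdd (BL (-1) t) t) BZero
| bc_L1 t : bcong (BL 1 t) t
| bc_LM a b t : bcong (BL (a * b) t) (BL a (BL b t))
| bc_LDl a b t : bcong (BL (a + b) t) (BAdd (BL a t) (BL b t))
| bc_LDr a t u : bcong (BL a (BAdd t u)) (BAdd (BL a t) (BL a u))
| bc_R1 t : bcong (BR t 1) t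
| bc_RM a b t : bcong (BR t (a * b)) (BR (BR t a) b)
| bc_RDr a b t : bcong (BR t (a + b)) (BAdd (BR t a) (BR t b))
| bc_RDl a t u : bcong (BR (BAdd t u) a) (BAdd (BR t a) (BR u a))
| bc_LR a b t : bcong (BL a (BR t b)) (BR (BL a t) b)
| bc_cst (c : k) t : bcong (BL c%:A t) (BR t c%:A).

HB.instance Definition _ := gen_eqMixin bterm.
HB.instance Definition _ := gen_choiceMixin bterm.

Definition bcongb (t u : bterm) : bool := `[< bcong t u >].

Lemma bcongb_refl : reflexive bcongb.
Proof. by move=> t; apply/asboolP/bc_refl. Qed.

Lemma bcongb_sym : symmetric bcongb.
Proof. by move=> t u; apply/asboolP/asboolP => /bc_sym. Qed.

Lemma bcongb_trans : transitive bcongb.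
Proof.
by move=> u t v /asboolP tu /asboolP uv; apply/asboolP/(bc_trans tu uv).
Qed.

Canonical bcong_equiv := EquivRel bcongb bcongb_refl bcongb_sym bcongb_trans.

Definition pres_bimod : Type := {eq_quot bcong_equiv}.

HB.instance Definition _ : EqQuotient bterm bcong_equiv pres_bimod :=
  EqQuotient.on pres_bimod.
HB.instance Definition _ := Choice.on pres_bimod.

Definition bclass (t : bterm) : pres_bimod := \pi_pres_bimod t.

Lemma bclassP t u : bclass t = bclass u <-> bcong t u.
Proof. by split=> [/eqmodP/asboolP|tu]; [|apply/eqmodP/asboolP]. Qed.

Lemma bclass_ind (Q : pres_bimod -> Prop) :
  (forall t, Q (bclass t)) -> forall x, Q x.
Proof. by move=> Qt x; rewrite -[x]reprK; apply: Qt. Qed.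

Lemma repr_bclass t : bcong (repr (bclass t)) t.
Proof. by apply/bclassP; rewrite {1}/bclass reprK. Qed.

Definition bm_add (x y : pres_bimod) := bclass (BAdd (repr x) (repr y)).
Definition lact (a : A) (x : pres_bimod) := bclass (BL a (repr x)).
Definition ract (x : pres_bimod) (a : A) := bclass (BR (repr x) a).

Lemma bm_addE t u : bm_add (bclass t) (bclass u) = bclass (BAdd t u).
Proof. by apply/bclassP/bc_add; apply: repr_bclass. Qed.

Lemma lactE a t : lact a (bclass t) = bclass (BL a t).
Proof. by apply/bclassP/bc_L/repr_bclass. Qed.

Lemma ractE a t : ract (bclass t) a = bclass (BR t a).
Proof. by apply/bclassP/bc_R/repr_bclass. Qed.

Fact bm_addA : associative bm_add.
Proof.
elim/bclass_ind=> t; elim/bclass_ind=> u; elim/bclass_ind=> v.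
by rewrite !bm_addE; apply/bclassP/bc_addA.
Qed.

Fact bm_addC : commutative bm_add.
Proof.
elim/bclass_ind=> t; elim/bclass_ind=> u.
by rewrite !bm_addE; apply/bclassP/bc_addC.
Qed.

Fact bm_add0 : left_id (bclass BZero) bm_add.
Proof. by elim/bclass_ind=> t; rewrite bm_addE; apply/bclassP/bc_add0. Qed.

Fact bm_addN : left_inverse (bclass BZero) (lact (-1)) bm_add.
Proof.
by elim/bclass_ind=> t; rewrite lactE bm_addE; apply/bclassP/bc_addN.
Qed.

HB.instance Definition _ :=
  GRing.isZmodule.Build pres_bimod bm_addA bm_addC bm_add0 bm_addN.

Lemma bclassD t u : bclass (BAdd t u) = bclass t + bclass u.
Proof. by rewrite [RHS]/+%R/= bm_addE. Qed.

Lemma lactM a b x : lact (a * b) x = lact a (lact b x).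
Proof. by elim/bclass_ind: x => t; rewrite !lactE; apply/bclassP/bc_LM. Qed.

Lemma lact1 x : lact 1 x = x.
Proof. by elim/bclass_ind: x => t; rewrite !lactE; apply/bclassP/bc_L1. Qed.

Lemma lactDl a b x : lact (a + b) x = lact a x + lact b x.
Proof.
elim/bclass_ind: x => t; rewrite !lactE -bclassD; exact/bclassP/bc_LDl.
Qed.

Lemma lactDr a x y : lact a (x + y) = lact a x + lact a y.
Proof.
elim/bclass_ind: x => t; elim/bclass_ind: y => u.
by rewrite -bclassD !lactE -bclassD; apply/bclassP/bc_LDr.
Qed.

Lemma ractM a b x : ract x (a * b) = ract (ract x a) b.
Proof. by elim/bclass_ind: x => t; rewrite !ractE; apply/bclassP/bc_RM. Qed.

Lemma ract1 x : ract x 1 = x.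
Proof. by elim/bclass_ind: x => t; rewrite !ractE; apply/bclassP/bc_R1. Qed.

Lemma ractDr a b x : ract x (a + b) = ract x a + ract x b.
Proof.
elim/bclass_ind: x => t; rewrite !ractE -bclassD; exact/bclassP/bc_RDr.
Qed.

Lemma ractDl a x y : ract (x + y) a = ract x a + ract y a.
Proof.
elim/bclass_ind: x => t; elim/bclass_ind: y => u.
by rewrite -bclassD !ractE -bclassD; apply/bclassP/bc_RDl.
Qed.

Lemma lractA a b x : lact a (ract x b) = ract (lact a x) b.
Proof.
by elim/bclass_ind: x => t; rewrite !(ractE, lactE); apply/bclassP/bc_LR.
Qed.

Definition bm_scale (c : k) (x : pres_bimod) := lact c%:A x.

Fact bm_scaleA c d x : bm_scale c (bm_scale d x) = bm_scale (c * d) x.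
Proof. by rewrite /bm_scale -lactM -scalerAl mul1r scalerA. Qed.

Fact bm_scale1 : left_id 1 bm_scale.
Proof. by move=> x; rewrite /bm_scale scale1r lact1. Qed.

Fact bm_scaleDr : right_distributive bm_scale +%R.
Proof. by move=> c x y; rewrite /bm_scale lactDr. Qed.

Fact bm_scaleDl x : {morph bm_scale^~ x : c d / c + d}.
Proof. by move=> c d; rewrite /bm_scale scalerDl lactDl. Qed.

HB.instance Definition _ := GRing.Zmodule_isLmodule.Build k pres_bimod
  bm_scaleA bm_scale1 bm_scaleDr bm_scaleDl.

Definition bgen (x : X) : pres_bimod := bclass (BGen x).

End Bimodule.

Section Forms.
Variables (k : fieldType) (n : nat) (q : k).
Local Notation A := (qmat n q).
Local Notation z := (@zgen k n q).

(* [Rmat b a b' a'] is R_{ba}^{b'a'}. *)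
Definition Rmat (b a b' a' : 'I_n) : k :=
  if (a == b) && (b == a') && (a' == b') then q^-1
  else if (a != b) && (a == a') && (b == b') then 1
  else if (a < b)%N && (a == b') && (b == a') then q^-1 - q
  else 0.

Inductive Omega_rel :
  bterm A ('I_n * 'I_n) -> bterm A ('I_n * 'I_n) -> Prop :=
| Omega_zdz (a al b be : 'I_n) :
    Omega_rel (BL (z b be) (BGen A (a, al)))
      (\big[@BAdd _ _ _/BZero _ _]_(al' < n) \big[@BAdd _ _ _/BZero _ _]_(be' < n)
       \big[@BAdd _ _ _/BZero _ _]_(a' < n) \big[@BAdd _ _ _/BZero _ _]_(b' < n)
         BL (Rmat be al be' al' * Rmat b a b' a')%:A
            (BR (BGen A (a', al')) (z b' be'))).

Definition Omega : lmodType k := pres_bimod Omega_rel.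
Definition dz (a al : 'I_n) : Omega := bgen Omega_rel (a, al).

Definition is_differential (d : A -> Omega) : Prop :=
  [/\ linear d,
      forall a al, d (z a al) = dz a al &
      forall f g, d (f * g) = ract (d f) g + lact f (d g)].

(* [D a al] is the operator d/dz_a^al. *)
Definition are_partials (d : A -> Omega) (D : 'I_n -> 'I_n -> A -> A) : Prop :=
  forall f, d f = \sum_(a < n) \sum_(al < n) lact (D a al f) (dz a al).

Definition perm_length (s : 'S_n) : nat :=
  #|[set p : 'I_n * 'I_n | (p.1 < p.2)%N && (s p.2 < s p.1)%N]|.

(* The composition is D_1^{s(1)} \o D_2^{s(2)} \o ... \o D_n^{s(n)}. *)
Definition box (D : 'I_n -> 'I_n -> A -> A) (f : A) : A :=
  \sum_(s : 'S_n) (- q) ^+ perm_length s *: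
     (\big[(fun g h => g \o h)/id]_(a < n) D a (s a)) f.

End Forms.

Section Actions.
Variables (R : realType) (n : nat) (q : R).
Local Open Scope complex_scope.

Definition Cq : R[i] := q%:C.

Definition Cqpow (x : R) : R[i] := (q `^ x)%:C.

(* The generator indices of U_q(sl_2n) are i = 0, ..., 2n - 2 and those of z
   are 0, ..., n - 1, so the 1-based indices are [i.+1], [a.+1], [al.+1]. *)
Local Notation U := (Uq n.*2.-1 Cq).
Local Notation A := (qmat n Cq).
Local Notation z := (@zgen R[i] n Cq).
Local Notation E := (@UE R[i] n.*2.-1 Cq).
Local Notation F := (@UF R[i] n.*2.-1 Cq).
Local Notation K := (@UK R[i] n.*2.-1 Cq).
Local Notation Ki := (@UKi R[i] n.*2.-1 Cq).

Variable act : U -> A -> A.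

(* Indices i.+1 = 1, ..., n - 1. *)
Definition left_action : Prop :=
  forall i : 'I_n.*2.-1, (i.+1 < n)%N -> forall a al : 'I_n,
  [/\ act (K i) (z a al) =
        (if a.+1 == i.+1 then Cq else if a.+1 == i.+2 then Cq^-1 else 1)
          *: z a al,
      a.+1 = i.+1 -> forall a' : 'I_n, a'.+1 = a.+2 ->
        act (F i) (z a al) = Cqpow (1 / 2) *: z a' al,
      a.+1 <> i.+1 -> act (F i) (z a al) = 0,
      a.+1 = i.+2 -> forall a' : 'I_n, a'.+2 = a.+1 ->
        act (E i) (z a al) = Cqpow (- (1 / 2)) *: z a' al &
      a.+1 <> i.+2 -> act (E i) (z a al) = 0].

(* Indices i.+1 = n + j with j = 1, ..., n - 1. *)
Definition right_action : Prop :=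
  forall (i : 'I_n.*2.-1) (j : nat), (0 < j)%N -> i.+1 = (n + j)%N ->
  forall a al : 'I_n,
  [/\ act (K i) (z a al) =
        (if al.+1 == (n - j)%N then Cq
         else if al.+1 == (n - j).+1 then Cq^-1 else 1) *: z a al,
      al.+1 = (n - j)%N -> forall al' : 'I_n, al'.+1 = al.+2 ->
        act (F i) (z a al) = Cqpow (1 / 2) *: z a al',
      al.+1 <> (n - j)%N -> act (F i) (z a al) = 0,
      al.+1 = (n - j).+1 -> forall al' : 'I_n, al'.+2 = al.+1 ->
        act (E i) (z a al) = Cqpow (- (1 / 2)) *: z a al' &
      al.+1 <> (n - j).+1 -> act (E i) (z a al) = 0].

(* Index i.+1 = n; here m.+1 = n, so that z m m is z_n^n. *)
Definition middle_action : Prop :=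
  forall (i : 'I_n.*2.-1) (m : 'I_n), i.+1 = n -> m.+1 = n ->
  forall a al : 'I_n,
  [/\ act (K i) (z a al) =
        (if (a == m) && (al == m) then Cq ^+ 2
         else if (a == m) || (al == m) then Cq else 1) *: z a al,
      act (F i) (z a al) =
        (if (a == m) && (al == m) then Cqpow (1 / 2) *: 1 else 0) &
      act (E i) (z a al) =
        (if (a != m) && (al != m) then
           - (Cqpow (- (1 / 2)) *: (z a m * z m al))
         else if (a == m) && (al == m) then
           - (Cqpow (1 / 2) *: (z m m) ^+ 2)
         else - (Cqpow (1 / 2) *: (z m m * z a al)))].

Definition is_initial_action (q0 : Cq != 0) : Prop :=
  [/\ is_module_algebra q0 act, left_action, right_action & middle_action].

Definition is_twisted_action (lam : R) (pi : U -> A -> A) : Prop :=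
  [/\ is_module pi,
      forall (j : 'I_n.*2.-1) f, j.+1 <> n ->
        [/\ pi (K j) f = act (K j) f, pi (Ki j) f = act (Ki j) f,
            pi (F j) f = act (F j) f & pi (E j) f = act (E j) f] &
      forall (j : 'I_n.*2.-1) (m : 'I_n) f, j.+1 = n -> m.+1 = n ->
        [/\ pi (K j) f = Cqpow lam *: act (K j) f,
            pi (Ki j) f = Cqpow (- lam) *: act (Ki j) f,
            pi (F j) f = Cqpow (- lam) *: act (F j) f &
            pi (E j) f = act (E j) f -
              (Cqpow (1 / 2) * ((1 - Cqpow (2 * lam)) / (1 - Cq ^+ 2))) *:
                (act (K j) f * z m m)]].

End Actions.

Lemma Cq_neq0 (R : realType) (q : R) : 0 < q < 1 -> Cq q != 0.
Proof. by case/andP=> q0 _; rewrite /Cq fmorph_eq0 gt_eqF. Qed.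

(* Main.v *)
Require Import Defs.
From mathcomp Require Import all_boot all_order all_algebra fingroup perm.
From mathcomp Require Import reals exp complex ring zify.

Set Implicit Arguments.
Unset Strict Implicit.
Unset Printing Implicit Defensive.

Import Order.TTheory GRing.Theory Num.Theory.
Local Open Scope ring_scope.

(** Write T for the l-th power of the wave operator, p for pi_(n-l) and p' for
pi_(n+l). Each F_j is a twisted derivation of the algebra of quantum matrices
and moves past the partial derivatives by an explicit rule, in which the index
of a derivative may be lowered. In the alternating sum that defines the wave
operator the correction terms cancel in pairs, so the wave operator commutes
with F_j for j <> n, and with F_n up to the scalar q^2 ([box_fr], [box_fc],
[box_fm]). Thus T intertwines the two actions of every F_j, and it intertwines
the actions of the K_j because it lowers every row and column degree by l.

The E_i are reached by rigidity. An element that all the F_j annihilate is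
constant ([joint_kernel]), and the F_j lower a height that is nonnegative on
nonzero elements. By induction on the height, a homogeneous operator L such that
L (F_j g) = 0 implies F_j (L g) = 0 is zero as soon as no value of L is a nonzero
constant ([rigidity]). This applies to L = T p(E_i) - p'(E_i) T: since
[E_i, F_j] is a combination of K_i and its inverse, p'(F_j) L = L p(F_j), and it
remains to see that the constant term of T (p(E_i) g) is zero. The functional
phi g = (constant term of T g) kills the image of F_j for j <> n. For i <> n the
claim is then a fact on sl_2: a functional that kills the image of F kills E v
when v has weight -2 ([invariant_sl2]). For i = n the parameter enters:
phi (E_n g) is a multiple of phi (g z_n^n) ([invariant_raising]), and the extra
term of the twisted action cancels it exactly for lambda = n - l
([invariant_E_mid]).

No basis of the algebra of quantum matrices is used. The joint kernel is found
from a closed formula ([conformal_raising]), in which E_n g is a combination of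
g z_n^n and of the products X_b(g) z_b^n, where X_b is an iterated q-commutator
of F_b, ..., F_(n-1): on an element killed by all the F_j the operator E_n is
multiplication by a multiple of z_n^n, and the commutators [E_j, F_j] force its
column degrees to be zero.

Rigidity also proves the quadratic relations between the partial derivatives
([partial_relations]), on which [box_fr] depends. The rules for the derivatives
themselves come from coordinates: one-forms are mapped to the free left module
on the dz, on which the right action is defined by two commuting R-matrix
extensions of right multiplication ([form_coord], [partialM]).

Indices start at 0, so that the last index plays the role of n. *)

(** * Comparing linear combinations *)
Section LinearCombinations.
Variables (k : fieldType) (V : lmodType k).

(** Formal linear combinations of the entries of a list of vectors. They serve to
reduce an equality of vectors of an abstract module to equalities of
coefficients, which field arithmetic decides. *)
Inductive lexp := LV of nat | LA of lexp & lexp | LO of lexp | LS of k & lexp | LZ.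

(** A test on closed numerals that [cbn] evaluates without unfolding the
arithmetic of the coefficients. *)
Fixpoint same_index (i j : nat) : bool :=
  match i, j with
  | O, O => true
  | S i', S j' => same_index i' j'
  | _, _ => false
  end.

Lemma same_indexE i j : same_index i j = (i == j).
Proof. by elim: i j => [|i IHi] [|j] //=; rewrite IHi. Qed.

Fixpoint lden (env : seq V) (e : lexp) : V :=
  match e with
  | LV j => nth 0 env j
  | LA x y => lden env x + lden env y
  | LO x => - lden env x
  | LS c x => c *: lden env x
  | LZ => 0
  end.

Fixpoint lcoef (i : nat) (e : lexp) : k :=
  match e with
  | LV j => if same_index i j then 1 else 0
  | LA x y => lcoef i x + lcoef i y
  | LO x => - lcoef i x
  | LS c x => c * lcoef i x
  | LZ => 0
  end.

Fixpoint lcheck (m : nat) (e1 e2 : lexp) : Prop :=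
  if m is m'.+1 then lcoef m' e1 = lcoef m' e2 /\ lcheck m' e1 e2 else True.

Lemma ldenE env e : lden env e = \sum_(i < size env) lcoef i e *: nth 0 env i.
Proof.
elim: e => [j|x IHx y IHy|x IHx|c x IHx|] /=.
- have [lt_j|le_j] := ltnP j (size env).
    rewrite (bigD1 (Ordinal lt_j)) //= same_indexE eqxx scale1r big1 ?addr0 //= => i ij.
    by rewrite same_indexE -val_eqE /= in ij *; rewrite (negPf ij) scale0r.
  rewrite nth_default // big1 // => i _; rewrite same_indexE.
  by rewrite ltn_eqF ?scale0r // (leq_trans (ltn_ord i)).
- by rewrite IHx IHy -big_split; apply: eq_bigr => i _; rewrite scalerDl.
- by rewrite IHx -sumrN; apply: eq_bigr => i _; rewrite scaleNr.
- by rewrite IHx scaler_sumr; apply: eq_bigr => i _; rewrite scalerA.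
- by rewrite big1 // => i _; rewrite scale0r.
Qed.

Lemma lmod_eq env e1 e2 : lcheck (size env) e1 e2 -> lden env e1 = lden env e2.
Proof.
move=> h; rewrite !ldenE; apply: eq_bigr => -[i /= lt_i] _; congr (_ *: _).
elim: (size env) h lt_i => //= m IHm [h1 h2].
by rewrite ltnS leq_eqVlt => /orP[/eqP-> //|]; apply: IHm.
Qed.
End LinearCombinations.

Lemma natr_bool (k : fieldType) : ((true%:R = 1 :> k) * (false%:R = 0 :> k))%type.
Proof. by []. Qed.

(** Products are compared factor by factor, since convertible instances of the
multiplication occur in the same goal. *)
Ltac same_term x t :=
  match constr:(tt) with
  | _ => let _ := match constr:(tt) with _ => constr_eq x t end in constr:(true)
  | _ =>
    lazymatch x with
    | (?x1 * ?x2)%R =>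
      lazymatch t with
      | (?t1 * ?t2)%R =>
        let b := same_term x1 t1 in
        lazymatch b with true => same_term x2 t2 | false => constr:(false) end
      | _ => constr:(false)
      end
    | _ => constr:(false)
    end
  end.
Ltac latoms env t :=
  lazymatch t with
  | (?a + ?b)%R => let env := latoms env a in latoms env b
  | (- ?a)%R => latoms env a
  | (?c *: ?a)%R => latoms env a
  | 0%R => env
  | _ => let rec mem l := lazymatch l with
           | nil => constr:(cons t env)
           | cons ?x ?l' => let b := same_term x t in lazymatch b with true => env | false => mem l' end end
         in mem env
  end.
Ltac lindex t env :=
  lazymatch env with
  | cons ?x ?l =>
    let b := same_term x t in
    lazymatch b with
    | true => constr:(0%N)
    | false => let i := lindex t l in constr:(S i)
    end
  end.
Ltac lreify k env t :=
  lazymatch t with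
  | (?a + ?b)%R => let x := lreify k env a in let y := lreify k env b in
                   constr:(@LA k x y)
  | (- ?a)%R => let x := lreify k env a in constr:(@LO k x)
  | (?c *: ?a)%R => let x := lreify k env a in constr:(@LS k c x)
  | 0%R => constr:(@LZ k)
  | _ => let i := lindex t env in constr:(@LV k i)
  end.
(** Replaces an equality of linear combinations by the equalities of the
coefficients of each atom. *)
Ltac lmod k :=
  lazymatch goal with
  | |- @eq ?V ?t ?u =>
    let env := latoms (@nil V) t in let env := latoms env u in
    let x := lreify k env t in let y := lreify k env u in
    apply: (@lmod_eq k _ env x y); cbn [lcheck lcoef size same_index];
    repeat split; rewrite ?(mulr1, mulr0, addr0, add0r, oppr0)
  end.

Ltac lfield k := rewrite ?natr_bool; lmod k; try done; field; do ?[apply/andP; split]; try done.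

(** * Linear maps and right actions *)
Section RawLinear.
Variables (k : fieldType) (V W : lmodType k) (f : V -> W).
Hypothesis lf : linear f.

Lemma rlinD u v : f (u + v) = f u + f v.
Proof. by rewrite -[u]scale1r lf !scale1r. Qed.
Lemma rlin0 : f 0 = 0.
Proof. by apply: (addrI (f 0)); rewrite -rlinD !addr0. Qed.
Lemma rlinZ a u : f (a *: u) = a *: f u.
Proof. by rewrite -[a *: u]addr0 lf rlin0 addr0. Qed.
Lemma rlinN u : f (- u) = - f u.
Proof. by rewrite -scaleN1r rlinZ scaleN1r. Qed.
Lemma rlinB u v : f (u - v) = f u - f v.
Proof. by rewrite rlinD rlinN. Qed.
Lemma rlin_sum (I : Type) (r : seq I) (Q : pred I) (F : I -> V) :
  f (\sum_(i <- r | Q i) F i) = \sum_(i <- r | Q i) f (F i).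
Proof. exact: (big_morph f rlinD rlin0). Qed.
End RawLinear.

Section RightAction.
Variables (k : fieldType) (P : presentation k) (V : lmodType k).
Variable op : gens P -> V -> V.

(** Operators attached to the generators extend to a right action of the free
algebra, hence to the presented algebra when they satisfy its relations. *)
Fixpoint term_ract (t : term k (gens P)) (v : V) : V :=
  match t with
  | Gen x => op x v
  | Cst c => c *: v
  | TAdd t u => term_ract t v + term_ract u v
  | TMul t u => term_ract u (term_ract t v)
  end.

Hypothesis op_lin : forall x, linear (op x).
Hypothesis op_rel : forall t u, @rels _ P t u -> term_ract t =1 term_ract u.

Lemma term_ract_lin t : linear (term_ract t).
Proof.
elim: t => [x|c|t IHt u IHu|t IHt u IHu] a v w /=.
- exact: op_lin.
- by rewrite scalerDr !scalerA mulrC.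
- by rewrite IHt IHu scalerDr addrACA.
- by rewrite IHt IHu.
Qed.

Lemma term_ract_cong t u : pcong t u -> term_ract t =1 term_ract u.
Proof.
have tlin := term_ract_lin.
elim=> {t u} //=.
- by move=> t u _ tu v; rewrite tu.
- by move=> t u w _ tu _ uw v; rewrite tu.
- by move=> t t' u u' _ tt' _ uu' v; rewrite tt' uu'.
- by move=> t t' u u' _ tt' _ uu' v; rewrite tt' uu'.
- by move=> t u w v; rewrite addrA.
- by move=> t u v; rewrite addrC.
- by move=> t v; rewrite scale0r add0r.
- by move=> t v; rewrite scale0r scaleN1r (rlinN (tlin _)) addNr.
- by move=> t v; rewrite scale1r.
- by move=> t u w v; rewrite (rlinD (tlin _)).
- by move=> c d v; rewrite scalerDl.
- by move=> c d v; rewrite scalerA mulrC.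
- by move=> c t v; rewrite (rlinZ (tlin _)).
Qed.

Definition ralg_act (x : pres_alg P) (v : V) : V := term_ract (generic_quotient.repr x) v.

Lemma ralg_act_pclass t v : ralg_act (pclass t) v = term_ract t v.
Proof. exact/term_ract_cong/repr_pclass. Qed.

Lemma ralg_act_gen x v : ralg_act (pgen P x) v = op x v.
Proof. exact: ralg_act_pclass. Qed.

Lemma ralg_act_lin x : linear (ralg_act x).
Proof. exact: term_ract_lin. Qed.

Lemma ralg_actD x y v : ralg_act (x + y) v = ralg_act x v + ralg_act y v.
Proof.
elim/pclass_ind: x => t; elim/pclass_ind: y => u.
by rewrite -pclassD !ralg_act_pclass.
Qed.

Lemma ralg_actM x y v : ralg_act (x * y) v = ralg_act y (ralg_act x v).
Proof.
elim/pclass_ind: x => t; elim/pclass_ind: y => u.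
by rewrite -pclassM !ralg_act_pclass.
Qed.

Lemma ralg_actC c v : ralg_act c%:A v = c *: v.
Proof. by rewrite -pclassC ralg_act_pclass. Qed.

End RightAction.

(** * The R-matrix *)
Section RMatrix.
Variables (k : fieldType) (n : nat) (q : k).
Hypothesis q0 : q != 0.
Local Notation lam := (q - q^-1).

(** The relations of quantum matrices as satisfied by right multiplications:
[P c ga] stands for multiplication by z_c^ga on the right, so that products are
composed in the reverse order. *)
Definition qrel (V : lmodType k) (P : 'I_n -> 'I_n -> V -> V) : Prop :=
  [/\ forall c (ga de : 'I_n) v, (ga < de)%N -> P c de (P c ga v) = q *: P c ga (P c de v),
      forall (c d : 'I_n) ga v, (c < d)%N -> P d ga (P c ga v) = q *: P c ga (P d ga v),
      forall (c d ga de : 'I_n) v, (c < d)%N -> (de < ga)%N ->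
        P d de (P c ga v) = P c ga (P d de v) &
      forall (c d ga de : 'I_n) v, (c < d)%N -> (ga < de)%N ->
        P d de (P c ga v) = P c ga (P d de v) + lam *: P d ga (P c de v)].

Definition swap (V : Type) (P : 'I_n -> 'I_n -> V) : 'I_n -> 'I_n -> V :=
  fun a b => P b a.

Lemma qrel_swap (V : lmodType k) (P : 'I_n -> 'I_n -> V -> V) :
  qrel P -> qrel (swap P).
Proof.
case=> r1 r2 r3 r4; split; rewrite /swap.
- by move=> c ga de v h; apply: r2.
- by move=> c d ga v h; apply: r1.
- by move=> c d ga de v h h'; rewrite (r3 de ga d c).
- by move=> c d ga de v h h'; rewrite r4 // (r3 ga de d c).
Qed.

(** The inverse of the matrix [Rmat], acting on one pair of indices, as
[Rmat_rext] shows. This is the form that moves a differential from the left of a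
generator to its right. *)
Definition Rmx (V : lmodType k) (Y : 'I_n -> 'I_n -> V) (a c : 'I_n) : V :=
  (if a == c then q else 1) *: Y a c +
  (if a == c then lam *: \sum_(b < n | (b < a)%N) Y b b else 0).

(** Right multiplications on vectors of coordinates: multiplying the coordinates
on the right by z_c^ga mixes them through the R-matrix. *)
Definition rext (V : lmodType k) (P : 'I_n -> 'I_n -> V -> V) (c ga : 'I_n)
    (x : {ffun 'I_n -> V}) : {ffun 'I_n -> V} :=
  [ffun a => Rmx (fun a' c' => P c' ga (x a')) a c].

Definition dvec (V : lmodType k) (b : 'I_n) (v : V) : {ffun 'I_n -> V} :=
  [ffun a => if a == b then v else 0].

Lemma Rmx_map (V W : lmodType k) (g : V -> W) : linear g ->
  forall (Y : 'I_n -> 'I_n -> V) a c, g (Rmx Y a c) = Rmx (fun a c => g (Y a c)) a c.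
Proof.
move=> lg Y a c; rewrite /Rmx (rlinD lg) (rlinZ lg); case: eqP => _.
  by rewrite (rlinZ lg) (rlin_sum lg).
by rewrite (rlin0 lg).
Qed.

Lemma eq_Rmx (V : lmodType k) (X Y : 'I_n -> 'I_n -> V) a c :
  (forall a c, X a c = Y a c) -> Rmx X a c = Rmx Y a c.
Proof.
move=> XY; rewrite /Rmx XY; case: eqP => // _; congr (_ + _ *: _).
by apply: eq_bigr => b _; apply: XY.
Qed.

(** The R-matrices of the rows and of the columns act on different indices. *)
Lemma RmxC (V : lmodType k) (Y : 'I_n -> 'I_n -> 'I_n -> 'I_n -> V) a c al ga :
  Rmx (fun a c => Rmx (Y a c) al ga) a c =
  Rmx (fun al ga => Rmx (fun a c => Y a c al ga) a c) al ga.
Proof.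
have neqE (W : lmodType k) (X : 'I_n -> 'I_n -> W) b d : b != d -> Rmx X b d = X b d.
  by rewrite /Rmx => /negPf->; rewrite scale1r addr0.
have [<-|alga] := eqVneq al ga; last first.
  by rewrite [RHS]neqE //; apply: eq_Rmx => *; rewrite neqE.
have [<-|ac] := eqVneq a c; last first.
  by rewrite [LHS]neqE //; apply: eq_Rmx => *; rewrite neqE.
rewrite /Rmx !eqxx !big_split /= -!scaler_sumr exchange_big /=.
set S1 := \sum_(b < n | (b < al)%N) _; set S2 := \sum_(i < n | (i < a)%N) _.
by set S3 := \sum_(j < n | (j < al)%N) _; lfield k.
Qed.

Section Ext.
Variables (V : lmodType k) (P : 'I_n -> 'I_n -> V -> V).
Hypothesis Plin : forall c ga, linear (P c ga).

Lemma Rmx_lin (W : lmodType k) (X Y : 'I_n -> 'I_n -> W) e a c :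
  Rmx (fun a c => e *: X a c + Y a c) a c = e *: Rmx X a c + Rmx Y a c.
Proof.
rewrite /Rmx; case: eqP => _; last by rewrite !addr0 !scale1r.
rewrite big_split /= -scaler_sumr !scalerDr !scalerA [q * e]mulrC [lam * e]mulrC.
by rewrite addrACA.
Qed.

Lemma rext_lin c ga : linear (rext P c ga).
Proof.
move=> e x y; apply/ffunP => a; rewrite !ffunE -Rmx_lin.
rewrite /Rmx !ffunE !Plin; congr (_ + _); case: eqP => // _; congr (_ *: _).
by apply: eq_bigr => b _; rewrite !ffunE Plin.
Qed.

Lemma rext_dvec c ga b v : rext P c ga (dvec b v) =
  (if b == c then q else 1) *: dvec b (P c ga v) +
  (if (b < c)%N then lam else 0) *: dvec c (P b ga v).
Proof.
apply/ffunP => a; rewrite !ffunE /Rmx !ffunE.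
have P0 c' ga' : P c' ga' 0 = 0 by apply: rlin0.
have -> : \sum_(b0 < n | (b0 < a)%N) P b0 ga (dvec b v b0) =
    if (b < a)%N then P b ga v else 0.
  case: ifP => ba; last first.
    rewrite big1 // => i ia; rewrite ffunE; case: eqP => // ib.
    by rewrite ib ba in ia.
  rewrite (bigD1 b) //= big1 ?addr0 ?ffunE ?eqxx // => i /andP[_ ib].
  by rewrite ffunE (negPf ib).
have [->|ab] := eqVneq a b.
  have [->|bc] := eqVneq b c; last by rewrite scaler0 addr0.
  by rewrite ltnn scaler0 scale0r !addr0.
rewrite P0 scaler0 add0r; have [->|ac] := eqVneq a c.
  by case: ifP; rewrite ?scaler0 ?scale0r add0r.
by rewrite scaler0 scaler0 addr0.
Qed.

Lemma dvec_sum (x : {ffun 'I_n -> V}) : x = \sum_(b < n) dvec b (x b).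
Proof.
apply/ffunP=> a; rewrite sum_ffunE (bigD1 a) //= big1 ?addr0 ?ffunE ?eqxx //.
by move=> i ia; rewrite ffunE eq_sym (negPf ia).
Qed.

Lemma dvecD b (v w : V) : dvec b (v + w) = dvec b v + dvec b w.
Proof. by apply/ffunP=> a; rewrite !ffunE; case: eqP; rewrite ?addr0. Qed.
Lemma dvecZ b e (v : V) : dvec b (e *: v) = e *: dvec b v.
Proof. by apply/ffunP=> a; rewrite !ffunE; case: eqP; rewrite ?scaler0. Qed.

End Ext.

(** The extension by the R-matrix preserves the relations of quantum matrices.
This is the Yang-Baxter equation; it suffices to check it on basis vectors, where
the images of both sides are explicit by [rext_dvec]. *)
Lemma rext_qrel (V : lmodType k) (P : 'I_n -> 'I_n -> V -> V) :
  (forall c ga, linear (P c ga)) -> qrel P -> qrel (rext P).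
Proof.
move=> Plin [r1 r2 r3 r4].
have El := rext_lin Plin.
have basis (f g : {ffun 'I_n -> V} -> {ffun 'I_n -> V}) : linear f -> linear g ->
    (forall b v, f (dvec b v) = g (dvec b v)) -> forall x, f x = g x.
  move=> lf lg fg x; rewrite [x]dvec_sum (rlin_sum lf) (rlin_sum lg).
  by apply: eq_bigr => b _; apply: fg.
have comp c d ga de b v : rext P d de (rext P c ga (dvec b v)) =
    (if b == c then q else 1) *: ((if b == d then q else 1) *: dvec b (P d de (P c ga v))
      + (if (b < d)%N then lam else 0) *: dvec d (P b de (P c ga v))) +
    (if (b < c)%N then lam else 0) *: ((if c == d then q else 1) *: dvec c (P d de (P b ga v))
      + (if (c < d)%N then lam else 0) *: dvec d (P c de (P b ga v))).
  by rewrite rext_dvec // (rlinD (El _ _)) !(rlinZ (El _ _)) !rext_dvec.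
have comm (c d ga de : 'I_n) e f x :
    (forall b v, rext P d de (rext P c ga (dvec b v)) =
      e *: rext P c ga (rext P d de (dvec b v)) + f *: rext P d ga (rext P c de (dvec b v))) ->
    rext P d de (rext P c ga x) =
      e *: rext P c ga (rext P d de x) + f *: rext P d ga (rext P c de x).
  move=> h; apply: (basis (fun x => rext P d de (rext P c ga x))
                (fun x => e *: rext P c ga (rext P d de x) +
                            f *: rext P d ga (rext P c de x))).
  - by move=> a u v; rewrite !El.
  - by move=> a u v; rewrite !El; lfield k.
  - exact: h.
have comm0 (c d ga de : 'I_n) e x :
    (forall b v, rext P d de (rext P c ga (dvec b v)) =
      e *: rext P c ga (rext P d de (dvec b v))) ->
    rext P d de (rext P c ga x) = e *: rext P c ga (rext P d de x).
  move=> h; rewrite -[RHS]addr0 -(scale0r (rext P d ga (rext P c de x))).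
  by apply: comm => b v; rewrite scale0r addr0.
split.
- move=> c ga de x gd; apply: comm0 => b v; rewrite !comp eqxx ltnn.
  case: (ltngtP b c) => [bc|cb|/val_inj<-]; last 1 first.
  + by rewrite eqxx (r1 b) // ?(dvecZ, dvecD); lfield k.
  + rewrite -val_eqE ltn_eqF //= (r1 c) // (r4 b c) // (r3 b c de ga) //.
    by rewrite ?(dvecZ, dvecD); lfield k.
  + by rewrite -val_eqE gtn_eqF //= (r1 c) // ?(dvecZ, dvecD); lfield k.
- move=> c d ga x cd; apply: comm0 => b v; rewrite !comp.
  rewrite -!val_eqE /= (ltn_eqF cd) (gtn_eqF cd) cd (ltnNge d c) (ltnW cd) /=.
  case: (ltngtP b c) => [bc|cb|/val_inj bc]; last 1 first.
  + by rewrite bc cd (ltn_eqF cd) (r2 c d) // ?(dvecZ, dvecD); lfield k.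
  + have bd := ltn_trans bc cd; rewrite bd (ltn_eqF bd).
    rewrite (r2 c d) // (r2 b c) // (r2 b d) // ?(dvecZ, dvecD); lfield k.
  + case: (ltngtP b d) => [bd|db|/val_inj bd]; last 1 first.
    * by rewrite bd (r2 c d) // ?(dvecZ, dvecD); lfield k.
    * by rewrite (r2 c d) // (r2 c b) // ?(dvecZ, dvecD); lfield k.
    * by rewrite (r2 c d) // ?(dvecZ, dvecD); lfield k.
- move=> c d ga de x cd dg; rewrite -[RHS]scale1r; apply: comm0 => b v; rewrite !comp.
  rewrite -!val_eqE /= (ltn_eqF cd) (gtn_eqF cd) cd (ltnNge d c) (ltnW cd) /=.
  case: (ltngtP b c) => [bc|cb|/val_inj bc]; last 1 first.
  + by rewrite bc cd (ltn_eqF cd) (r3 c d) // (r1 c de ga) // ?(dvecZ, dvecD); lfield k.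
  + have bd := ltn_trans bc cd.
    rewrite bd (ltn_eqF bd) (r3 c d) // (r3 b d) // (r4 b c de ga) //.
    by rewrite ?(dvecZ, dvecD); lfield k.
  + case: (ltngtP b d) => [bd|db|/val_inj bd]; last 1 first.
    * by rewrite bd (r3 c d) // ?(dvecZ, dvecD); lfield k.
    * by rewrite (r3 c d) // (r3 c b) // ?(dvecZ, dvecD); lfield k.
    * by rewrite (r3 c d) // ?(dvecZ, dvecD); lfield k.
- move=> c d ga de x cd gd; rewrite -[X in X + _]scale1r; apply: comm => b v; rewrite !comp.
  rewrite -!val_eqE /= (ltn_eqF cd) (gtn_eqF cd) cd (ltnNge d c) (ltnW cd) /=.
  case: (ltngtP b c) => [bc|cb|/val_inj bc]; last 1 first.
  + rewrite bc cd (ltn_eqF cd) (r4 c d) // (r1 c ga de) // ?(dvecZ, dvecD); lfield k.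
  + have bd := ltn_trans bc cd.
    rewrite bd (ltn_eqF bd) (r4 c d) // (r4 b c) // (r4 b d) // !(r3 b c de ga) //.
    by rewrite ?(dvecZ, dvecD); lfield k.
  + case: (ltngtP b d) => [bd|db|/val_inj bd]; last 1 first.
    * by rewrite bd (r4 c d) // ?(dvecZ, dvecD); lfield k.
    * by rewrite (r4 c d) // (r4 c b) // ?(dvecZ, dvecD); lfield k.
    * by rewrite (r4 c d) // ?(dvecZ, dvecD); lfield k.
Qed.
End RMatrix.

(** * Coordinates of one-forms *)
Section FormsFree.
Variables (k : fieldType) (n : nat) (q : k).
Hypothesis q0 : q != 0.
Local Notation A := (qmat n q).
Local Notation z := (@zgen k n q).
Local Notation Rmx := (@Rmx k n q).
Local Notation rext := (@rext k n q).
Local Notation lam := (q - q^-1).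

Let rel t u (h : @qmat_rel k n q t u) := @pgen_rels k (qmat_pres n q) t u h.

Lemma zgen_qrel : [/\
  forall c (ga de : 'I_n), (ga < de)%N -> z c ga * z c de = q *: (z c de * z c ga),
  forall (c d : 'I_n) ga, (c < d)%N -> z c ga * z d ga = q *: (z d ga * z c ga),
  forall (c d ga de : 'I_n), (c < d)%N -> (de < ga)%N ->
    z c ga * z d de = z d de * z c ga &
  forall (c d ga de : 'I_n), (c < d)%N -> (ga < de)%N ->
    z c ga * z d de = z d de * z c ga + lam *: (z c de * z d ga)].
Proof.
split.
- move=> c ga de h; have := rel (qmat_q q (or_introl (conj (erefl c) h))).
  by rewrite /= -scalerAl mul1r.
- move=> c d ga h; have := rel (qmat_q q (or_intror (conj h (erefl ga)))).
  by rewrite /= -scalerAl mul1r.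
- by move=> c d ga de h h'; have := rel (qmat_comm q h h').
- move=> c d ga de h h'; have := rel (qmat_cross q h h').
  by rewrite /= -scalerAl mul1r.
Qed.

Definition rmulz (c ga : 'I_n) (f : A) : A := f * z c ga.

Lemma rmulz_lin c ga : linear (rmulz c ga).
Proof. by move=> e f g; rewrite /rmulz mulrDl scalerAl. Qed.

Lemma rmulz_qrel : qrel q rmulz.
Proof.
have [r1 r2 r3 r4] := zgen_qrel; rewrite /rmulz; split.
- by move=> c ga de v h; rewrite -!mulrA r1 // -scalerAr.
- by move=> c d ga v h; rewrite -!mulrA r2 // -scalerAr.
- by move=> c d ga de v h h'; rewrite -!mulrA r3.
- by move=> c d ga de v h h'; rewrite -!mulrA r4 // mulrDr -scalerAr.
Qed.

Local Notation M := {ffun 'I_n -> {ffun 'I_n -> A}}.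

(** Right multiplication by a generator on coordinates with respect to the dz: one
R-matrix acts on the lower index and, after exchanging the roles of the two
indices, another one on the upper index. *)
Definition form_op (p : 'I_n * 'I_n) : M -> M :=
  rext (swap (rext rmulz)) p.2 p.1.

Lemma form_op_lin p : linear (form_op p).
Proof. by do 2!(apply: rext_lin => ? ?); apply: rmulz_lin. Qed.

Lemma form_op_qrel : qrel q (fun c ga => form_op (c, ga)).
Proof.
apply: qrel_swap; apply: rext_qrel => //.
  by move=> c ga; apply: rext_lin => ? ?; apply: rmulz_lin.
apply: qrel_swap; apply: rext_qrel => //; first exact: rmulz_lin.
exact: rmulz_qrel.
Qed.

Lemma form_op_rel t u : @rels _ (qmat_pres n q) t u ->
  term_ract (P := qmat_pres n q) form_op t =1 term_ract (P := qmat_pres n q) form_op u.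
Proof.
have [r1 r2 r3 r4] := form_op_qrel.
case=> [a al b be [[-> h]|[h ->]]|a al b be h h'|a al b be h h'] v /=.
- by rewrite r1 // (rlinZ (form_op_lin _)) (rlinZ (form_op_lin _)).
- by rewrite r2 // (rlinZ (form_op_lin _)) (rlinZ (form_op_lin _)).
- exact: r3.
- by rewrite r4 // !(rlinZ (form_op_lin _)).
Qed.

Lemma form_opE p (x : M) al a : form_op p x al a =
  Rmx (fun al' ga' => Rmx (fun a' c' => x al' a' * z c' ga') a p.1) al p.2.
Proof.
rewrite /form_op /rext !ffunE /swap /Rmx /=.
case: eqP => _; rewrite !ffunE //; congr (_ + _ *: _).
by rewrite sum_ffunE; apply: eq_bigr => b _; rewrite ffunE.
Qed.

Definition form_lmul (f : A) (x : M) : M := [ffun al => [ffun a => f * x al a]].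

Definition form_ract (x : M) (f : A) : M := ralg_act (P := qmat_pres n q) form_op f x.

(** The bimodule of one-forms maps to the free left module on the dz. The map is
all that is needed to read off coefficients, since the dz go to the basis. *)
Fixpoint form_int (t : bterm A ('I_n * 'I_n)) : M :=
  match t with
  | BGen p => dvec p.2 (dvec p.1 (1 : A))
  | BZero => 0
  | BAdd t u => form_int t + form_int u
  | BL f t => form_lmul f (form_int t)
  | BR t f => form_ract (form_int t) f
  end.

Lemma form_lmulE f x al a : form_lmul f x al a = f * x al a.
Proof. by rewrite !ffunE. Qed.

Lemma form_lmul_op f p x : form_op p (form_lmul f x) = form_lmul f (form_op p x).
Proof.
have lf : linear ( *%R f) by move=> e u v; rewrite mulrDr scalerAr.
apply/ffunP => al; apply/ffunP => a; rewrite form_lmulE !form_opE.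
rewrite (Rmx_map q lf); apply: eq_Rmx => al' ga'.
by rewrite (Rmx_map q lf); apply: eq_Rmx => a' c'; rewrite form_lmulE mulrA.
Qed.

Lemma form_lmul_lin f : linear (form_lmul f).
Proof.
move=> e x y; apply/ffunP => al; apply/ffunP => a; rewrite !ffunE.
by rewrite mulrDr scalerAr.
Qed.

Lemma form_ractM x f g : form_ract x (f * g) = form_ract (form_ract x f) g.
Proof.
exact: (@ralg_actM k (qmat_pres n q) M form_op form_op_lin form_op_rel f g x).
Qed.

Lemma form_ractD x f g : form_ract x (f + g) = form_ract x f + form_ract x g.
Proof.
exact: (@ralg_actD k (qmat_pres n q) M form_op form_op_lin form_op_rel f g x).
Qed.

Lemma form_ractC x c : form_ract x c%:A = c *: x.
Proof.
exact: (@ralg_actC k (qmat_pres n q) M form_op form_op_lin form_op_rel c x).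
Qed.

Lemma form_ract_gen x a al : form_ract x (z a al) = form_op (a, al) x.
Proof.
exact: (@ralg_act_gen k (qmat_pres n q) M form_op form_op_lin form_op_rel (a, al) x).
Qed.

Lemma form_ract_lin f : linear (form_ract^~ f).
Proof. exact: (@ralg_act_lin k (qmat_pres n q) M form_op form_op_lin f). Qed.

Lemma form_lmul_ract f x g :
  form_ract (form_lmul f x) g = form_lmul f (form_ract x g).
Proof.
have ract_class y t :
    form_ract y (@pclass k (qmat_pres n q) t) =
    term_ract (P := qmat_pres n q) form_op t y.
  exact: (@ralg_act_pclass k (qmat_pres n q) M form_op form_op_lin form_op_rel t y).
elim/pclass_ind: g => t; rewrite !ract_class.
elim: t x => [p|c|t IHt u IHu|t IHt u IHu] x /=.
- exact: form_lmul_op.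
- by rewrite (rlinZ (form_lmul_lin f)).
- by rewrite IHt IHu (rlinD (form_lmul_lin f)).
- by rewrite IHt IHu.
Qed.

Lemma RmatE (b a b' a' : 'I_n) : Rmat q b a b' a' =
  (if a' == a then if b' == b then if a == b then q^-1 else 1 else 0 else 0) +
  (if a' == b then if b' == a then if (a < b)%N then q^-1 - q else 0 else 0 else 0).
Proof.
rewrite /Rmat; have [<-|ab] := eqVneq a b.
  rewrite ltnn /= !if_same addr0 [a == a']eq_sym; case: eqP => //= ->.
  by rewrite eq_sym; case: eqP.
rewrite [a == a']eq_sym [b == b']eq_sym [a == b']eq_sym [b == a']eq_sym /=.
have [->|a'a] := eqVneq a' a; have [->|b'b] := eqVneq b' b => //=;
  rewrite ?(negPf ab) ?[b == a]eq_sym ?(negPf ab) ?andbF ?addr0 ?add0r //.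
- by rewrite if_same.
- by rewrite andbC; case: (_ == _); case: (_ == _); case: (_ < _)%N.
Qed.

Lemma sum_delta (V : lmodType k) (a : 'I_n) (F : 'I_n -> k) (H : 'I_n -> V) :
  \sum_i (if i == a then F i else 0) *: H i = F a *: H a.
Proof.
rewrite (bigD1 a) //= eqxx big1 ?addr0 // => i /negPf->.
by rewrite scale0r.
Qed.

Lemma Rmat_sum (V : lmodType k) (H : 'I_n -> 'I_n -> V) (b a : 'I_n) :
  \sum_(a' < n) \sum_(b' < n) Rmat q b a b' a' *: H a' b' =
  (if a == b then q^-1 else 1) *: H a b +
  (if (a < b)%N then q^-1 - q else 0) *: H b a.
Proof.
under eq_bigr => a' _ do under eq_bigr => b' _ do rewrite RmatE scalerDl.
under eq_bigr => a' _ do rewrite big_split /=.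
rewrite big_split /=; congr (_ + _).
  rewrite (bigD1 a) //= ?eqxx sum_delta big1 ?addr0 // => i /negPf->.
  by rewrite big1 // => j _; rewrite scale0r.
rewrite (bigD1 b) //= ?eqxx sum_delta big1 ?addr0 // => i /negPf->.
by rewrite big1 // => j _; rewrite scale0r.
Qed.

(** [Rmx] inverts [Rmat]: this is the commutation relation between z and dz on
one pair of indices. *)
Lemma Rmat_rext (V : lmodType k) (P : 'I_n -> 'I_n -> V -> V) b a ga v :
  (forall c ga, linear (P c ga)) ->
  \sum_(a' < n) \sum_(b' < n) Rmat q b a b' a' *: rext P b' ga (dvec a' v) =
  dvec a (P b ga v).
Proof.
move=> Plin; rewrite Rmat_sum !rext_dvec // [b == a]eq_sym -val_eqE.
case: ltngtP => [ab|ba|/val_inj->]; by lfield k.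
Qed.

Lemma form_int_bigadd (I : Type) (r : seq I) F :
  form_int (\big[@BAdd _ _ _/BZero _ _]_(i <- r) F i) = \sum_(i <- r) form_int (F i).
Proof. by elim/big_rec2: _ => //= i x y _ <-. Qed.

(** The defining relation holds in coordinates by two uses of [Rmat_rext], for the
lower and for the upper indices. *)
Lemma form_int_rel t u : @Omega_rel k n q t u -> form_int t = form_int u.
Proof.
case=> a al b be.
have rmlin := rext_lin q rmulz_lin.
transitivity (\sum_(a' < n) \sum_(b' < n) \sum_(al' < n) \sum_(be' < n)
    (Rmat q be al be' al' * Rmat q b a b' a') *:
      form_op (b', be') (dvec al' (dvec a' 1))).
  transitivity (\sum_(a' < n) \sum_(b' < n) Rmat q b a b' a' *:
      dvec al (rext rmulz b' be (dvec a' 1))).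
    transitivity (dvec al (dvec a (z b be))).
      apply/ffunP => al'; apply/ffunP => a'; rewrite form_lmulE !ffunE.
      case: eqP => _; rewrite ?ffunE ?mulr0 //.
      by case: eqP => _; rewrite ?mulr0 ?mulr1.
    rewrite -[z b be]mul1r -/(rmulz b be 1) -(Rmat_rext _ _ _ _ rmulz_lin).
    have dl : linear (@dvec k n {ffun 'I_n -> A} al).
      by move=> e v w; rewrite dvecD dvecZ.
    rewrite (rlin_sum dl); apply: eq_bigr => a' _.
    by rewrite (rlin_sum dl); apply: eq_bigr => b' _; rewrite dvecZ.
  apply: eq_bigr => a' _; apply: eq_bigr => b' _.
  rewrite -[rext rmulz b' be _]/(swap (rext rmulz) be b' _) -Rmat_rext; last first.
    by move=> ? ?; apply: rmlin.
  rewrite scaler_sumr; apply: eq_bigr => al' _; rewrite scaler_sumr.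
  by apply: eq_bigr => be' _; rewrite scalerA mulrC.
under eq_bigr => a' _ do rewrite exchange_big /=.
rewrite exchange_big form_int_bigadd; apply: eq_bigr => al' _.
under eq_bigr => a' _ do rewrite exchange_big /=.
rewrite exchange_big form_int_bigadd; apply: eq_bigr => be' _.
rewrite form_int_bigadd; apply: eq_bigr => a' _.
rewrite form_int_bigadd; apply: eq_bigr => b' _ /=.
rewrite form_ract_gen; apply/ffunP => x; apply/ffunP => y.
by rewrite form_lmulE !ffunE -scalerAl mul1r.
Qed.

Lemma form_int_cong t u : bcong (@Omega_rel k n q) t u -> form_int t = form_int u.
Proof.
have rlin := form_ract_lin.
have llin := form_lmul_lin.
elim=> {t u} //=.
- exact: form_int_rel.
- by move=> t u v _ -> _ ->.
- by move=> t t' u u' _ -> _ ->.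
- by move=> f t u _ ->.
- by move=> f t u _ ->.
- by move=> t u v; rewrite addrA.
- by move=> t u; rewrite addrC.
- by move=> t; rewrite add0r.
- move=> t; apply/ffunP => al; apply/ffunP => a; rewrite !ffunE.
  by rewrite mulN1r addNr.
- by move=> t; apply/ffunP => al; apply/ffunP => a; rewrite !ffunE mul1r.
- by move=> f g t; apply/ffunP => al; apply/ffunP => a; rewrite !ffunE mulrA.
- by move=> f g t; apply/ffunP => al; apply/ffunP => a; rewrite !ffunE mulrDl.
- by move=> f t u; rewrite (rlinD (llin _)).
- by move=> t; rewrite -[1]scale1r form_ractC scale1r.
- by move=> f g t; apply: form_ractM.
- by move=> f g t; apply: form_ractD.
- by move=> f t u; apply: (rlinD (rlin f)).
- by move=> f g t; rewrite form_lmul_ract.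
- move=> c t; rewrite form_ractC.
  by apply/ffunP => al; apply/ffunP => a; rewrite !ffunE -scalerAl mul1r.
Qed.

Definition form_coord (w : Omega n q) : M := form_int (generic_quotient.repr w).

Lemma form_coord_class t : form_coord (bclass (@Omega_rel k n q) t) = form_int t.
Proof. exact/form_int_cong/repr_bclass. Qed.

Lemma form_coordD w v : form_coord (w + v) = form_coord w + form_coord v.
Proof.
elim/bclass_ind: w => t; elim/bclass_ind: v => u.
by rewrite -bclassD !form_coord_class.
Qed.

Lemma form_coordL f w : form_coord (lact f w) = form_lmul f (form_coord w).
Proof. by elim/bclass_ind: w => t; rewrite lactE !form_coord_class. Qed.

Lemma form_coordR f w : form_coord (ract w f) = form_ract (form_coord w) f.
Proof. by elim/bclass_ind: w => t; rewrite ractE !form_coord_class. Qed.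

Lemma form_coord_lin : linear form_coord.
Proof.
move=> c w v; rewrite form_coordD form_coordL; congr (_ + _).
by apply/ffunP => al; apply/ffunP => a; rewrite !ffunE -scalerAl mul1r.
Qed.

Lemma form_coord_dz a al : form_coord (dz q a al) = dvec al (dvec a 1).
Proof. exact: form_coord_class. Qed.

Section Partials.
Variables (d : A -> Omega n q) (D : 'I_n -> 'I_n -> A -> A).
Hypotheses (hd : is_differential d) (hD : are_partials d D).

Lemma partialE a al f : D a al f = form_coord (d f) al a.
Proof.
rewrite hD (rlin_sum form_coord_lin) !sum_ffunE (bigD1 a) //=.
rewrite (rlin_sum form_coord_lin) !sum_ffunE (bigD1 al) //=.
rewrite form_coordL form_coord_dz form_lmulE !ffunE !eqxx ffunE eqxx mulr1.
rewrite big1 ?addr0 => [|i ial]; last first.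
  by rewrite form_coordL form_coord_dz form_lmulE ffunE eq_sym (negPf ial) ffunE mulr0.
rewrite big1 ?addr0 // => i ia; rewrite (rlin_sum form_coord_lin) !sum_ffunE.
rewrite big1 // => j _; rewrite form_coordL form_coord_dz form_lmulE !ffunE.
by case: eqP => _; rewrite ffunE ?mulr0 // eq_sym (negPf ia) mulr0.
Qed.

Lemma partial_lin a al : linear (D a al).
Proof.
have [dl _ _] := hd => e f g.
by rewrite !partialE dl form_coord_lin !ffunE.
Qed.

Lemma partial1 a al : D a al 1 = 0.
Proof.
have [_ _ dM] := hd; rewrite partialE.
have : d (1 * 1) = d 1 by rewrite mulr1.
rewrite dM ract1 lact1 => /(congr1 (fun w => w - d 1)); rewrite addrK subrr => ->.
by rewrite (rlin0 form_coord_lin) !ffunE.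
Qed.

(** The Leibniz rule: in d(f z) = d(f) z + f dz the generator of the first term is
moved through the differentials by the two R-matrices. *)
Lemma partialM a al f c ga : D a al (f * z c ga) =
  Rmx (fun al' ga' => Rmx (fun a' c' => D a' al' f * z c' ga') a c) al ga
  + (if (a == c) && (al == ga) then f else 0).
Proof.
have [_ dgen dM] := hd; rewrite partialE dM dgen form_coordD !ffunE; congr (_ + _).
  rewrite form_coordR form_ract_gen form_opE; apply: eq_Rmx => al' ga'.
  by apply: eq_Rmx => a' c'; rewrite partialE.
rewrite form_coordL form_coord_dz form_lmulE !ffunE andbC.
by case: eqP => _; rewrite ?ffunE ?mulr0 //=; case: eqP => _; rewrite ?mulr1 ?mulr0.
Qed.
End Partials.

End FormsFree.

(** * Derivatives and lowering operators *)
Section Calculus.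
Variables (k : fieldType) (n : nat) (q : k).
Hypothesis q0 : q != 0.
Local Notation A := (qmat n q).
Local Notation z := (@zgen k n q).
Local Notation Rmx := (@Rmx k n q).
Local Notation lam := (q - q^-1).

(** The algebra is spanned by words, which are built by multiplying by generators
on the right. *)
Lemma qmat_ind (Q : A -> Prop) :
  (forall e f g, Q f -> Q g -> Q (e *: f + g)) -> Q 1 ->
  (forall f c ga, Q f -> Q (f * z c ga)) -> forall f, Q f.
Proof.
move=> Qlin Q1 Qz.
have Qc c f : Q f -> Q (c *: f).
  move=> Qf; have Q0 : Q 0.
    by have := Qlin (-1) _ _ Q1 Q1; rewrite scaleN1r addNr.
  by have := Qlin c f 0 Qf Q0; rewrite addr0.
suff Qt t f : Q f -> Q (f * @pclass k (qmat_pres n q) t).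
  by elim/pclass_ind=> t; rewrite -[pclass t]mul1r; apply: Qt.
elim: t f => [[c ga]|c|t IHt u IHu|t IHt u IHu] f Qf.
- exact: Qz.
- by rewrite pclassC -scalerAr mulr1; apply: Qc.
- rewrite pclassD mulrDr -[X in X + _]scale1r.
  by apply: Qlin; [apply: IHt | apply: IHu].
- by rewrite pclassM mulrA; apply/IHu/IHt.
Qed.

(** The eigenvalue of the inverse of K on a generator whose row index is [c], for
the lowering operator that sends row [j] to row [j']. *)
Definition rowwt (j j' c : 'I_n) : k :=
  if c == j then q^-1 else if c == j' then q else 1.

(** The R-matrix commutes with the action of a lowering operator on a pair of
indices, where the first index carries the dual representation. *)
Lemma Rmx_cov (V : lmodType k) (P Y : 'I_n -> 'I_n -> V) (j j' a c : 'I_n) :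
  j' = j.+1 :> nat ->
  rowwt j j' c *: Rmx (fun a c => rowwt j j' a *: P a c + (a == j')%:R *: Y j c) a c
    + (c == j)%:R *: Rmx Y a j' =
  rowwt j j' a *: Rmx (fun a c => rowwt j j' c *: P a c + (c == j)%:R *: Y a j') a c
    + (a == j')%:R *: Rmx Y j c.
Proof.
move=> jj'; have jlt : (j < j')%N by rewrite jj'.
have jNj' : (j == j') = false by rewrite -val_eqE ltn_eqF.
have dsum (i : 'I_n) (H : 'I_n -> V) :
    \sum_(b < n | (b < a)%N) (b == i)%:R *: H b = (i < a)%:R *: H i.
  rewrite (bigID (pred1 i)) /= [X in _ + X]big1 => [|b /andP[_ /negPf->]]; last first.
    by rewrite scale0r.
  rewrite addr0; have [ia|ia] := ltnP i a; last first.
    by rewrite scale0r big1 // => b /andP[ba /eqP bi]; rewrite bi ltnNge ia in ba.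
  rewrite (bigD1 i) ?ia /= ?eqxx // big1 ?addr0 // => b.
  by rewrite andbAC -andbA andNb andbF.
have jsum (H : 'I_n -> V) :
    \sum_(b < n | (b < j')%N) H b = H j + \sum_(b < n | (b < j)%N) H b.
  rewrite (bigD1 j) //=; congr (_ + _); apply: eq_bigl => b.
  by rewrite jj' ltnS -val_eqE /=; case: ltngtP.
rewrite /Rmx !big_split /= !dsum.
have j'Nj : (j' == j) = false by rewrite eq_sym.
set S := \sum_(b < n | _) rowwt j j' b *: P b b.
rewrite /rowwt.
have [->|aj] := eqVneq a j.
  have [->|cj] := eqVneq c j; rewrite ?jNj' ?ltnn ?eqxx ?(ltnNge j') ?(ltnW jlt) /=.
    by set T := \sum_(b < n | _) _; lfield k.
  have [->|cj'] := eqVneq c j'; rewrite ?jNj' ?[j == c]eq_sym ?(negPf cj); lfield k.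
have [->|aj'] := eqVneq a j'.
  rewrite ltnn jlt jsum; have [->|cj] := eqVneq c j; rewrite ?jNj' ?j'Nj.
    by set T := \sum_(b < n | _) _; lfield k.
  have [->|cj'] := eqVneq c j'.
    by set T := \sum_(b < n | _) _; lfield k.
  by rewrite ?(negPf cj') ?[j' == c]eq_sym ?(negPf cj'); lfield k.
have [->|cj] := eqVneq c j; rewrite ?(negPf aj) ?jNj'.
  by lfield k.
have [->|cj'] := eqVneq c j'; first by rewrite ?(negPf aj'); lfield k.
have [ac|ac] := eqVneq a c; last by lfield k.
have -> : (j < a)%N = (j' < a)%N.
  by rewrite [RHS]ltn_neqAle (inj_eq val_inj) eq_sym aj' jj'.
by lfield k.
Qed.

(** The rules of the partial derivatives, stated for a family [w] that is either z
or its transpose: transposition exchanges rows and columns, so that statements on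
columns follow from statements on rows. *)
Definition is_calculus (w : 'I_n -> 'I_n -> A) (D : 'I_n -> 'I_n -> A -> A) :=
  [/\ forall a al, linear (D a al), forall a al, D a al 1 = 0 &
    forall a al f c ga, D a al (f * w c ga) =
      Rmx (fun al' ga' => Rmx (fun a' c' => D a' al' f * w c' ga') a c) al ga
      + ((a == c) && (al == ga))%:R *: f].

Lemma is_calculus_swap w D : is_calculus w D -> is_calculus (swap w) (swap D).
Proof.
case=> Dlin D1 Dw; split=> [a al|a al|a al f c ga]; rewrite /swap //.
by rewrite Dw RmxC // andbC.
Qed.

(** The operator q^(-1/2) F_j for a node j that acts on rows, described on right
multiples of generators. *)
Definition is_row_op (w : 'I_n -> 'I_n -> A) (j j' : 'I_n) (f : A -> A) :=
  [/\ linear f, f 1 = 0 & forall g c ga,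
    f (g * w c ga) = rowwt j j' c *: (f g * w c ga) + (c == j)%:R *: (g * w j' ga)].

Definition spanning (w : 'I_n -> 'I_n -> A) := forall (Q : A -> Prop),
  (forall e f g, Q f -> Q g -> Q (e *: f + g)) -> Q 1 ->
  (forall f c ga, Q f -> Q (f * w c ga)) -> forall f, Q f.

Lemma zgen_spanning : spanning z.
Proof. exact: qmat_ind. Qed.

Lemma spanning_swap w : spanning w -> spanning (swap w).
Proof. by move=> sw Q ? ? Qz; apply: sw => // f c ga; apply: Qz. Qed.

Lemma Rmx_comb (V : lmodType k) (X Y : 'I_n -> 'I_n -> V) e e' a c :
  Rmx (fun a c => e *: X a c + e' *: Y a c) a c = e *: Rmx X a c + e' *: Rmx Y a c.
Proof.
rewrite Rmx_lin; congr (_ + _); rewrite [RHS](@Rmx_map k n q _ _ ( *:%R e')) //.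
by move=> b u v; rewrite scalerDr !scalerA mulrC.
Qed.

(** Induction on words: the covariance [Rmx_cov] of the R-matrix turns the rule for
g into the rule for g z. *)
Lemma calculus_row w D (j j' : 'I_n) f : spanning w -> j' = j.+1 :> nat ->
  is_calculus w D -> is_row_op w j j' f -> forall a al g,
  D a al (f g) = rowwt j j' a *: f (D a al g) + (a == j')%:R *: D j al g.
Proof.
move=> sw jj' [Dlin D1 Dw] [flin f1 fw] a al g; move: g a al; apply: sw.
- move=> e g h IHg IHh a al; rewrite flin !Dlin flin IHg IHh; lfield k.
- by move=> a al; rewrite f1 !D1 (rlin0 (Dlin _ _)) (rlin0 flin) !scaler0 addr0.
move=> g c ga IH a al.
rewrite fw (rlinD (Dlin _ _)) !(rlinZ (Dlin _ _)) !Dw (rlinD flin) (rlinZ flin).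
rewrite (Rmx_map q flin).
have inner al' ga' :
    rowwt j j' c *: Rmx (fun a' c' => D a' al' (f g) * w c' ga') a c
      + (c == j)%:R *: Rmx (fun a' c' => D a' al' g * w c' ga') a j' =
    rowwt j j' a *: f (Rmx (fun a' c' => D a' al' g * w c' ga') a c)
      + (a == j')%:R *: Rmx (fun a' c' => D a' al' g * w c' ga') j c.
  have := Rmx_cov (fun a' c' => f (D a' al' g) * w c' ga')
    (fun a' c' => D a' al' g * w c' ga') a c jj'.
  congr (_ *: _ + _ = _ *: _ + _); first last.
    by rewrite (Rmx_map q flin); apply: eq_Rmx => a' c'; rewrite fw.
  by apply: eq_Rmx => a' c'; rewrite IH mulrDl -!scalerAl.
set X := (fun al' ga' => Rmx (fun a' c' => D a' al' (f g) * w c' ga') a c) in inner *.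
transitivity (Rmx (fun al' ga' => rowwt j j' c *: X al' ga' + (c == j)%:R *:
    Rmx (fun a' c' => D a' al' g * w c' ga') a j') al ga +
    (rowwt j j' c *: (((a == c) && (al == ga))%:R *: f g) +
     (c == j)%:R *: (((a == j') && (al == ga))%:R *: g))).
  by rewrite Rmx_comb; lfield k.
rewrite (@eq_Rmx k n q _ _ _ _ _ inner) Rmx_comb.
rewrite /rowwt.
have jlt : (j < j')%N by rewrite jj'.
have jNj' : (j == j') = false by rewrite -val_eqE ltn_eqF.
case: (al == ga); last by rewrite !andbF; lfield k.
rewrite !andbT [j == c]eq_sym.
have [<-|ac] := eqVneq a c; first by lfield k.
have [->|cj] := eqVneq c j; last by lfield k.
by lfield k.
Qed.

Lemma Rmx_wt (V : lmodType k) (u : 'I_n -> k) (Y : 'I_n -> 'I_n -> V) a c :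
  (forall x, u x != 0) -> Rmx (fun a c => u a *: Y a c) a c =
  (u a / u c) *: Rmx (fun a c => u c *: Y a c) a c.
Proof.
move=> u0; rewrite /Rmx; have ua0 := u0 a; have uc0 := u0 c.
case: eqP => [<-|_]; last by lfield k.
by set S := \sum_(b < n | _) _; lfield k.
Qed.

Lemma Rmx_max (V : lmodType k) (m : 'I_n) (Y : 'I_n -> V) a c :
  (forall i : 'I_n, (i <= m)%N) ->
  Rmx (fun a c => (c == m)%:R *: Y a) a c =
  ((c == m)%:R * (if a == m then q else 1)) *: Y a.
Proof.
move=> mmax; rewrite /Rmx big1 => [|b ba]; last first.
  have [bm|_] := eqVneq b m; last by rewrite scale0r.
  by rewrite bm ltnNge mmax in ba.
have [<-|ac] := eqVneq a c; first by case: eqVneq => _; lfield k.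
have [cm|cm] := eqVneq c m; last by lfield k.
by rewrite -cm (negPf ac); lfield k.
Qed.

Definition cornerwt (m a : 'I_n) : k := if a == m then q^-1 else 1.

(** The operator q^(-1/2) F_n, which removes a factor z_n^n. *)
Definition is_corner_op (w : 'I_n -> 'I_n -> A) (m : 'I_n) (f : A -> A) :=
  [/\ linear f, f 1 = 0 & forall g c ga, f (g * w c ga) =
    (cornerwt m c * cornerwt m ga) *: (f g * w c ga)
    + ((c == m) && (ga == m))%:R *: g].

(** The removal of z_n^n creates no new term: the inhomogeneous terms of the two
twisted Leibniz rules cancel because the index [m] is the largest one. *)
Lemma calculus_corner w D (m : 'I_n) f : spanning w -> (forall i : 'I_n, (i <= m)%N) ->
  is_calculus w D -> is_corner_op w m f -> forall a al g,
  D a al (f g) = (cornerwt m a * cornerwt m al) *: f (D a al g).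
Proof.
move=> sw mmax [Dlin D1 Dw] [flin f1 fw] a al g; move: g a al; apply: sw.
- by move=> e g h IHg IHh a al; rewrite flin !Dlin flin IHg IHh; lfield k.
- by move=> a al; rewrite f1 !D1 (rlin0 (Dlin _ _)) (rlin0 flin) !scaler0.
move=> g c ga IH a al; set u := cornerwt m.
rewrite fw (rlinD (Dlin _ _)) !(rlinZ (Dlin _ _)) !Dw (rlinD flin) (rlinZ flin).
rewrite (Rmx_map q flin).
pose T := Rmx (fun al' ga' => u ga' *: Rmx (fun a' c' =>
  u c' *: (f (D a' al' g) * w c' ga')) a c) al ga.
have u0 x : u x != 0.
  rewrite /u /cornerwt; case: (x == m); first exact: invr_neq0.
  exact: oner_neq0.
have -> : Rmx (fun al' ga' => Rmx (fun a' c' => D a' al' (f g) * w c' ga') a c) al ga =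
    ((u a * u al) / (u c * u ga)) *: T.
  transitivity (Rmx (fun al' ga' => u al' *: ((u a / u c) *:
      Rmx (fun a' c' => u c' *: (f (D a' al' g) * w c' ga')) a c)) al ga).
    apply: eq_Rmx => al' ga'; rewrite -Rmx_wt // (@Rmx_map k n q _ _ ( *:%R (u al'))).
      by apply: eq_Rmx => a' c'; rewrite IH -scalerAl scalerA mulrC.
    by move=> e x y; lfield k.
  rewrite Rmx_wt // /T.
  rewrite [X in _ = _ *: X](_ : _ = (u c / u a) *: Rmx (fun al' ga' => u ga' *: ((u a / u c) *:
      Rmx (fun a' c' => u c' *: (f (D a' al' g) * w c' ga')) a c)) al ga).
    by have := u0 a; have := u0 c; have := u0 ga => *; lfield k.
  rewrite (@Rmx_map k n q _ _ ( *:%R (u c / u a))); last by move=> e x y; lfield k.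
  by apply: eq_Rmx => *; have := u0 a; have := u0 c => *; lfield k.
have -> : Rmx (fun al' ga' => f (Rmx (fun a' c' => D a' al' g * w c' ga') a c)) al ga =
    T + (((c == m) && (ga == m))%:R * ((if a == m then q else 1) *
      (if al == m then q else 1))) *: D a al g.
  transitivity (Rmx (fun al' ga' => 1 *: (u ga' *: Rmx (fun a' c' =>
      u c' *: (f (D a' al' g) * w c' ga')) a c) + ((c == m)%:R / u a) *:
      ((ga' == m)%:R *: D a al' g)) al ga).
    apply: eq_Rmx => al' ga'; rewrite (Rmx_map q flin).
    transitivity (Rmx (fun a' c' => u ga' *: (u c' *: (f (D a' al' g) * w c' ga')) +
        (ga' == m)%:R *: ((c' == m)%:R *: D a' al' g)) a c).
      apply: eq_Rmx => a' c'; rewrite fw -/u.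
      by case: (c' == m); case: (ga' == m); rewrite /=; lfield k.
    rewrite Rmx_comb Rmx_max // /u /cornerwt.
    by case: (a == m); rewrite ?invrK ?invr1; lfield k.
  rewrite Rmx_comb Rmx_max // -/T /u /cornerwt.
  by case: (al == m); case: (a == m); case: (c == m); case: (ga == m);
    rewrite ?invrK ?invr1 /=; lfield k.
have [ua ual uc uga] := And4 (u0 a) (u0 al) (u0 c) (u0 ga).
rewrite -/(u c) -/(u ga) -/(u a) -/(u al).
have uq x : (if x == m then q else 1) = (u x)^-1.
  by rewrite /u /cornerwt; case: (x == m); rewrite ?invrK ?invr1.
rewrite !uq; have [ac|ac] := eqVneq a c; last by rewrite /=; lfield k.
by rewrite ac; have [aga|aga] := eqVneq al ga; rewrite ?aga /=; lfield k.
Qed.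
End Calculus.

(** * Homogeneous elements *)
Section Homogeneous.
Variables (k : fieldType) (n : nat) (q : k).
Local Notation A := (qmat n q).
Local Notation z := (@zgen k n q).

(** [r] and [c] count the occurrences of each lower and upper index. The predicate
is generated by words and linear combinations; it does not express a direct sum
decomposition, and 0 is homogeneous of every content. *)
Inductive homog : ('I_n -> int) -> ('I_n -> int) -> A -> Prop :=
| homog1 r c : (forall x, r x = 0) -> (forall x, c x = 0) -> homog r c 1
| homog0 r c : homog r c 0
| homogL r c e f g : homog r c f -> homog r c g -> homog r c (e *: f + g)
| homogM r c r' c' f a al : homog r c f ->
    (forall x, r' x = r x + (x == a)%:R) -> (forall x, c' x = c x + (x == al)%:R) ->
    homog r' c' (f * z a al).

Lemma homogZ r c e f : homog r c f -> homog r c (e *: f).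
Proof. by move=> hf; rewrite -[_ *: _]addr0; apply: homogL hf (homog0 _ _). Qed.

Lemma homogD r c f g : homog r c f -> homog r c g -> homog r c (f + g).
Proof. by move=> hf hg; rewrite -[f]scale1r; apply: homogL. Qed.

Lemma homog_sum r c (I : Type) (s : seq I) (Q : pred I) (F : I -> A) :
  (forall i, Q i -> homog r c (F i)) -> homog r c (\sum_(i <- s | Q i) F i).
Proof. by move=> hF; apply: big_ind => //; [apply: homog0 | apply: homogD]. Qed.

Lemma homog_ext r c r' c' f : homog r c f -> r =1 r' -> c =1 c' -> homog r' c' f.
Proof.
move=> hf; elim: hf r' c' => {r c f} [r c r0 c0|r c|r c e f g _ IHf _ IHg|
  r c r1 c1 f a al hf _ hr hc] r' c' rr cc.
- by apply: homog1 => x; rewrite -?rr -?cc ?r0 ?c0.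
- exact: homog0.
- by apply: homogL; [apply: IHf | apply: IHg].
- by apply: homogM hf _ _ => x; rewrite -?rr -?cc ?hr ?hc.
Qed.

(** Contents of nonzero elements are nonnegative. With [homog_const] this replaces
the knowledge of a basis. *)
Lemma homog_neg_row r c f a : homog r c f -> r a < 0 -> f = 0.
Proof.
move=> hf; elim: hf a => {r c f} [r c r0 c0|r c|r c e f g _ IHf _ IHg|
  r c r' c' f b al hf IH hr hc] a ra //.
- by rewrite r0 in ra.
- by rewrite (IHf _ ra) (IHg _ ra) scaler0 addr0.
- rewrite (IH a) ?mul0r //; apply: le_lt_trans ra; rewrite hr lerDl.
  by rewrite ler0n.
Qed.

Lemma homog_neg_col r c f a : homog r c f -> c a < 0 -> f = 0.
Proof.
move=> hf; elim: hf a => {r c f} [r c r0 c0|r c|r c e f g _ IHf _ IHg|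
  r c r' c' f b al hf IH hr hc] a ra //.
- by rewrite c0 in ra.
- by rewrite (IHf _ ra) (IHg _ ra) scaler0 addr0.
- rewrite (IH a) ?mul0r //; apply: le_lt_trans ra; rewrite hc lerDl.
  by rewrite ler0n.
Qed.

Lemma homog_const r c f : homog r c f -> (forall a, c a = 0) -> exists e, f = e%:A.
Proof.
elim=> {r c f} [r c _ _|r c|r c e f g _ IHf _ IHg|r c r' c' f b al hf _ hr hc] c0.
- by exists 1; rewrite scale1r.
- by exists 0; rewrite scale0r.
- have [[x ->] [y ->]] := (IHf c0, IHg c0).
  by exists (e * x + y); rewrite scalerDl scalerA.
- exists 0; rewrite scale0r (homog_neg_col (a := al) hf) ?mul0r //.
  by have := hc al; rewrite c0 eqxx /=; lia.
Qed.

Lemma homog_span (Q : A -> Prop) :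
  (forall e f g, Q f -> Q g -> Q (e *: f + g)) ->
  (forall r c f, homog r c f -> Q f) -> forall f, Q f.
Proof.
move=> Qlin Qh f; move: f Q Qlin Qh; apply: qmat_ind.
- move=> e f g IHf IHg Q Qlin Qh.
  exact: Qlin (IHf Q Qlin Qh) (IHg Q Qlin Qh).
- move=> Q _ Qh; apply: (Qh (fun=> 0) (fun=> 0)); exact: homog1.
- move=> f c ga IH Q Qlin Qh; apply: (IH (fun g => Q (g * z c ga))).
    by move=> e g h Qg Qh'; rewrite mulrDl -scalerAl; apply: Qlin.
  move=> r c' g hg; apply: (Qh (fun x => r x + (x == c)%:R) (fun x => c' x + (x == ga)%:R)).
  exact: homogM hg _ _.
Qed.

Definition shifts (X : A -> A) (dr dc : 'I_n -> int) := forall r c f, homog r c f ->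
  homog (fun x => r x + dr x) (fun x => c x + dc x) (X f).

Lemma Rmx_closed (V : lmodType k) (Q : V -> Prop) (Y : 'I_n -> 'I_n -> V) a c :
  Q 0 -> (forall e v w, Q v -> Q w -> Q (e *: v + w)) ->
  Q (Y a c) -> (a = c -> forall b, Q (Y b b)) -> Q (Rmx q Y a c).
Proof.
move=> Q0 Ql Qac Qb; rewrite /Rmx; apply: (Ql) => //; case: eqP => // /Qb {}Qb.
rewrite -[_ *: _]addr0; apply: (Ql) => //; apply: big_ind => // v w Qv Qw.
by rewrite -[v]scale1r; apply: (Ql).
Qed.

Lemma calculus_shifts D a al : is_calculus z D ->
  shifts (D a al) (fun x => - (x == a)%:R) (fun x => - (x == al)%:R).
Proof.
case=> Dlin D1 Dz r c f hf.
elim: hf a al => {r c f} [r c r0 c0|r c|r c e f g _ IHf _ IHg|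
  r c r' c' f c0 ga hf IH hr hc] a al.
- by rewrite D1; apply: homog0.
- by rewrite (rlin0 (Dlin _ _)); apply: homog0.
- by rewrite Dlin; apply: homogL.
rewrite Dz; apply: homogD; last first.
  have [->|_] := eqVneq a c0; last by rewrite scale0r; apply: homog0.
  have [->|_] := eqVneq al ga; last by rewrite scale0r; apply: homog0.
  by rewrite scale1r; apply: homog_ext hf _ _ => x; rewrite ?hr ?hc ?am ?alm addrK.
set Q := homog _ _.
have hQ a' d' al' ga' :
    (forall x, (x == a')%:R - (x == d')%:R = (x == a)%:R - (x == c0)%:R :> int) ->
    (forall x, (x == al')%:R - (x == ga')%:R = (x == al)%:R - (x == ga)%:R :> int) ->
    Q (D a' al' f * z d' ga').
  move=> h1 h2; apply: homogM (IH a' al') _ _ => x.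
    by rewrite hr; have := h1 x; lia.
  by rewrite hc; have := h2 x; lia.
have Qin al' ga' :
    (forall x, (x == al')%:R - (x == ga')%:R = (x == al)%:R - (x == ga)%:R :> int) ->
    Q (Rmx q (fun a' c' => D a' al' f * z c' ga') a c0).
  move=> h; apply: Rmx_closed; [exact: homog0 | exact: homogL | exact: hQ |].
  by move=> aE b; apply: hQ => // x; rewrite aE !subrr.
apply: Rmx_closed; [exact: homog0 | exact: homogL | exact: Qin |].
by move=> alE b; apply: Qin => // x; rewrite alE !subrr.
Qed.

Lemma shifts_eq X dr dc dr' dc' : shifts X dr dc -> dr =1 dr' -> dc =1 dc' ->
  shifts X dr' dc'.
Proof.
by move=> hX hr hc r c f hf; apply: homog_ext (hX _ _ _ hf) _ _ => x; rewrite ?hr ?hc.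
Qed.

Lemma row_op_shifts (j j' : 'I_n) f : is_row_op z j j' f ->
  shifts f (fun x => (x == j')%:R - (x == j)%:R) (fun=> 0).
Proof.
case=> flin f1 fz r c g hg.
elim: hg => {r c g} [r c r0 c0|r c|r c e g h _ IHg _ IHh|
  r c r' c' g a al hg IH hr hc].
- by rewrite f1; apply: homog0.
- by rewrite (rlin0 flin); apply: homog0.
- by rewrite flin; apply: homogL.
rewrite fz; apply: homogL.
  by apply: homogM IH _ _ => x; rewrite ?hr ?hc; lia.
have [aj|_] := eqVneq a j; last by rewrite scale0r; apply: homog0.
by rewrite scale1r; apply: homogM hg _ _ => x; rewrite ?hr ?hc ?aj; lia.
Qed.

Lemma col_op_shifts (j j' : 'I_n) f : is_row_op (swap z) j j' f ->
  shifts f (fun=> 0) (fun x => (x == j')%:R - (x == j)%:R).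
Proof.
case=> flin f1 fz r c g hg.
elim: hg => {r c g} [r c r0 c0|r c|r c e g h _ IHg _ IHh|
  r c r' c' g a al hg IH hr hc].
- by rewrite f1; apply: homog0.
- by rewrite (rlin0 flin); apply: homog0.
- by rewrite flin; apply: homogL.
have := fz g al a; rewrite /swap => ->; apply: homogL.
  by apply: homogM IH _ _ => x; rewrite ?hr ?hc; lia.
have [aj|_] := eqVneq al j; last by rewrite scale0r; apply: homog0.
by rewrite scale1r; apply: homogM hg _ _ => x; rewrite ?hr ?hc ?aj; lia.
Qed.

Lemma corner_op_shifts (m : 'I_n) f : is_corner_op z m f ->
  shifts f (fun x => - (x == m)%:R) (fun x => - (x == m)%:R).
Proof.
case=> flin f1 fz r c g hg.
elim: hg => {r c g} [r c r0 c0|r c|r c e g h _ IHg _ IHh|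
  r c r' c' g a al hg IH hr hc].
- by rewrite f1; apply: homog0.
- by rewrite (rlin0 flin); apply: homog0.
- by rewrite flin; apply: homogL.
rewrite fz; apply: homogL.
  by apply: homogM IH _ _ => x; rewrite ?hr ?hc; lia.
have [am|_] := eqVneq a m; last by rewrite scale0r; apply: homog0.
have [alm|_] := eqVneq al m; last by rewrite scale0r; apply: homog0.
by rewrite scale1r; apply: homog_ext hg _ _ => x; rewrite ?hr ?hc ?am ?alm addrK.
Qed.

End Homogeneous.

(** * The conformal raising operator and rigidity *)
Definition qint (k : fieldType) (q : k) (x : int) : k :=
  (q ^ x - q ^ (- x)) / (q - q^-1).

Section QuantumIntegers.
Variables (k : fieldType) (q : k).
Hypothesis q0 : q != 0.
Hypothesis q2 : q * q - 1 != 0.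
Hypothesis q_root : forall i : int, q ^ i = 1 -> i = 0.
Local Notation lam := (q - q^-1).
Local Notation qint := (@qint k q).

Lemma lam_neq0 : lam != 0.
Proof.
apply: contra q2 => /eqP h; apply/eqP.
by rewrite -[X in _ - X](divff q0) -mulrBr h mulr0.
Qed.

Lemma qint_eq0 x : qint x = 0 -> x = 0.
Proof.
move=> /eqP; rewrite mulf_eq0 invr_eq0 (negPf lam_neq0) orbF subr_eq0 => /eqP h.
suff /q_root : q ^ (x + x) = 1 by lia.
by rewrite expfzDr // {1}h -expfzDr // addNr.
Qed.
End QuantumIntegers.

(** What the argument uses of the initial action, with the half-integral powers of
q removed by rescaling: [fr j] and [fc j] are q^(-1/2) F for the nodes that act on
rows and on columns, [fm] is q^(-1/2) F_n, [em] is - q^(1/2) E_n, and [ec j] is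
q^(1/2) E for the nodes that act on columns. The weight of a node on an element is
read from its content, which is why the commutators of raising and lowering
operators are stated on homogeneous elements. *)
Record conformal_ops (k : fieldType) (N : nat) (q : k)
    (fr fc : nat -> qmat N.+1 q -> qmat N.+1 q) (fm em : qmat N.+1 q -> qmat N.+1 q)
    (ec : nat -> qmat N.+1 q -> qmat N.+1 q) : Prop := ConformalOps {
  ops_q0 : q != 0;
  ops_q2 : q * q - 1 != 0;
  ops_root : forall i : int, q ^ i = 1 -> i = 0;
  ops_fr : forall j, (j < N)%N -> is_row_op (@zgen k N.+1 q) (inord j) (inord j.+1) (fr j);
  ops_fc : forall j, (j < N)%N ->
    is_row_op (swap (@zgen k N.+1 q)) (inord j) (inord j.+1) (fc j);
  ops_fm : is_corner_op (@zgen k N.+1 q) ord_max fm;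
  ops_fr_comm : forall i j, (i.+1 < j)%N -> (j < N)%N ->
    forall g, fr i (fr j g) = fr j (fr i g);
  ops_em_lin : linear em;
  ops_em1 : em 1 = 0;
  ops_em_z : forall r c g (a al : 'I_N.+1), homog r c g ->
    em (g * zgen q a al) = em g * zgen q a al
      + (q ^ (r ord_max + c ord_max) * (if a == ord_max then q else 1)) *:
        (g * (zgen q a ord_max * zgen q ord_max al));
  ops_em_fm : forall r c g, homog r c g ->
    em (fm g) = fm (em g) - qint q (r ord_max + c ord_max) *: g;
  ops_ec_lin : forall j, (j < N)%N -> linear (ec j);
  ops_ec_shift : forall j, (j < N)%N ->
    shifts (ec j) (fun=> 0) (fun x => (x == inord j)%:R - (x == inord j.+1)%:R);
  ops_ec_fc : forall j r c g, (j < N)%N -> homog r c g ->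
    ec j (fc j g) = fc j (ec j g) + qint q (c (inord j) - c (inord j.+1)) *: g
}.

Section Conformal.
Variables (k : fieldType) (N : nat) (q : k).
Local Notation n := N.+1.
Local Notation A := (qmat n q).
Local Notation z := (@zgen k n q).
Local Notation mx := (ord_max : 'I_n).
Local Notation lam := (q - q^-1).
Local Notation qint := (@qint k q).

Variables (fr fc : nat -> A -> A) (fm em : A -> A) (ec : nat -> A -> A).
Hypothesis ops : conformal_ops fr fc fm em ec.
Let q0 := ops_q0 ops.
Let q2 := ops_q2 ops.
Let q_root := ops_root ops.
Let fr_row := ops_fr ops.
Let fc_col := ops_fc ops.
Let fm_corner := ops_fm ops.
Let fr_comm := ops_fr_comm ops.
Let em_lin := ops_em_lin ops.
Let em1 := ops_em1 ops.
Let em_z := ops_em_z ops.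
Let em_fm := ops_em_fm ops.
Let ec_lin := ops_ec_lin ops.
Let ec_shift := ops_ec_shift ops.
Let ec_fc := ops_ec_fc ops.

(** [xop a] is the iterated q-commutator of [fr a], ..., [fr N.-1], a root vector
that sends row [a] to the last row; the recursion is on the number of steps from
[N.-1]. *)
Fixpoint xrec (d : nat) : A -> A :=
  if d is d'.+1 then
    fun g => xrec d' (fr (N.-1 - d) g) - q *: fr (N.-1 - d) (xrec d' g)
  else fr N.-1.

Definition xop (a : nat) : A -> A := xrec (N.-1 - a).

Lemma xop_last : xop N.-1 = fr N.-1.
Proof. by rewrite /xop subnn. Qed.

Lemma xop_step a g : (a.+1 < N)%N ->
  xop a g = xop a.+1 (fr a g) - q *: fr a (xop a.+1 g).
Proof.
move=> aN; rewrite /xop (_ : N.-1 - a = (N.-1 - a.+1).+1)%N; last by lia.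
by rewrite /= (_ : N.-1 - (N.-1 - a.+1).+1 = a)%N; last by lia.
Qed.

Lemma xop_ind (Q : nat -> Prop) : ((0 < N)%N -> Q N.-1) ->
  (forall a, (a.+1 < N)%N -> Q a.+1 -> Q a) -> forall a, (a < N)%N -> Q a.
Proof.
move=> Ql Qs a aN; have [d ad] : exists d, (a + d = N.-1)%N.
  by exists (N.-1 - a)%N; lia.
elim: d a aN ad => [|d IHd] a aN ad.
  by rewrite (_ : a = N.-1); [apply: Ql; lia | lia].
by apply: Qs; [lia | apply: IHd; lia].
Qed.

Lemma fr_lin j : (j < N)%N -> linear (fr j).
Proof. by move=> /fr_row[]. Qed.

Lemma xop_lin a : (a < N)%N -> linear (xop a).
Proof.
elim/xop_ind=> {a} [N0|a aN IH].
  by rewrite xop_last; apply: fr_lin; lia.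
have flin := fr_lin (ltnW aN).
by move=> e g h; rewrite !(xop_step _ aN) !flin !IH flin; lfield k.
Qed.

Lemma xop1 a : (a < N)%N -> xop a 1 = 0.
Proof.
elim/xop_ind=> {a} [N0|a aN IH].
  have [|_ f1 _] := fr_row (j := N.-1); first by lia.
  by rewrite xop_last.
have [flin f1 _] := fr_row (ltnW aN).
by rewrite (xop_step _ aN) f1 IH (rlin0 (xop_lin aN)) (rlin0 flin) scaler0 subr0.
Qed.

Lemma fr_zE j g (c ga : 'I_n) : (j < N)%N -> fr j (g * z c ga) =
  (if c == j :> nat then q^-1 else if c == j.+1 :> nat then q else 1) *:
    (fr j g * z c ga) + (c == j :> nat)%:R *: (g * z (inord j.+1) ga).
Proof.
move=> jN; have [_ _ ->] := fr_row jN; rewrite /rowwt.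
by rewrite -!val_eqE /= !inordK //; lia.
Qed.

Lemma fr_xop_comm i b : (i.+1 < b)%N -> (b < N)%N -> forall g,
  xop b (fr i g) = fr i (xop b g).
Proof.
move=> ib bN; move: b bN ib; apply: xop_ind => [N0|b bN IH] ib g.
  by rewrite xop_last (fr_comm ib) //; lia.
rewrite !(xop_step _ bN) !(rlinB (fr_lin (_ : (i < N)%N))); try lia.
rewrite (rlinZ (fr_lin (_ : (i < N)%N))); last by lia.
rewrite -IH; last by lia.
rewrite (fr_comm ib) 1?IH //; try lia.
by rewrite (fr_comm ib) //; lia.
Qed.

(** The twisted Leibniz rule of a composite root vector acquires a tail that
involves the shorter ones. *)
Lemma xop_z a g (c ga : 'I_n) : (a < N)%N -> xop a (g * z c ga) =
  (if c == a :> nat then q^-1 else if c == mx then q else 1) *: (xop a g * z c ga)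
  + (c == a :> nat)%:R *: (g * z mx ga - lam *:
      \sum_(b < n | (a < b < N)%N) xop b g * z b ga).
Proof.
move=> aN; move: a aN g c ga; apply: xop_ind => [N0|a aN IH] g c ga.
  rewrite xop_last fr_zE; last by lia.
  rewrite big_pred0 => [|b]; last by apply/negbTE; lia.
  rewrite scaler0 subr0 (_ : N.-1.+1 = N) ?prednK //.
  rewrite -[c == mx]val_eqE /= (_ : inord N = mx) //.
  by apply: val_inj; rewrite /= inordK.
have flin := fr_lin (ltnW aN); have xlin := xop_lin aN.
have aN1 : (a < N)%N by lia.
have ina : (inord a.+1 : 'I_n) = a.+1 :> nat by rewrite inordK //; lia.
rewrite (xop_step _ aN) fr_zE // (rlinD xlin) !(rlinZ xlin) !IH ina.
rewrite (rlinD flin) !(rlinZ flin) (rlinB flin) (rlinZ flin) (rlin_sum flin).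
rewrite (xop_step _ aN) mulrBl -scalerAl.
have amx : (mx == a :> nat) = false by rewrite /=; lia.
have amx1 : (mx == a.+1 :> nat) = false by rewrite /=; lia.
rewrite (fr_zE (xop a.+1 g)) // (fr_zE g mx) // amx amx1 eqxx.
have -> : \sum_(i < n | (a.+1 < i < N)%N) fr a (xop i g * z i ga) =
    \sum_(i < n | (a.+1 < i < N)%N) xop i (fr a g) * z i ga.
  apply: eq_bigr => i /andP[ai iN]; rewrite fr_zE // fr_xop_comm //.
  rewrite (_ : (i == a :> nat) = false); last by lia.
  rewrite (_ : (i == a.+1 :> nat) = false); last by lia.
  by rewrite scale0r addr0 scale1r.
have -> : \sum_(b < n | (a < b < N)%N) xop b g * z b ga =
    xop a.+1 g * z (inord a.+1) ga + \sum_(b < n | (a.+1 < b < N)%N) xop b g * z b ga.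
  rewrite (bigD1 (inord a.+1)) /=; last by rewrite ina; lia.
  rewrite ina; congr (_ + _); apply: eq_bigl => b.
  by rewrite -val_eqE /= ina; apply/idP/idP; lia.
set S1 := \sum_(i < n | _) xop _ (fr a g) * _.
set S2 := \sum_(i < n | _) xop _ g * _.
have [ca|ca] := eqVneq (c : nat) a.
  rewrite (_ : (c == a.+1 :> nat) = false); last by lia.
  rewrite (_ : (c == mx) = false); last by apply/negbTE; rewrite -val_eqE /=; lia.
  by lfield k.
have [ca1|ca1] := eqVneq (c : nat) a.+1.
  rewrite (_ : (c == mx) = false); last by apply/negbTE; rewrite -val_eqE /=; lia.
  by lfield k.
by case: (c == mx); lfield k.
Qed.

(** The relation that moves the last column factor of [conformal_raising] past a
new generator. *)
Lemma corner_swap (b c ga : 'I_n) : (b < N)%N ->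
  ((if ga == mx then q else 1) * (if c == mx then q^-1 else 1)) *:
    ((if c == b :> nat then q^-1 else if c == mx then q else 1) *: (z c ga * z b mx)
     - ((c < b)%N%:R * lam) *: (z b ga * z c mx)) = z b mx * z c ga.
Proof.
move=> bN; have [r1 r2 r3 r4] := zgen_qrel n q.
have mxE (i : 'I_n) : (i == mx) = (i == N :> nat) by rewrite -val_eqE.
have ltmx (i : 'I_n) : i != mx -> (i < mx)%N by rewrite mxE /=; have := ltn_ord i; lia.
have [cb|bc|/val_inj cb] := ltngtP c b.
- have cN : (c == mx) = false by rewrite mxE; lia.
  rewrite cN; have [->|gN] := eqVneq ga mx; first by rewrite r2 //; lfield k.
  by rewrite (r4 c b ga mx) ?ltmx // (r3 c b mx ga) ?ltmx //; lfield k.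
- have [->|gN] := eqVneq ga mx.
    by rewrite (r2 b c) //; case: (c == mx); lfield k.
  by rewrite (r3 b c mx ga) ?ltmx //; case: (c == mx); lfield k.
- have bN' : (b == mx) = false by rewrite mxE; lia.
  rewrite cb bN'; have [->|gN] := eqVneq ga mx; first by lfield k.
  by rewrite r1 ?ltmx //; lfield k.
Qed.

(** The raising operator of the middle node, which is quadratic on generators, is
expressed through lowering operators. The proof is by induction on words: the
tails of [xop_z] are those that [corner_swap] absorbs, and the four cases at the
end say whether the new generator lies in the last row or column. *)
Lemma conformal_raising r c g : homog r c g ->
  em g = q ^ (c mx - r mx) *: (\sum_(b < n | (b < N)%N) xop b g * z b mx)
         + (q ^ c mx * qint (r mx)) *: (g * z mx mx).
Proof.
elim=> {r c g} [r c r0 c0|r c|r c e f g _ IHf _ IHg|r c r' c' f a al hf IH hr hc].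
- rewrite em1 big1 => [|b bN]; last by rewrite xop1 ?mul0r.
  by rewrite /qint r0 oppr0 subrr mul0r mulr0 scaler0 scale0r addr0.
- rewrite (rlin0 em_lin) big1 => [|b bN]; last by rewrite (rlin0 (xop_lin bN)) mul0r.
  by rewrite mul0r !scaler0 addr0.
- have -> : \sum_(b < n | (b < N)%N) xop b (e *: f + g) * z b mx =
      e *: (\sum_(b < n | (b < N)%N) xop b f * z b mx) +
      \sum_(b < n | (b < N)%N) xop b g * z b mx.
    rewrite scaler_sumr -big_split; apply: eq_bigr => b bN.
    by rewrite (xop_lin bN) mulrDl scalerAl.
  rewrite em_lin IHf IHg mulrDl -scalerAl.
  set S := \sum_(b < n | _) _; set T := \sum_(b < n | _) _; lfield k.
rewrite (em_z _ _ hf) IH {IH}; set X := \sum_(b < n | _) xop b f * _.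
have mxE (i : 'I_n) : (i == mx) = (i == N :> nat) by rewrite -val_eqE.
have ltmx (i : 'I_n) : i != mx -> (i < N)%N by rewrite mxE; have := ltn_ord i; lia.
have qz i j : q ^ (i + j) = q ^ i * q ^ j by rewrite expfzDr.
have qb (b : bool) : q ^ (b%:R : int) = if b then q else 1 by case: b.
have qN i : q ^ (- i) = (q ^ i)^-1 by rewrite invr_expz.
(* The tail of [xop_z] occurs only for the row a of the new generator; there it is
   spread over the rows b > a. *)
have sumE : \sum_(b < n | (b < N)%N) xop b (f * z a al) * z b mx =
    \sum_(b < n | (b < N)%N) xop b f *
      ((if a == b :> nat then q^-1 else if a == mx then q else 1) *: (z a al * z b mx)
       - ((a < b)%N%:R * lam) *: (z b al * z a mx))
    + (a < N)%N%:R *: (f * (z mx al * z a mx)).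
  pose W := f * z mx al - lam *: \sum_(b < n | (a < b < N)%N) xop b f * z b al.
  transitivity (\sum_(b < n | (b < N)%N) xop b f *
      ((if a == b :> nat then q^-1 else if a == mx then q else 1) *: (z a al * z b mx))
      + (a < N)%N%:R *: (W * z a mx)).
    under eq_bigr => b bN do rewrite xop_z // mulrDl -scalerAl -mulrA scalerAr.
    rewrite big_split /=; congr (_ + _); rewrite (big_mkcond (fun i : 'I_n => (i < N)%N)) /=.
    rewrite (bigD1 a) //= [X in _ + X = _]big1 => [|b ba]; last first.
      rewrite (_ : (a == b :> nat) = false) ?scale0r ?mul0r ?if_same //.
      by rewrite (inj_eq val_inj) eq_sym (negPf ba).
    by rewrite eqxx addr0; case: ltnP; rewrite ?scale0r // !scale1r.
  rewrite [X in _ = X + _](eq_bigr (fun b : 'I_n => xop b f *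
      ((if a == b :> nat then q^-1 else if a == mx then q else 1) *: (z a al * z b mx))
      + (- lam) *: ((a < b)%N%:R *: (xop b f * (z b al * z a mx))))) => [|b bN]; last first.
    by rewrite mulrBr -[X in _ - X]scalerAr scalerA mulNr [lam * _]mulrC scaleNr.
  rewrite big_split /= -addrA; congr (_ + _); rewrite -scaler_sumr /W.
  have -> : \sum_(b < n | (b < N)%N) (a < b)%N%:R *: (xop b f * (z b al * z a mx)) =
      (a < N)%N%:R *: ((\sum_(b < n | (a < b < N)%N) xop b f * z b al) * z a mx).
    have [aN|Na] := ltnP a N; last first.
      rewrite scale0r big1 // => b bN; rewrite (_ : (a < b)%N = false) ?scale0r //.
      by apply/negbTE; lia.
    rewrite scale1r mulr_suml [RHS]big_mkcond [LHS]big_mkcond /=.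
    apply: eq_bigr => b _; rewrite andbC; case: (b < N)%N => //=.
    by case: (a < b)%N; rewrite ?scale0r // scale1r mulrA.
  by rewrite mulrBl -scalerAl mulrA; lfield k.
rewrite sumE (_ : c' mx - r' mx = (c mx - r mx) + ((mx == al)%:R - (mx == a)%:R));
  last by rewrite hr hc; ring.
rewrite (qz (c mx - r mx)); set u := q ^ (_ - (mx == a)%:R).
have uE : u = (if al == mx then q else 1) * (if a == mx then q^-1 else 1).
  by rewrite /u qz qN !qb ![mx == _]eq_sym; case: (a == mx); rewrite ?invr1.
set Sg := \sum_(b < n | _) xop b f * _.
have SgE : u *: Sg = X * z a al.
  rewrite mulr_suml scaler_sumr; apply: eq_bigr => b bN.
  by rewrite scalerAr uE corner_swap // mulrA.
rewrite -(scalerA _ u) (scalerDr u) SgE.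
rewrite mulrDl -!scalerAl -!mulrA /qint !qN hr hc !qz !qb ![mx == _]eq_sym qN uE -!mulrA.
have [_ r2 r3 r4] := zgen_qrel n q; have [r1 _ _ _] := zgen_qrel n q.
have x0 : q ^ r mx != 0 by rewrite expfz_neq0.
have y0 : q ^ c mx != 0 by rewrite expfz_neq0.
set x := q ^ r mx in x0 *; set y := q ^ c mx in y0 *.
have [am|am] := eqVneq a mx; have [alm|alm] := eqVneq al mx.
- by rewrite am alm /= ltnn; lfield k.
- by rewrite am /= ltnn (r1 mx al mx) ?ltmx // -scalerAr; lfield k.
- by rewrite alm ltmx // (r2 a mx mx) ?ltmx // -scalerAr; lfield k.
- by rewrite ltmx // (r4 a mx al mx) ?ltmx // (r3 a mx mx al) ?ltmx // mulrDr -scalerAr;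
    lfield k.
Qed.
Inductive lowering : (A -> A) -> Prop :=
| lowering_row j : (j < N)%N -> lowering (fr j)
| lowering_col j : (j < N)%N -> lowering (fc j)
| lowering_corner : lowering fm.

(** On an element [g] killed by all lowering operators, the formula for [em]
reduces to a multiple of g z_n^n. Applying [fm] and comparing with the commutator
of [em] and [fm] gives degree 0 in the last column; then the commutators of [ec]
and [fc] propagate this to the other columns, because the value of [ec] on [g] has
negative degree in a column. *)
Lemma joint_kernel r c g : homog r c g -> (forall f, lowering f -> f g = 0) ->
  g = 0 \/ forall x, c x = 0.
Proof.
move=> hg fg; have [g0|g0] := eqVneq g 0; [by left | right].
have gN0 e : e *: g = 0 -> e = 0.
  by move=> /eqP; rewrite scaler_eq0 (negPf g0) orbF => /eqP.
have [fml fm1 fmz] := fm_corner.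
have xop0 a : (a < N)%N -> xop a g = 0.
  move: a; apply: xop_ind => [N0|a aN IH].
    by rewrite xop_last fg //; apply: lowering_row; lia.
  have aN1 : (a < N)%N by lia.
  rewrite (xop_step _ aN) IH (fg _ (lowering_row aN1)).
  rewrite (rlin0 (xop_lin aN)) (rlin0 (fr_lin aN1)).
  by rewrite scaler0 subr0.
have emg : em g = (q ^ c mx * qint (r mx)) *: (g * z mx mx).
  rewrite (conformal_raising hg).
  rewrite big1 ?scaler0 ?add0r // => b bN.
  by rewrite xop0 ?mul0r.
have cmx : c mx = 0.
  have := em_fm hg; rewrite (fg _ lowering_corner) (rlin0 em_lin) emg.
  rewrite (rlinZ fml) fmz (fg _ lowering_corner) mul0r scaler0 add0r !eqxx scale1r.
  rewrite -scalerBl => /esym/gN0/eqP; rewrite subr_eq0 => /eqP h.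
  suff /q_root : q ^ (c mx + c mx) = 1 by lia.
  have x0 : q ^ r mx != 0 by rewrite expfz_neq0.
  have y0 : q ^ c mx != 0 by rewrite expfz_neq0.
  move: h; rewrite /qint -!invr_expz !expfzDr //.
  set x := q ^ r mx in x0 *; set y := q ^ c mx in y0 * => /(congr1 (fun u => u * (lam * x * y))).
  have lam0 := lam_neq0 q0 q2.
  have -> : y * ((x - x^-1) / lam) * (lam * x * y) = x ^+ 2 * y ^+ 2 - y * y.
    by field; rewrite x0 q0 q2.
  have -> : (x * y - (x * y)^-1) / lam * (lam * x * y) = x ^+ 2 * y ^+ 2 - 1.
    by field; rewrite x0 y0 q0 q2.
  by move=> /addrI/oppr_inj.
(* Descending induction on the column. *)
have cj d : (d <= N)%N -> c (inord (N - d)) = 0.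
  elim: d => [|d IHd] dN.
    by rewrite subn0 (_ : inord N = mx) //; apply: val_inj; rewrite /= inordK.
  have jN : (N - d.+1 < N)%N by lia.
  have jS : (N - d.+1).+1 = (N - d)%N by lia.
  have jNj : (inord (N - d) == inord (N - d.+1) :> 'I_n) = false.
    by apply/negbTE; rewrite -val_eqE /= !inordK; lia.
  have := ec_fc jN hg; rewrite (fg _ (lowering_col jN)) (rlin0 (ec_lin jN)).
  have -> : ec (N - d.+1) g = 0.
    apply: (homog_neg_col (a := inord (N - d)) (ec_shift jN hg)).
    by rewrite jS jNj eqxx IHd //; lia.
  have [fcl _ _] := fc_col jN; rewrite (rlin0 fcl) add0r jS IHd; last by lia.
  by rewrite subr0 => /esym/gN0/(qint_eq0 q0 q2 q_root).
move=> x; rewrite -(cj (N - x)%N) ?leq_subr //; congr (c _).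
by apply: val_inj; rewrite /= inordK; have := ltn_ord x; lia.
Qed.

Lemma homog_col0 r c f : @homog k n q r c f -> (forall a, c a = 0) ->
  f = 0 \/ forall a, r a = 0.
Proof.
elim=> {r c f} [r c r0 _|r c|r c e f g _ IHf _ IHg|r c r' c' f b al hf _ hr hc] c0.
- by right.
- by left.
- case: (IHf c0) => [->|]; last by right.
  by case: (IHg c0) => [->|]; [left; rewrite scaler0 addr0 | right].
- left; rewrite (homog_neg_col (a := al) hf) ?mul0r //.
  by have := hc al; rewrite c0 eqxx /=; lia.
Qed.

(** The weights decrease with the index: moving a row or column index up by one
lowers the height, and so does the removal of z_n^n. *)
Definition height (r c : 'I_n -> int) : int :=
  \sum_(x < n) (n - x)%N%:Z * (r x + c x).

Lemma height_delta (j : 'I_n) : \sum_(x < n) (n - x)%N%:Z * (x == j)%:R = (n - j)%N%:Z.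
Proof.
rewrite (bigD1 j) //= eqxx mulr1 big1 ?addr0 // => i /negPf->.
by rewrite mulr0.
Qed.

Lemma lowering_height f r c g : lowering f -> homog r c g ->
  exists r' c', homog r' c' (f g) /\ height r' c' <= height r c - 1.
Proof.
have step j : (j < N)%N ->
    \sum_(x < n) (n - x)%N%:Z * ((x == inord j.+1)%:R - (x == inord j)%:R) = -1.
  move=> jN; under eq_bigr do rewrite mulrBr.
  by rewrite sumrB !height_delta !inordK //; lia.
case=> [j jN|j jN|] hg.
- exists (fun x => r x + ((x == inord j.+1)%:R - (x == inord j)%:R)), (fun x => c x + 0).
  split; first exact: (row_op_shifts (fr_row jN) hg).
  rewrite /height -(step j jN) -big_split /=;
  rewrite le_eqVlt; apply/orP; left; apply/eqP/eq_bigr => x _; ring.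
- exists (fun x => r x + 0), (fun x => c x + ((x == inord j.+1)%:R - (x == inord j)%:R)).
  split; first exact: (col_op_shifts (fc_col jN) hg).
  rewrite /height -(step j jN) -big_split /=;
  rewrite le_eqVlt; apply/orP; left; apply/eqP/eq_bigr => x _; ring.
- exists (fun x => r x - (x == mx)%:R), (fun x => c x - (x == mx)%:R).
  split; first exact: (corner_op_shifts fm_corner hg).
  have -> : height (fun x => r x - (x == mx)%:R) (fun x => c x - (x == mx)%:R) =
      height r c - \sum_(x < n) (n - x)%N%:Z * (x == mx)%:R
                 - \sum_(x < n) (n - x)%N%:Z * (x == mx)%:R.
    by rewrite -!sumrB; apply: eq_bigr => x _; ring.
  by rewrite !height_delta /=; lia.
Qed.

Lemma height_neg r c g : @homog k n q r c g -> height r c < 0 -> g = 0.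
Proof.
move=> hg; have [/existsP[x xr]|] := boolP [exists x, r x < 0].
  by rewrite (homog_neg_row hg xr).
have [/existsP[x xc] _|] := boolP [exists x, c x < 0].
  by rewrite (homog_neg_col hg xc).
rewrite !negb_exists => /forallP c0 /forallP r0; rewrite ltNge sumr_ge0 // => x _.
by rewrite mulr_ge0 // addr_ge0 // leNgt.
Qed.

(** Induction on the height: on an element of minimal height all lowerings vanish,
so that the image under [L] lies in the joint kernel, hence is constant. *)
Theorem rigidity (L : A -> A) dr dc : linear L -> shifts L dr dc ->
  (forall f, lowering f -> forall g, L (f g) = 0 -> f (L g) = 0) ->
  (forall r c g e, homog r c g -> (forall x, r x + dr x = 0) ->
     (forall x, c x + dc x = 0) -> L g = e%:A -> e = 0) ->
  forall g, L g = 0.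
Proof.
move=> Llin Lsh Lf Le; apply: homog_span.
  by move=> e f g Lf0 Lg0; rewrite Llin Lf0 Lg0 scaler0 addr0.
move=> r c g hg; have [K] : exists K : nat, height r c < K%:Z.
  by exists `|height r c|.+1; lia.
elim: K r c g hg => [|K IHK] r c g hg hK.
  by rewrite (height_neg hg hK) (rlin0 Llin).
have fL f : lowering f -> f (L g) = 0.
  move=> hf; apply: (Lf) => //; have [r' [c' [hfg hh]]] := lowering_height hf hg.
  by apply: IHK hfg _; lia.
have hL := Lsh _ _ _ hg.
have [//|c0] := joint_kernel hL fL.
have [//|r0] := homog_col0 hL c0.
have [e Lg] := homog_const hL c0.
by rewrite Lg (Le _ _ _ _ hg r0 c0 Lg) scale0r.
Qed.
End Conformal.

(** * Quadratic relations between the partial derivatives *)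
Section PartialRelations.
Variables (k : fieldType) (N : nat) (q : k).
Local Notation n := N.+1.
Local Notation A := (qmat n q).
Local Notation z := (@zgen k n q).
Local Notation mx := (ord_max : 'I_n).
Local Notation lam := (q - q^-1).
Variables (fr fc : nat -> A -> A) (fm em : A -> A) (ec : nat -> A -> A).
Hypothesis ops : conformal_ops fr fc fm em ec.
Variable D : 'I_n -> 'I_n -> A -> A.
Hypothesis calc : is_calculus z D.
Let q0 := ops_q0 ops.
Let Dlin a al : linear (D a al). Proof. by case: calc. Qed.

(** The braided flip on a pair of indices, which satisfies the quadratic Hecke
relation [hecke_coef_sq]. *)
Definition hecke (V : lmodType k) (G : 'I_n -> 'I_n -> V) (a b : 'I_n) : V :=
  (if a == b then q else 1) *: G b a + (if (a < b)%N then lam else 0) *: G a b.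

(** How a product of two derivatives, each of which satisfies [calculus_row], moves
past a lowering operator. *)
Definition pair_cov (j j' : 'I_n) (f : A -> A) (G : 'I_n -> 'I_n -> A -> A) :=
  forall a b g, G a b (f g) =
    (rowwt q j j' a * rowwt q j j' b) *: f (G a b g)
    + ((a == j')%:R * rowwt q j j' b) *: G j b g + (b == j')%:R *: G a j g.

Lemma pair_cov_lin j j' f G H e e' : linear f -> pair_cov j j' f G ->
  pair_cov j j' f H -> pair_cov j j' f (fun a b g => e *: G a b g + e' *: H a b g).
Proof.
by move=> fl hG hH a b g; rewrite hG hH (rlinD fl) !(rlinZ fl); lfield k.
Qed.

(** The braided flip commutes with the action on pairs of indices. *)
Lemma pair_cov_hecke (j j' : 'I_n) f G : linear f -> j' = j.+1 :> nat ->
  pair_cov j j' f G ->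
  pair_cov j j' f (fun a b g => hecke (fun a b => G a b g) a b).
Proof.
move=> fl jj' hG a b g; rewrite /hecke !hG (rlinD fl) !(rlinZ fl) /rowwt.
have vE (x y : 'I_n) : (x == y) = (x == y :> nat) by rewrite -val_eqE.
have jlt : (j < j')%N by rewrite jj'.
have j'j : (j' == j) = false by rewrite vE gtn_eqF.
have jj'F : (j == j') = false by rewrite vE ltn_eqF.
have [->|aj'] := eqVneq a j'; have [->|bj'] := eqVneq b j'.
- rewrite j'j jj'F ?eqxx ?ltnn jlt (ltnNge j') (ltnW jlt) /=; lfield k.
- have [bj|bj] := eqVneq b j.
    by rewrite ?bj ?eqxx ?j'j ?ltnn ?(ltnNge j') ?(ltnW jlt) /=; lfield k.
  have jb : (j == b) = false by rewrite eq_sym (negPf bj).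
  have j'b : (j' == b) = false by rewrite eq_sym (negPf bj').
  have -> : (j' < b)%N = (j < b)%N.
    by move: bj'; rewrite vE jj'; case: ltngtP; lia.
  by rewrite ?jb ?j'b ?j'j ?eqxx; lfield k.
- have [aj|aj] := eqVneq a j.
    by rewrite ?aj ?eqxx ?j'j ?jj'F ?ltnn ?jlt; lfield k.
  have -> : (a < j')%N = (a < j)%N.
    by move: aj; rewrite vE jj'; case: ltngtP; lia.
  by rewrite ?(negPf aj') ?j'j ?jj'F ?eqxx; lfield k.
- by have [->|ab] := eqVneq a b; lfield k.
Qed.

Lemma pair_cov_partial (j j' : 'I_n) f (E F : 'I_n -> A -> A) :
  (forall a, linear (E a)) ->
  (forall a g, E a (f g) = rowwt q j j' a *: f (E a g) + (a == j')%:R *: E j g) ->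
  (forall a g, F a (f g) = rowwt q j j' a *: f (F a g) + (a == j')%:R *: F j g) ->
  pair_cov j j' f (fun a b g => E a (F b g)).
Proof.
move=> El hE hF a b g; rewrite hF (rlinD (El _)) !(rlinZ (El _)) hE.
by lfield k.
Qed.

Lemma pair_cov_ext j j' f G H : (forall a b g, G a b g = H a b g) ->
  pair_cov j j' f G -> pair_cov j j' f H.
Proof. by move=> GH hG a b g; rewrite -!GH. Qed.

Definition partial2 (a b al be : 'I_n) (g : A) : A := D a al (D b be g).

(** The difference between the braided flips of the row indices and of the column
indices of a product of two derivatives. *)
Definition partial_defect (a b al be : 'I_n) (g : A) : A :=
  hecke (fun a b => partial2 a b al be g) a b - hecke (fun al be => partial2 a b al be g) al be.

Lemma partial2_lin a b al be : linear (partial2 a b al be).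
Proof. by move=> e f g; rewrite /partial2 !Dlin. Qed.

Lemma partial_defect_lin a b al be : linear (partial_defect a b al be).
Proof. by move=> e f g; rewrite /partial_defect /hecke !partial2_lin; lfield k. Qed.

Lemma partial_fr j a al g : (j < N)%N -> D a al (fr j g) =
  rowwt q (inord j) (inord j.+1) a *: fr j (D a al g)
  + (a == inord j.+1)%:R *: D (inord j) al g.
Proof.
move=> jN; apply: (calculus_row q0 (zgen_spanning (q := q)) _ calc (ops_fr ops jN)).
by rewrite !inordK //; lia.
Qed.

Lemma partial_fc j a al g : (j < N)%N -> D a al (fc j g) =
  rowwt q (inord j) (inord j.+1) al *: fc j (D a al g)
  + (al == inord j.+1)%:R *: D a (inord j) g.
Proof.
move=> jN; have := calculus_row q0 (spanning_swap (zgen_spanning (q := q))) _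
  (is_calculus_swap q0 calc) (ops_fc ops jN) al a g; rewrite /swap => -> //.
by rewrite !inordK //; lia.
Qed.

Lemma partial_fm a al g :
  D a al (fm g) = (cornerwt q mx a * cornerwt q mx al) *: fm (D a al g).
Proof.
apply: (calculus_corner q0 (zgen_spanning (q := q)) _ calc (ops_fm ops)).
by move=> i; rewrite -ltnS ltn_ord.
Qed.

Lemma partial_defect_fr j al be : (j < N)%N ->
  pair_cov (inord j) (inord j.+1) (fr j) (fun a b => partial_defect a b al be).
Proof.
move=> jN; have [fl _ _] := ops_fr ops jN.
have jj' : (inord j.+1 : 'I_n) = (inord j : 'I_n).+1 :> nat by rewrite !inordK //; lia.
have cov al' be' : pair_cov (inord j) (inord j.+1) (fr j)
    (fun a b => partial2 a b al' be').
  apply: (pair_cov_partial (E := fun a => D a al') (F := fun a => D a be')) => //.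
    by move=> a g; apply: partial_fr.
  by move=> a g; apply: partial_fr.
apply: pair_cov_ext (pair_cov_lin 1 (-1) fl (pair_cov_hecke fl jj' (cov al be))
   (pair_cov_lin (if al == be then q else 1) (if (al < be)%N then lam else 0) fl
      (cov be al) (cov al be))) => a b g.
by rewrite scale1r scaleN1r.
Qed.

Lemma partial_defect_fc j a b : (j < N)%N ->
  pair_cov (inord j) (inord j.+1) (fc j) (fun al be => partial_defect a b al be).
Proof.
move=> jN; have [fl _ _] := ops_fc ops jN.
have jj' : (inord j.+1 : 'I_n) = (inord j : 'I_n).+1 :> nat by rewrite !inordK //; lia.
have cov a' b' : pair_cov (inord j) (inord j.+1) (fc j) (partial2 a' b').
  apply: (pair_cov_partial (E := D a') (F := D b')) => //.
    by move=> al g; apply: partial_fc.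
  by move=> al g; apply: partial_fc.
apply: pair_cov_ext (pair_cov_lin (-1) 1 fl (pair_cov_hecke fl jj' (cov a b))
   (pair_cov_lin (if a == b then q else 1) (if (a < b)%N then lam else 0) fl
      (cov b a) (cov a b))) => al be g.
by rewrite scale1r scaleN1r addrC.
Qed.

Lemma partial_defect_fm a b al be g : partial_defect a b al be (fm g) =
  (cornerwt q mx a * cornerwt q mx b * (cornerwt q mx al * cornerwt q mx be)) *:
    fm (partial_defect a b al be g).
Proof.
have [fl _ _] := ops_fm ops.
rewrite /partial_defect /hecke /partial2 !(partial_fm, rlinZ (Dlin _ _)).
by rewrite (rlinB fl) !(rlinD fl) !(rlinZ fl); lfield k.
Qed.

(** The matrix of the braided flip. *)
Definition hecke_coef (a b c d : 'I_n) : k :=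
  (if a == b then q else 1) * ((b == c) && (a == d))%:R
  + (if (a < b)%N then lam else 0) * ((a == c) && (b == d))%:R.

Lemma partial2_zz a b al be c d ga de :
  partial2 a b al be (z c ga * z d de) =
  (hecke_coef a b c d * hecke_coef al be ga de
   + ((a == c) && (b == d))%:R * ((al == ga) && (be == de))%:R)%:A.
Proof.
have [_ D1 Dz] := calc.
have Dgen x xi y yi : D x xi (z y yi) = ((x == y)%:R * (xi == yi)%:R)%:A.
  rewrite -[z y yi]mul1r Dz -mulnb natrM.
  rewrite [X in X + _](_ : _ = 0) ?add0r //.
  rewrite (@eq_Rmx k n q _ _ (fun _ _ => 0)); last first.
    move=> *; rewrite (@eq_Rmx k n q _ _ (fun _ _ => 0)); last by move=> *; rewrite D1 mul0r.
    by rewrite /Rmx big1 // !scaler0 if_same addr0.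
  by rewrite /Rmx big1 // !scaler0 if_same addr0.
have Rdelta (V : lmodType k) (v : V) (x y u v' : 'I_n) :
    Rmx q (fun b' d' => ((b' == u)%:R * (v' == d')%:R) *: v) x y = hecke_coef v' x u y *: v.
  rewrite /Rmx /hecke_coef [v' == x]eq_sym.
  have -> : \sum_(b < n | (b < x)%N) ((b == u)%:R * (v' == b)%:R) *: v =
      ((u < x)%N%:R * (v' == u)%:R) *: v.
    rewrite (bigID (pred1 u)) /= [X in _ + X]big1 => [|i /andP[_ /negPf->]]; last first.
      by rewrite mul0r scale0r.
    rewrite addr0; case: (ltnP u x) => ux; last first.
      rewrite mul0r scale0r big1 // => i /andP[ix /eqP iu].
      by rewrite iu ltnNge ux in ix.
    rewrite (bigD1 u) ?ux /= ?eqxx // big1 ?addr0 // => i.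
    by rewrite andbAC -andbA andNb andbF.
  have [<-|xy] := eqVneq x y; last first.
    rewrite andbF mulr0 !addr0 scale1r -mulnb natrM.
    have [->|v'y] := eqVneq v' y; last by rewrite !mulr0.
    by rewrite (negPf xy) mul1r.
  rewrite andbT; have [->|v'u] := eqVneq v' u.
    rewrite [u == x]eq_sym; case: (x == u); case: (u < x)%N; rewrite /=; lfield k.
  rewrite mulr0 scale0r scaler0 addr0 /= mulr0 addr0.
  have [xu|xu] := eqVneq x u; last first.
    by rewrite /= ?mul0r ?mulr0 ?scale0r ?scaler0.
  by rewrite xu (negPf v'u) /= ?mulr0 ?scale0r ?scaler0.
rewrite /partial2 Dz (rlinD (Dlin _ _)) (rlinZ (Dlin _ _)) Dgen scalerDl; congr (_ + _).
  rewrite (Rmx_map q (Dlin a al)).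
  rewrite (@eq_Rmx k n q _ _ (fun be' de' => (((be' == ga)%:R * (al == de')%:R) *:
      (hecke_coef a b c d)%:A))) => [|be' de'].
    by rewrite Rdelta scalerA mulrC.
  rewrite (Rmx_map q (Dlin a al)).
  rewrite (@eq_Rmx k n q _ _ (fun b' d' => ((b' == c)%:R * (a == d')%:R) *:
      ((be' == ga)%:R * (al == de')%:R)%:A)) => [|b' d'].
    by rewrite Rdelta !scalerA mulrC.
  by rewrite Dgen -scalerAl mul1r (rlinZ (Dlin _ _)) Dgen !scalerA; congr (_ *: _); ring.
by rewrite scalerA -!mulnb !natrM; congr (_ *: _); ring.
Qed.

Lemma hecke_coef_sq a b c d :
  (if a == b then q else 1) * hecke_coef b a c d
  + (if (a < b)%N then lam else 0) * hecke_coef a b c d =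
  ((a == c) && (b == d))%:R + lam * hecke_coef a b c d.
Proof.
rewrite /hecke_coef [b == a]eq_sym.
have [->|ab] := eqVneq a b.
  by rewrite ltnn; set I := (_ && _)%:R; field.
set I := ((b == c) && (a == d))%:R; set J := ((a == c) && (b == d))%:R.
case: ltngtP => [lt_ab|lt_ba|/val_inj ab0]; last by rewrite ab0 eqxx in ab.
  by field.
by field.
Qed.

(** With R the braided flip, the product of two derivatives takes on a product of
two generators the value R x R + 1 x 1. Applying R to the rows or to the columns
gives the same result because R^2 = 1 + lam R. *)
Lemma partial_defect_zz a b al be c d ga de :
  partial_defect a b al be (z c ga * z d de) = 0.
Proof.
have h1 := hecke_coef_sq a b c d; have h2 := hecke_coef_sq al be ga de.
have h3 : (if a == b then q else 1) * ((b == c) && (a == d))%:R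
    + (if (a < b)%N then lam else 0) * ((a == c) && (b == d))%:R = hecke_coef a b c d by [].
have h4 : (if al == be then q else 1) * ((be == ga) && (al == de))%:R
    + (if (al < be)%N then lam else 0) * ((al == ga) && (be == de))%:R =
    hecke_coef al be ga de by [].
move: h1 h2 h4 h3; rewrite /partial_defect /hecke !partial2_zz.
set S := hecke_coef a b c d; set S' := hecke_coef b a c d.
set T := hecke_coef al be ga de; set T' := hecke_coef be al ga de.
set I := ((be == ga) && (al == de))%:R; set I' := ((al == ga) && (be == de))%:R.
set J := ((b == c) && (a == d))%:R; set J' := ((a == c) && (b == d))%:R.
set qa := if a == b then q else 1; set la := if (a < b)%N then lam else 0.
set qb := if al == be then q else 1; set lb := if (al < be)%N then lam else 0.
move=> h1 h2 h4 h3.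
rewrite !scalerA -!scalerDl -scalerBl [X in X *: _](_ : _ = 0) ?scale0r //.
transitivity ((qa * S' + la * S) * T + (qa * J + la * J') * I'
  - (S * (qb * T' + lb * T) + J' * (qb * I + lb * I'))); first by ring.
by rewrite h1 h2 h3 h4; ring.
Qed.

(** The property [Q] passes from words to homogeneous elements of the same degree;
it varies in the induction, which removes the last letter. *)
Lemma homog_degree (Q : A -> Prop) r c g (d : nat) :
  (forall e f g, Q f -> Q g -> Q (e *: f + g)) -> Q 0 ->
  (forall w : seq ('I_n * 'I_n), size w = d -> Q (\prod_(p <- w) z p.1 p.2)) ->
  homog r c g -> \sum_x r x = d%:Z -> Q g.
Proof.
move=> Ql Q0 Qw hg; elim: hg d Q Ql Q0 Qw => {r c g} [r c r0 c0|r c|r c e f g _ IHf _ IHg|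
  r c r' c' f a al hf IH hr hc] d Q Ql Q0 Qw rd.
- have := Qw [::]; rewrite big_nil; apply => /=.
  by move: rd; rewrite big1 // => /eqP; rewrite eq_sym eqz_nat => /eqP.
- exact: Q0.
- exact: Ql (IHf d Q Ql Q0 Qw rd) (IHg d Q Ql Q0 Qw rd).
have rE : \sum_x r x = d%:Z - 1.
  rewrite -rd (eq_bigr _ (fun x _ => hr x)) big_split /=.
  rewrite [X in _ + X - _](_ : _ = 1) ?addrK // (bigD1 a) //= eqxx big1 ?addr0 //.
  by move=> i /negPf->.
case: d Qw rd rE => [|d] Qw rd rE.
  have [/existsP[x xr]|] := boolP [exists x, r x < 0].
    by rewrite (homog_neg_row hf xr) mul0r.
  rewrite negb_exists => /forallP r0; have : 0 <= \sum_x r x.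
    by apply: sumr_ge0 => x _; rewrite leNgt.
  by rewrite rE.
apply: (IH d (fun f => Q (f * z a al))).
- by move=> e g h Qg Qh; rewrite mulrDl -scalerAl; apply: Ql.
- by rewrite mul0r.
- move=> w wd; have := Qw (rcons w (a, al)); rewrite size_rcons wd big_rcons /=.
  exact.
- by rewrite rE; lia.
Qed.

(** Rigidity applies to the defect: moving it past a lowering operator creates only
defects with smaller indices, whence the induction on the sum of the indices, and
a constant value can only come from degree 2, where [partial_defect_zz] applies.
For equal row indices this says that derivatives of the same row q-commute. *)
Lemma partial_relations a b al be g : partial_defect a b al be g = 0.
Proof.
have [K] : exists K, (a + b + al + be < K)%N by exists (a + b + al + be).+1.
elim: K a b al be g => // K IH a b al be g hK; move: g.
have jlt j : (j < N)%N -> ((inord j : 'I_n) < (inord j.+1 : 'I_n))%N.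
  by move=> jN; rewrite !inordK //; lia.
pose wt (a b : 'I_n) := fun x : 'I_n => - (x == a)%:R - (x == b)%:R : int.
have sh2 a' b' al' be' : shifts (partial2 a' b' al' be') (wt a' b') (wt al' be').
  move=> r c f hf; have := calculus_shifts a' al' calc (calculus_shifts b' be' calc hf).
  by move=> h; apply: homog_ext h _ _ => x; rewrite /wt; ring.
apply: (rigidity ops (dr := wt a b) (dc := wt al be)).
- exact: partial_defect_lin.
- move=> r c f hf; rewrite /partial_defect -scaleN1r -[X in X + _]addr0.
  have hh a' b' al' be' : wt a' b' =1 wt a b -> wt al' be' =1 wt al be ->
      homog (fun x => r x + wt a b x) (fun x => c x + wt al be x)
        (partial2 a' b' al' be' f).
    by move=> h1 h2; apply: homog_ext (sh2 _ _ _ _ _ _ _ hf) _ _ => x; rewrite ?h1 ?h2.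
  have wtC a' b' : wt a' b' =1 wt b' a' by move=> x; rewrite /wt; ring.
  apply: homogD; first (apply: homogD; last exact: homog0).
    by apply: homogD; apply: homogZ; apply: hh.
  by apply: homogZ; apply: homogD; apply: homogZ; apply: hh.
(* The covariance factors are units, so a defect that vanishes on [f g] is killed by
  [f], up to defects of smaller indices. *)
- have rw0 (i : 'I_n) j : rowwt q (inord j) (inord j.+1) i != 0.
    rewrite /rowwt; case: (i == _); first exact: invr_neq0.
    by case: (i == _); rewrite ?oner_neq0.
  have cw0 i : cornerwt q mx i != 0.
    by rewrite /cornerwt; case: (i == _); [exact: invr_neq0 | exact: oner_neq0].
  have drop (e : k) (v : A) : e != 0 -> e *: v = 0 -> v = 0.
    by move=> e0 /eqP; rewrite scaler_eq0 (negPf e0) => /eqP.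
  move=> f hf; case: hf => [j jN|j jN|] g.
  + rewrite (partial_defect_fr _ _ jN) => h; apply: drop (_ : _ != 0) _.
      exact: mulf_neq0 (rw0 a j) (rw0 b j).
    rewrite -{}[RHS]h -[LHS]addr0 -addrA; congr (_ + _).
    have [aj|_] := eqVneq a (inord j.+1); have [bj|_] := eqVneq b (inord j.+1);
      rewrite ?mul0r ?scale0r ?add0r ?IH ?scaler0 ?addr0 //;
      have := jlt j jN; move: hK; rewrite ?aj ?bj; lia.
  + rewrite (partial_defect_fc _ _ jN) => h; apply: drop (_ : _ != 0) _.
      exact: mulf_neq0 (rw0 al j) (rw0 be j).
    rewrite -{}[RHS]h -[LHS]addr0 -addrA; congr (_ + _).
    have [aj|_] := eqVneq al (inord j.+1); have [bj|_] := eqVneq be (inord j.+1);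
      rewrite ?mul0r ?scale0r ?add0r ?IH ?scaler0 ?addr0 //;
      have := jlt j jN; move: hK; rewrite ?aj ?bj; lia.
  + rewrite partial_defect_fm; apply: drop.
    by rewrite !mulf_neq0.
move=> r c g e hg r0 c0.
suff -> : partial_defect a b al be g = 0.
  by move/eqP; rewrite eq_sym scaler_eq0 oner_eq0 orbF => /eqP.
apply: (homog_degree (d := 2) (Q := fun g => partial_defect a b al be g = 0)) hg _.
- by move=> e' f g' h1 h2; rewrite partial_defect_lin h1 h2 scaler0 addr0.
- exact: (rlin0 (partial_defect_lin _ _ _ _)).
- case=> [|p [|p' [|? ?]]] //= _; rewrite !big_cons big_nil mulr1.
  exact: partial_defect_zz.
have delta y : \sum_(x < n) (x == y)%:R = 1 :> int.
  by rewrite (bigD1 y) //= eqxx big1 ?addr0 // => i /negPf->.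
have : \sum_(x < n) (r x + wt a b x) = 0 by apply: big1 => x _; apply: r0.
rewrite /wt !big_split /= !sumrN !delta.
by set S := \sum_(x < n) r x; lia.
Qed.
End PartialRelations.

(** * The wave operator *)
Section PermLength.
Variable n : nat.
Implicit Type s : 'S_n.

Lemma perm_lengthV s : perm_length s^-1%g = perm_length s.
Proof.
rewrite /perm_length; set X := [set p | _]; set Y := [set p | _].
have inj : injective (fun p : 'I_n * 'I_n => (s p.2, s p.1)).
  by move=> [a b] [c d] [/perm_inj-> /perm_inj->].
rewrite -(card_imset Y inj); apply: eq_card => -[a b]; rewrite inE /=.
apply/idP/imsetP => [/andP[ab ba]|[[c d]]].
  exists ((s^-1)%g b, (s^-1)%g a); last by rewrite /= !permKV.
  by rewrite inE /= !permKV ba.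
by rewrite inE /= => /andP[cd dc] [-> ->]; rewrite !permK dc.
Qed.

(** The composition with the transposition of two consecutive values adds the
inversion formed by these two values and keeps all the others. *)
Lemma perm_length_tperm s (j j' : 'I_n) : j' = j.+1 :> nat ->
  ((s^-1)%g j < (s^-1)%g j')%N -> perm_length (s * tperm j j') = (perm_length s).+1.
Proof.
move=> jj' lt; rewrite /perm_length; set Y := [set p | _ & (s _ < s _)%N].
pose p0 := ((s^-1)%g j, (s^-1)%g j').
have p0Y : p0 \notin Y by rewrite inE /= !permKV (_ : (j' < j)%N = false) ?andbF //; lia.
have -> : #|Y|.+1 = #|p0 |: Y| by rewrite cardsU1 p0Y.
apply: eq_card => -[a b].
rewrite !inE /= !permM xpair_eqE.
have -> : (a == (s^-1)%g j) = (s a == j) by rewrite (can2_eq (permK s) (permKV s)).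
have -> : (b == (s^-1)%g j') = (s b == j') by rewrite (can2_eq (permK s) (permKV s)).
have ab0 : a = b -> (a < b)%N = false by move->; rewrite ltnn.
have ltE : s a = j -> s b = j' -> (a < b)%N.
  by move=> sa sb; move: lt; rewrite -sa -sb !permK.
have ltE' : s a = j' -> s b = j -> (a < b)%N = false.
  by move=> sa sb; move: lt; rewrite -sa -sb !permK; case: ltngtP.
have inj : s a = s b -> a = b by apply: perm_inj.
have vE (x y : 'I_n) : (x == y) = (x == y :> nat) by rewrite -val_eqE.
case: tpermP => [sb|sb|/eqP sb /eqP sb']; case: tpermP => [sa|sa|/eqP sa /eqP sa'].
- rewrite ab0; last by apply: inj; rewrite sa sb.
  by rewrite sa sb eqxx vE jj' (ltn_eqF (ltnSn j)).
- by rewrite ltE' // sa sb !vE jj' gtn_eqF.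
- by move: sa sa'; rewrite sb !vE => sa sa'; rewrite (negPf sa) /=; congr (_ && _); lia.
- by rewrite ltE // sa sb !eqxx /= jj' ltnSn.
- rewrite ab0; last by apply: inj; rewrite sa sb.
  by rewrite sa sb eqxx vE jj' (gtn_eqF (ltnSn j)).
- by move: sa sa'; rewrite sb !vE => sa sa'; rewrite (negPf sa) /=; congr (_ && _); lia.
- by move: sb sb'; rewrite sa !vE => sb sb'; rewrite (negPf sb') andbF /=; congr (_ && _); lia.
- by move: sb sb'; rewrite sa !vE => sb sb'; rewrite (negPf sb') andbF /=; congr (_ && _); lia.
- by rewrite (negPf sa).
Qed.
End PermLength.

Section Box.
Variables (k : fieldType) (N : nat) (q : k).
Local Notation n := N.+1.
Local Notation A := (qmat n q).
Local Notation z := (@zgen k n q).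
Local Notation mx := (ord_max : 'I_n).
Variables (fr fc : nat -> A -> A) (fm em : A -> A) (ec : nat -> A -> A).
Hypothesis ops : conformal_ops fr fc fm em ec.
Variable D : 'I_n -> 'I_n -> A -> A.
Hypothesis calc : is_calculus z D.
Let q0 := ops_q0 ops.
Let Dlin a al : linear (D a al). Proof. by case: calc. Qed.

Definition partials (L : seq ('I_n * 'I_n)) (g : A) : A :=
  foldr (fun p => D p.1 p.2) g L.

Lemma partials_lin L : linear (partials L).
Proof.
elim: L => [|p L IH] e f g //=.
by rewrite IH Dlin.
Qed.

Lemma partials_cat L1 L2 g : partials (L1 ++ L2) g = partials L1 (partials L2 g).
Proof. exact: foldr_cat. Qed.

Lemma boxE f : box D f =
  \sum_(s : 'S_n) (- q) ^+ perm_length s *: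
    partials [seq (a, s a) | a <- enum 'I_n] f.
Proof.
rewrite /box; apply: eq_bigr => s _; congr (_ *: _).
rewrite (_ : index_enum _ = enum 'I_n); last by rewrite enumT.
elim: (enum 'I_n) => [|a L IH]; first by rewrite big_nil.
by rewrite big_cons /= IH.
Qed.

Lemma box_lin : linear (box D).
Proof.
move=> e f g; rewrite !boxE scaler_sumr -big_split; apply: eq_bigr => s _ /=.
by rewrite partials_lin scalerDr !scalerA mulrC.
Qed.

(** Moving an operator past a product of derivatives. The index that interacts is
[pi p], and [lw p] is the pair with this index lowered; both rows and columns are
instances. At most one factor has the index [j'] that can be lowered. *)
Section Move.
Variables (pi : 'I_n * 'I_n -> 'I_n) (lw : 'I_n * 'I_n -> 'I_n * 'I_n).
Variables (j j' : 'I_n) (f : A -> A).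

Hypothesis cov : forall p g, D p.1 p.2 (f g) =
  rowwt q j j' (pi p) *: f (D p.1 p.2 g) + (pi p == j')%:R *: D (lw p).1 (lw p).2 g.

Lemma partials_move0 L g : all (fun p => pi p != j') L ->
  partials L (f g) = q^-1 ^+ count (fun p => pi p == j) L *: f (partials L g).
Proof.
elim: L => [|p L IH] /= => [_|/andP[pj Lj]]; first by rewrite scale1r.
rewrite IH // (rlinZ (Dlin _ _)) cov (negPf pj) scale0r addr0 scalerA.
congr (_ *: _); rewrite /rowwt (negPf pj).
by case: (pi p == j); rewrite ?mulr1 // exprD expr1 mulrC.
Qed.

Lemma partials_move1 L1 L2 p g : j != j' -> all (fun p => pi p != j') L1 ->
  all (fun p => pi p != j') L2 -> pi p = j' ->
  partials (L1 ++ p :: L2) (f g) =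
    (q^-1 ^+ count (fun p => pi p == j) L1 * q * q^-1 ^+ count (fun p => pi p == j) L2) *:
      f (partials (L1 ++ p :: L2) g)
    + q^-1 ^+ count (fun p => pi p == j) L2 *: partials (L1 ++ lw p :: L2) g.
Proof.
move=> jj' h1 h2 pj; rewrite !partials_cat /= partials_move0 //.
rewrite (rlinZ (Dlin _ _)) cov pj eqxx scale1r (rlinZ (partials_lin _)).
rewrite (rlinD (partials_lin _)) (rlinZ (partials_lin _)) partials_move0 //.
by rewrite scalerDr !scalerA /rowwt eq_sym (negPf jj') eqxx; congr (_ *: _ + _); ring.
Qed.
End Move.

Lemma drop_enum_ord (a : 'I_n) : drop a (enum 'I_n) = a :: drop a.+1 (enum 'I_n).
Proof. by rewrite (drop_nth a) ?size_enum_ord // nth_ord_enum. Qed.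

Lemma enum_ord_split (a : 'I_n) :
  enum 'I_n = take a (enum 'I_n) ++ a :: drop a.+1 (enum 'I_n).
Proof. by rewrite -drop_enum_ord cat_take_drop. Qed.

Lemma mem_take_enum_ord (a x : 'I_n) : (x \in take a (enum 'I_n)) = (x < a)%N.
Proof. by rewrite in_take ?mem_enum // index_enum_ord. Qed.

Lemma mem_drop_enum_ord (a x : 'I_n) : (x \in drop a.+1 (enum 'I_n)) = (a < x)%N.
Proof.
have := mem_enum 'I_n x; rewrite inE {1}(enum_ord_split a) mem_cat mem_take_enum_ord inE.
have := enum_uniq 'I_n; rewrite {1}(enum_ord_split a) cat_uniq => /and3P[_ h /= /andP[aN _]].
have xd : x \in drop a.+1 (enum 'I_n) -> ~~ (x < a)%N.
  by move=> xd; rewrite -mem_take_enum_ord; move/hasPn: h; apply; rewrite inE xd orbT.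
case: (ltngtP x a) => [xa|ax|/val_inj xa] /=.
- by move=> _; apply/negbTE/negP => /xd; rewrite xa.
- by rewrite -val_eqE gtn_eqF //= => ->.
- by rewrite xa (negPf aN).
Qed.

Section Column.
Variables (j : nat) (jN : (j < N)%N).
Let j0 : 'I_n := inord j.
Let j1 : 'I_n := inord j.+1.
Let merge (x : 'I_n) := if x == j1 then j0 else x.
Let t := tperm j0 j1.

Let j01 : j1 = j0.+1 :> nat. Proof. by rewrite /j0 /j1 !inordK //; lia. Qed.
Let jN01 : j0 != j1. Proof. by rewrite -val_eqE /= j01; lia. Qed.

Let merge_t x : merge (t x) = merge x.
Proof.
rewrite /merge /t; case: tpermP => [->|->|/eqP x0 /eqP x1].
- by rewrite eqxx (negPf jN01).
- by rewrite eqxx (negPf jN01).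
- by rewrite (negPf x1).
Qed.

(** In the term of [s] a single derivative has column j+1, and lowering it makes the
column j occur twice. The power of q records whether the derivative with column j
is applied before this one. *)
Lemma partials_fc (s : 'S_n) g :
  partials [seq (a, s a) | a <- enum 'I_n] (fc j g) =
  fc j (partials [seq (a, s a) | a <- enum 'I_n] g)
  + (if ((s^-1)%g j1 < (s^-1)%g j0)%N then q^-1 else 1) *:
    partials [seq (a, merge (s a)) | a <- enum 'I_n] g.
Proof.
have [fl _ _] := ops_fc ops jN.
have cov p h : D p.1 p.2 (fc j h) = rowwt q j0 j1 p.2 *: fc j (D p.1 p.2 h)
    + (p.2 == j1)%:R *: D (p.1, j0).1 (p.1, j0).2 h.
  exact: (partial_fc ops calc p.1 p.2 h jN).
set a0 := (s^-1)%g j1; set a1 := (s^-1)%g j0.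
have sE x y : (s x == y) = (x == (s^-1)%g y) by rewrite (can2_eq (permK s) (permKV s)).
have a01 : a1 != a0 by rewrite (inj_eq perm_inj).
have cnt (E : seq 'I_n) : uniq E ->
    count (fun p : 'I_n * 'I_n => p.2 == j0) [seq (a, s a) | a <- E] = (a1 \in E).
  move=> uE; rewrite count_map -(count_uniq_mem _ uE); apply: eq_count => x /=.
  by rewrite sE.
have noj (E : seq 'I_n) : a0 \notin E ->
    all (fun p : 'I_n * 'I_n => p.2 != j1) [seq (a, s a) | a <- E].
  move=> aE; rewrite all_map; apply/allP => x xE /=; rewrite sE.
  by apply: contraNneq aE => xa; rewrite /a0 -xa.
have mg (E : seq 'I_n) : a0 \notin E ->
    [seq (a, merge (s a)) | a <- E] = [seq (a, s a) | a <- E].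
  move=> aE; apply/eq_in_map => x xE; rewrite /merge sE.
  by case: eqP => // xa; rewrite /a0 -xa xE in aE.
have e1 : a0 \notin take a0 (enum 'I_n) by rewrite mem_take_enum_ord ltnn.
have e2 : a0 \notin drop a0.+1 (enum 'I_n) by rewrite mem_drop_enum_ord ltnn.
rewrite (enum_ord_split a0) !map_cat /= (partials_move1 (pi := snd) (lw := fun p => (p.1, j0)) cov) ?noj //; last first.
  by rewrite /= permKV.
rewrite !cnt ?take_uniq ?drop_uniq ?enum_uniq // mem_take_enum_ord mem_drop_enum_ord.
rewrite !mg // /merge permKV eqxx.
have : (a1 < a0)%N || (a0 < a1)%N by rewrite -neq_ltn.
case: (ltngtP a1 a0) => //= _ _; rewrite ?expr0 ?expr1 ?mulr1 ?mul1r ?mulVf ?mulfV //.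
  by rewrite !scale1r.
by rewrite scale1r.
Qed.

(** The permutations [s] and [s] followed by the exchange of j and j+1 give the same
product after the column has been lowered, with coefficients that cancel. *)
Lemma box_fc g : box D (fc j g) = fc j (box D g).
Proof.
have [fl _ _] := ops_fc ops jN.
rewrite !boxE (rlin_sum fl); under eq_bigr => s _ do rewrite partials_fc scalerDr.
rewrite big_split /= -[RHS]addr0; congr (_ + _).
  by apply: eq_bigr => s _; rewrite (rlinZ fl).
pose X (s : 'S_n) := (- q) ^+ perm_length s *:
  ((if ((s^-1)%g j1 < (s^-1)%g j0)%N then q^-1 else 1) *:
   partials [seq (a, merge (s a)) | a <- enum 'I_n] g).
suff : \sum_s X s = 0 by [].
(* [P] selects one permutation in each pair {s, s * t}. *)
pose P (s : 'S_n) := ((s^-1)%g j0 < (s^-1)%g j1)%N.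
have tj0 : t j0 = j1 by rewrite tpermL.
have tj1 : t j1 = j0 by rewrite tpermR.
have tV : (t^-1)%g = t by rewrite tpermV.
have Pt s : ~~ P (s * t)%g = P s.
  rewrite /P invMg tV !permM tj0 tj1 -leqNgt leq_eqVlt.
  by rewrite (inj_eq val_inj) (inj_eq perm_inj) (negPf jN01).
rewrite (bigID P) /= [X in _ + X](reindex_inj (mulIg t)) /=.
rewrite [X in _ + X](eq_bigl P) // -big_split /= big1 // => s Ps.
rewrite /X perm_length_tperm // invMg tV !permM tj0 tj1 -/j0 -/j1.
have -> : ((s^-1)%g j1 < (s^-1)%g j0)%N = false by apply/negbTE; rewrite -leqNgt ltnW.
rewrite [X in (if X then _ else _)]Ps.
have -> : [seq (a, merge ((s * t)%g a)) | a <- enum 'I_n] =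
    [seq (a, merge (s a)) | a <- enum 'I_n].
  by apply: eq_map => a; rewrite permM merge_t.
rewrite !scalerA -scalerDl exprS (_ : _ + _ = 0) ?scale0r //.
by field.
Qed.

Lemma partials_fr (s : 'S_n) g :
  partials [seq (a, s a) | a <- enum 'I_n] (fr j g) =
  fr j (partials [seq (a, s a) | a <- enum 'I_n] g)
  + partials [seq (merge a, s a) | a <- enum 'I_n] g.
Proof.
have cov p h : D p.1 p.2 (fr j h) = rowwt q j0 j1 p.1 *: fr j (D p.1 p.2 h)
    + (p.1 == j1)%:R *: D (j0, p.2).1 (j0, p.2).2 h.
  exact: (partial_fr ops calc p.1 p.2 h jN).
have cnt (E : seq 'I_n) : uniq E ->
    count (fun p : 'I_n * 'I_n => p.1 == j0) [seq (a, s a) | a <- E] = (j0 \in E).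
  by move=> uE; rewrite count_map -(count_uniq_mem _ uE); apply: eq_count.
have noj (E : seq 'I_n) : j1 \notin E ->
    all (fun p : 'I_n * 'I_n => p.1 != j1) [seq (a, s a) | a <- E].
  move=> aE; rewrite all_map; apply/allP => x xE /=.
  by apply: contraNneq aE => <-.
have mg (E : seq 'I_n) : j1 \notin E ->
    [seq (merge a, s a) | a <- E] = [seq (a, s a) | a <- E].
  move=> aE; apply/eq_in_map => x xE; rewrite /merge.
  by case: eqP => // xa; rewrite -xa xE in aE.
have e1 : j1 \notin take j1 (enum 'I_n) by rewrite mem_take_enum_ord ltnn.
have e2 : j1 \notin drop j1.+1 (enum 'I_n) by rewrite mem_drop_enum_ord ltnn.
have j0lt : (j0 < j1)%N by rewrite j01.
rewrite (enum_ord_split j1) !map_cat /=.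
rewrite (partials_move1 (pi := fst) (lw := fun p => (j0, p.2)) cov) ?noj //.
rewrite !cnt ?take_uniq ?drop_uniq ?enum_uniq // mem_take_enum_ord mem_drop_enum_ord.
rewrite !mg // /merge eqxx j0lt (ltnNge j1) (ltnW j0lt) /=.
by rewrite expr0 expr1 mulr1 mulVf // !scale1r.
Qed.

(** After the lowering, two neighbouring derivatives have the same row, so they
q-commute by [partial_relations]. *)
Lemma partials_merge_rows (s : 'S_n) g : (s j0 < s j1)%N ->
  partials [seq (merge a, s a) | a <- enum 'I_n] g =
  q *: partials [seq (merge a, (t * s)%g a) | a <- enum 'I_n] g.
Proof.
move=> lt_s; rewrite (enum_ord_split j0) -j01 drop_enum_ord !map_cat /= !partials_cat /=.
have mE : merge j0 = j0 by rewrite /merge (negPf jN01).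
have mE1 : merge j1 = j0 by rewrite /merge eqxx.
rewrite mE mE1 !permM tpermL tpermR.
have same (E : seq 'I_n) : j0 \notin E -> j1 \notin E ->
    [seq (merge a, (t * s)%g a) | a <- E] = [seq (merge a, s a) | a <- E].
  move=> h0 h1; apply/eq_in_map => x xE; rewrite permM tpermD //.
    by apply: contraNneq h0 => ->.
  by apply: contraNneq h1 => ->.
rewrite !same ?mem_take_enum_ord ?mem_drop_enum_ord ?ltnn ?j01 ?ltnn -?leqNgt //; try lia.
rewrite -(rlinZ (partials_lin _)); congr (partials _ _).
set h := partials _ g; have := partial_relations ops calc j0 j0 (s j0) (s j1) h.
rewrite /partial_defect /hecke /partial2 eqxx ltnn lt_s.
rewrite -val_eqE (ltn_eqF lt_s) scale0r addr0 scale1r => /subr0_eq.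
set u := D _ _ (D _ _ h); set v := D _ _ (D _ _ h) => e.
have -> : v = q *: u - (q - q^-1) *: u by rewrite e addrK.
by lfield k.
Qed.

(** As in [box_fc], the terms of [s] and of the exchange of j and j+1 followed by
[s] cancel; here the factor q comes from [partials_merge_rows]. *)
Lemma box_fr g : box D (fr j g) = fr j (box D g).
Proof.
have [fl _ _] := ops_fr ops jN.
rewrite !boxE (rlin_sum fl); under eq_bigr => s _ do rewrite partials_fr scalerDr.
rewrite big_split /= -[RHS]addr0; congr (_ + _).
  by apply: eq_bigr => s _; rewrite (rlinZ fl).
pose X (s : 'S_n) := (- q) ^+ perm_length s *:
  partials [seq (merge a, s a) | a <- enum 'I_n] g.
suff : \sum_s X s = 0 by [].
pose P (s : 'S_n) := (s j0 < s j1)%N.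
have tj0 : t j0 = j1 by rewrite tpermL.
have tj1 : t j1 = j0 by rewrite tpermR.
have Pt s : ~~ P (t * s)%g = P s.
  rewrite /P !permM tj0 tj1 -leqNgt leq_eqVlt.
  by rewrite (inj_eq val_inj) (inj_eq perm_inj) (negPf jN01).
rewrite (bigID P) /= [X in _ + X](reindex_inj (mulgI t)) /=.
rewrite [X in _ + X](eq_bigl P) // -big_split /= big1 // => s Ps.
rewrite /X -[perm_length (t * s)%g]perm_lengthV invMg tpermV.
rewrite perm_length_tperm ?invgK // perm_lengthV partials_merge_rows //.
by rewrite !scalerA -scalerDl exprS (_ : _ + _ = 0) ?scale0r //; ring.
Qed.
End Column.

Lemma partials_fm L g : partials L (fm g) =
  (\prod_(p <- L) (cornerwt q mx p.1 * cornerwt q mx p.2)) *: fm (partials L g).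
Proof.
elim: L => [|p L IH] /=; first by rewrite big_nil scale1r.
by rewrite IH (rlinZ (Dlin _ _)) (partial_fm ops calc) big_cons scalerA mulrC.
Qed.

(** Each term of the wave operator has one derivative in the last row and one in the
last column, and each contributes a factor 1/q. *)
Lemma box_fm g : box D (fm g) = (q^-1 * q^-1) *: fm (box D g).
Proof.
have [fl _ _] := ops_fm ops.
rewrite !boxE (rlin_sum fl) scaler_sumr; apply: eq_bigr => s _.
rewrite partials_fm (rlinZ fl) !scalerA mulrC; congr (_ * _ *: _).
have prodE : \prod_(a < n) cornerwt q mx a = q^-1.
  rewrite (bigD1 mx) //= big1 ?mulr1 => [|i im]; first by rewrite /cornerwt eqxx.
  by rewrite /cornerwt (negPf im).
rewrite big_map big_enum /= big_split /= prodE; congr (_ * _).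
by rewrite -[RHS]prodE [RHS](reindex_inj (@perm_inj _ s)).
Qed.

Lemma partials_shifts L : shifts (partials L)
  (fun x => - (count (fun p => x == p.1) L)%:Z) (fun x => - (count (fun p => x == p.2) L)%:Z).
Proof.
elim: L => [|p L IH] r c f hf.
  by apply: homog_ext hf _ _ => x /=; rewrite subr0.
apply: homog_ext (calculus_shifts p.1 p.2 calc (IH _ _ _ hf)) _ _ => x /=;
  by case: (x == _); rewrite /=; lia.
Qed.

Lemma box_shifts : shifts (box D) (fun=> -1) (fun=> -1).
Proof.
move=> r c f hf; rewrite boxE; apply: homog_sum => s _; apply: homogZ.
apply: homog_ext (partials_shifts _ hf) _ _ => x; congr (_ - _%:Z).
  rewrite count_map (eq_count (a2 := pred1 x)) => [|a /=]; last by rewrite eq_sym.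
  by rewrite count_uniq_mem ?enum_uniq // mem_enum.
rewrite count_map (eq_count (a2 := pred1 ((s^-1)%g x))) => [|a /=].
  by rewrite count_uniq_mem ?enum_uniq // mem_enum.
by rewrite eq_sym (can2_eq (permK s) (permKV s)).
Qed.
End Box.

(** * Constant terms and invariant functionals *)
Section Augmentation.
Variables (k : fieldType) (n : nat) (q : k).
Local Notation A := (qmat n q).
Local Notation z := (@zgen k n q).

Definition const_term : A -> k^o := @lift_of k (qmat_pres n q) k^o _ (@qmat_augP k n q).

Lemma const_term_lin : linear const_term. Proof. exact: lift_linear. Qed.

Lemma const_termM f g : const_term (f * g) = const_term f * const_term g.
Proof. by have [_] := @lift_monoid k (qmat_pres n q) k^o _ (@qmat_augP k n q); apply. Qed.

Lemma const_termz f a al : const_term (f * z a al) = 0.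
Proof.
rewrite const_termM [X in _ * X](_ : _ = 0) ?mulr0 //.
exact: (@lift_gen k (qmat_pres n q) k^o _ (@qmat_augP k n q)).
Qed.

Lemma const_term1 : const_term 1 = 1.
Proof. by have [] := @lift_monoid k (qmat_pres n q) k^o _ (@qmat_augP k n q). Qed.

Lemma const_term_row w j j' f : spanning w -> (forall g a al, const_term (g * w a al) = 0) ->
  is_row_op w j j' f -> forall g, const_term (f g) = 0.
Proof.
move=> sw wz [fl f1 fw]; have cl := const_term_lin; apply: sw.
- by move=> e g h g0 h0; rewrite fl cl g0 h0 scaler0 addr0.
- by rewrite f1 (rlin0 cl).
- by move=> g a al _; rewrite fw (rlinD cl) !(rlinZ cl) !wz !scaler0 addr0.
Qed.
End Augmentation.

(** Integration by parts for a functional that kills the image of the lowering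
operators of the rows. *)
Section Invariant.
Variables (k : fieldType) (N : nat) (q : k).
Local Notation n := N.+1.
Local Notation A := (qmat n q).
Local Notation z := (@zgen k n q).
Local Notation mx := (ord_max : 'I_n).
Local Notation qint := (@qint k q).
Variables (fr fc : nat -> A -> A) (fm em : A -> A) (ec : nat -> A -> A).
Hypothesis ops : conformal_ops fr fc fm em ec.
Let q0 := ops_q0 ops.
Let q2 := ops_q2 ops.

Variable phi : A -> k^o.
Hypothesis phi_lin : linear phi.
Hypothesis phi_fr : forall j g, (j < N)%N -> phi (fr j g) = 0.

Lemma invariant_fr0 j u (c : 'I_n) : (j < N)%N -> c <> j :> nat ->
  phi (fr j u * z c mx) = 0.
Proof.
move=> jN cj; have := phi_fr (u * z c mx) jN; rewrite (fr_zE ops) //.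
rewrite (_ : (c == j :> nat) = false); last by apply/eqP.
rewrite scale0r addr0 (rlinZ phi_lin) => /eqP; rewrite scaler_eq0 => /orP[|/eqP//].
by case: ifP => _; rewrite ?oner_eq0 // (negPf q0).
Qed.

Lemma invariant_fr1 j u : (j < N)%N ->
  phi (fr j u * z (inord j) mx) = - q *: phi (u * z (inord j.+1) mx).
Proof.
move=> jN; have := phi_fr (u * z (inord j) mx) jN; rewrite (fr_zE ops) //.
rewrite inordK ?eqxx; last by lia.
rewrite scale1r (rlinD phi_lin) (rlinZ phi_lin) => /eqP.
rewrite addr_eq0 => /eqP h; rewrite scaleNr -scalerN -h scalerA mulfV // scale1r //.
Qed.

Lemma invariant_xop0 b u (c : 'I_n) : (b < N)%N -> (c < b)%N ->
  phi (xop fr b u * z c mx) = 0.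
Proof.
move=> bN; move: b bN u; apply: (xop_ind ops) => [N0|b bN IH] u cb.
  by rewrite xop_last invariant_fr0 //; lia.
rewrite (xop_step ops _ bN) mulrBl -scalerAl (rlinB phi_lin) (rlinZ phi_lin).
by rewrite IH ?invariant_fr0 ?scaler0 ?subr0 //; lia.
Qed.

Lemma invariant_xop a u : (a < N)%N -> phi (xop fr a u * z (inord a) mx) =
  - (q * (q * q) ^+ (N.-1 - a)) *: phi (u * z mx mx).
Proof.
move=> aN; move: a aN u; apply: (xop_ind ops) => [N0|a aN IH] u.
  rewrite xop_last invariant_fr1 ?subnn ?expr0 ?mulr1; last by lia.
  rewrite (_ : inord N.-1.+1 = mx) //; apply: val_inj; rewrite /= inordK; lia.
rewrite (xop_step ops _ aN) mulrBl -scalerAl (rlinB phi_lin) (rlinZ phi_lin).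
rewrite invariant_xop0 //; last by rewrite inordK; lia.
rewrite invariant_fr1 ?IH; last by lia.
rewrite (_ : N.-1 - a = (N.-1 - a.+1).+1)%N; last by lia.
by rewrite exprS sub0r -!scaleNr !scalerA; congr (_ *: _); ring.
Qed.

(** By [conformal_raising] and [invariant_xop] the value is a multiple of
phi (g z_n^n), where the coefficients for the different rows form a geometric
series. *)
Lemma invariant_raising r c g : homog r c g -> c mx = r mx ->
  phi (em g) = (q * (q ^ (r mx + r mx) - (q * q) ^+ N) / (q * q - 1)) *: phi (g * z mx mx).
Proof.
move=> hg cr; rewrite (conformal_raising ops hg) (rlinD phi_lin) !(rlinZ phi_lin).
rewrite (rlin_sum phi_lin) cr subrr expr0z scale1r.
have geo M : \sum_(i < M) (q * q) ^+ i = ((q * q) ^+ M - 1) / (q * q - 1).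
  by rewrite subrX1 mulrAC divff // mul1r.
have -> : \sum_(b < n | (b < N)%N) phi (xop fr b g * z b mx) =
    - (q * ((q * q) ^+ N - 1) / (q * q - 1)) *: phi (g * z mx mx).
  pose G i := - (q * (q * q) ^+ (N.-1 - i)) *: phi (g * z mx mx).
  transitivity (\sum_(b < n | (b < N)%N) G b).
    by apply: eq_bigr => b bN; rewrite -{1}[b]inord_val /G -invariant_xop // inord_val.
  rewrite -(big_ord_widen n G (leqnSn N)) (reindex_inj rev_ord_inj) /=.
  rewrite -mulrA -geo mulr_sumr -sumrN scaler_suml; apply: eq_bigr => i _.
  by rewrite /G (_ : N.-1 - (N - i.+1) = i)%N //; have := ltn_ord i; lia.
rewrite -scalerDl; congr (_ *: _).
have x0 : q ^ r mx != 0 by rewrite expfz_neq0.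
rewrite /qint -invr_expz expfzDr //; set x := q ^ r mx in x0 *.
by field; rewrite x0 q0 q2.
Qed.
End Invariant.

Section SL2.
Variables (k : fieldType) (q : k) (V : lmodType k).
Hypothesis q0 : q != 0.
Hypothesis q2 : q * q - 1 != 0.
Hypothesis q_root : forall i : int, q ^ i = 1 -> i = 0.
Local Notation lam := (q - q^-1).
Local Notation qint := (@qint k q).
Variables (W : int -> V -> Prop) (e f : V -> V) (phi : V -> k^o).
Hypotheses (e_lin : linear e) (f_lin : linear f) (phi_lin : linear phi).
Hypothesis eW : forall h v, W h v -> W (h + 2) (e v).
Hypothesis fW : forall h v, W h v -> W (h - 2) (f v).
Hypothesis ef : forall h v, W h v -> e (f v) = f (e v) + qint h *: v.
Hypothesis phi_f : forall v, phi (f v) = 0.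

Lemma iter_lin (g : V -> V) M : linear g -> linear (iter M g).
Proof. by move=> gl; elim: M => [|M IH] a u v //=; rewrite IH gl. Qed.

Lemma iter_raising M h v : W h v -> iter M.+1 e (f v) =
  f (iter M.+1 e v) + (qint (M.+1%:Z) * qint (h + M%:Z)) *: iter M e v.
Proof.
elim: M h v => [|M IH] h v hv.
  rewrite /= (ef hv) addr0; congr (_ + _ *: _).
  by rewrite /qint expr1z exprN1 mulfV ?mul1r // lam_neq0.
have el := iter_lin M.+1 e_lin.
rewrite iterSr (ef hv) (rlinD el) (rlinZ el) (IH _ _ (eW hv)) -!iterSr -addrA -scalerDl.
congr (_ + _ *: _); rewrite /qint.
have x0 : q ^ h != 0 by rewrite expfz_neq0.
have y0 : q ^ M != 0 by rewrite expfz_neq0.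
rewrite !intS -!invr_expz !expfzDr // !expr1z.
set x := q ^ h in x0 *; set y := q ^ M in y0 *.
by field; rewrite x0 y0 q0 q2.
Qed.

(** On a vector of weight -2m, the commutation rule [iter_raising] expresses
phi (E^m v) through phi (E^(m+1) (F v)), with a nonzero coefficient. Iterating,
phi (E v) is a multiple of phi (E^(M+1) (F^M v)), which vanishes for large M since F
is nilpotent on v. *)
Lemma invariant_sl2 v : W (-2) v -> (exists M, iter M f v = 0) -> phi (e v) = 0.
Proof.
(* Generalized to the vectors of weight -2(K+1), by induction on the nilpotency
   order M. *)
move=> hv [M]; suff : forall K v, W (- (K.+1 + K.+1)%N%:Z) v -> iter M f v = 0 ->
    phi (iter K.+1 e v) = 0 by move=> h; apply: (h 0%N).
elim: M {v hv} => [|M IH] K v hv fv.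
  by rewrite -[v]/(iter 0 f v) fv (rlin0 (iter_lin _ e_lin)) (rlin0 phi_lin).
have hfv : W (- (K.+2 + K.+2)%N%:Z) (f v).
  by have := fW hv; congr (W _ _); lia.
have := iter_raising K.+1 hv.
move=> /(congr1 phi); rewrite (IH K.+1) //; last by rewrite -iterSr.
rewrite (rlinD phi_lin) phi_f add0r (rlinZ phi_lin) => /esym/eqP.
rewrite scaler_eq0 mulf_eq0 => /orP[/orP[]|/eqP//].
  by move=> /eqP/(qint_eq0 q0 q2 q_root); lia.
by move=> /eqP/(qint_eq0 q0 q2 q_root); lia.
Qed.
End SL2.

(** * The initial action *)
Section Scalars.
Variables (R : realType) (q : R).
Hypothesis hq : 0 < q < 1.
Local Open Scope complex_scope.
Local Notation k := (R[i]).
Local Notation Q := (Cq q).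

Lemma Cq_root (i : int) : Q ^ i = 1 -> i = 0.
Proof.
have [q_gt0 q_lt1] := andP hq.
rewrite /Cq -fmorphXz => /(congr1 (@complex.Re R)) /= qi.
by move/eqP: qi; rewrite pexprz_eq1 ?ltW // (lt_eqF q_lt1) orbF => /eqP.
Qed.

Lemma Cq_sq : Q * Q - 1 != 0.
Proof.
by rewrite subr_eq0; apply/eqP => h; have := @Cq_root 2 h.
Qed.

Lemma CqpowD x y : Cqpow q (x + y) = Cqpow q x * Cqpow q y.
Proof.
have [q_gt0 _] := andP hq.
by rewrite /Cqpow powRD ?rmorphM //; apply/implyP => _; rewrite gt_eqF.
Qed.

Lemma Cqpow_nat m : Cqpow q m%:R = Q ^+ m.
Proof.
have [q_gt0 _] := andP hq.
by rewrite /Cqpow powR_mulrn ?rmorphXn //= ltW.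
Qed.

Lemma CqpowN x : Cqpow q (- x) = (Cqpow q x)^-1.
Proof. by rewrite /Cqpow powRN fmorphV. Qed.

Lemma Cqpow_half : Cqpow q (1 / 2) * Cqpow q (1 / 2) = Q.
Proof. by rewrite -CqpowD -[RHS]expr1 -Cqpow_nat; congr (Cqpow q _); field. Qed.

Lemma Cqpow_neq0 x : Cqpow q x != 0.
Proof.
have [q_gt0 _] := andP hq.
by rewrite /Cqpow fmorph_eq0 gt_eqF // powR_gt0.
Qed.

Lemma Cqpow_int (i : int) : Cqpow q i%:~R = Q ^ i.
Proof.
case: i => m; first by rewrite -pmulrn Cqpow_nat.
by rewrite NegzE mulrNz CqpowN -invr_expz -pmulrn Cqpow_nat.
Qed.
End Scalars.

Lemma homog_mul (k : fieldType) (n : nat) (q : k) r c r' c' (f g : qmat n q) :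
  homog r c f -> homog r' c' g ->
  homog (fun x => r x + r' x) (fun x => c x + c' x) (f * g).
Proof.
move=> hf hg; elim: hg r c hf => {r' c' g} [r' c' r0 c0|r' c'|r' c' e g h _ IHg _ IHh|
  r' c' r1 c1 g a al hg IH hr hc] r c hf.
- by rewrite mulr1; apply: homog_ext hf _ _ => x; rewrite ?r0 ?c0 addr0.
- by rewrite mulr0; apply: homog0.
- by rewrite mulrDr -scalerAr; apply: homogL; [apply: IHg | apply: IHh].
- rewrite mulrA; apply: homogM (IH _ _ hf) _ _ => x; by rewrite ?hr ?hc addrA.
Qed.

Lemma homog_gen (k : fieldType) (n : nat) (q : k) (a al : 'I_n) :
  homog (fun x => (x == a)%:R) (fun x => (x == al)%:R) (zgen q a al).
Proof.
rewrite -[zgen q a al]mul1r; apply: (homogM (r := fun=> 0) (c := fun=> 0)) => [|x|x].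
- exact: homog1.
- by rewrite add0r.
- by rewrite add0r.
Qed.

(** Consequences of the coproduct formulas, for one generator of the quantum group
at a time. *)
Section ModuleAlgebra.
Variables (k : fieldType) (n r : nat) (q : k).
Hypothesis q0 : q != 0.
Local Notation A := (qmat n q).
Local Notation z := (@zgen k n q).
Local Notation U := (Uq r q).
Local Notation E := (@UE k r q).
Local Notation F := (@UF k r q).
Local Notation K := (@UK k r q).
Local Notation Ki := (@UKi k r q).
Variable act : U -> A -> A.
Hypothesis act_mod : is_module_algebra q0 act.

Lemma act_lin xi : linear (act xi).
Proof. by have [[]] := act_mod. Qed.
Lemma act_linl g : linear (act^~ g).
Proof. by have [[]] := act_mod. Qed.
Lemma act_unit g : act 1 g = g.
Proof. by have [[]] := act_mod. Qed.
Lemma act_mul xi eta g : act (xi * eta) g = act xi (act eta g).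
Proof. by have [[]] := act_mod. Qed.

Let comul_gen x : comul q0 (pgen (Uq_pres r q) x) = comul_gens q x.
Proof. exact: lift_gen. Qed.

Lemma act_KM i f g : act (K i) (f * g) = act (K i) f * act (K i) g.
Proof.
have [_ _ act_prod] := act_mod.
rewrite (act_prod _ [:: (K i, K i)]) ?big_seq1 //.
exact: comul_gen.
Qed.

Lemma act_FM i f g : act (F i) (f * g) = act (F i) f * act (Ki i) g + f * act (F i) g.
Proof.
have [_ _ act_prod] := act_mod.
rewrite (act_prod _ [:: (F i, Ki i); (1, F i)]) ?big_cons ?big_nil /= ?addr0 ?act_unit //.
exact: comul_gen.
Qed.

Lemma act_EM i f g : act (E i) (f * g) = act (E i) f * g + act (K i) f * act (E i) g.
Proof.
have [_ _ act_prod] := act_mod.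
rewrite (act_prod _ [:: (E i, 1); (K i, E i)]) ?big_cons ?big_nil /= ?addr0 ?act_unit //.
exact: comul_gen.
Qed.

Let counit_gen x : counit (pgen (Uq_pres r q) x) = Uq_aug k x.
Proof. exact: (@lift_gen k (Uq_pres r q) k^o _ (@Uq_augP k r q)). Qed.

Lemma act_K1 i : act (K i) 1 = 1.
Proof. by have [_ -> _] := act_mod; rewrite [counit _]counit_gen scale1r. Qed.
Lemma act_F1 i : act (F i) 1 = 0.
Proof. by have [_ -> _] := act_mod; rewrite [counit _]counit_gen scale0r. Qed.
Lemma act_E1 i : act (E i) 1 = 0.
Proof. by have [_ -> _] := act_mod; rewrite [counit _]counit_gen scale0r. Qed.

(** A weight [h] is given as a function of the content; [wt] is its increment when
the word is multiplied by a generator. *)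
Section Weights.
Variables (i : 'I_r) (h : ('I_n -> int) -> ('I_n -> int) -> int) (wt : 'I_n -> 'I_n -> int).
Hypothesis h0 : forall r c, (forall x, r x = 0) -> (forall x, c x = 0) -> h r c = 0.
Hypothesis hD : forall r c r' c' a al, (forall x, r' x = r x + (x == a)%:R) ->
  (forall x, c' x = c x + (x == al)%:R) -> h r' c' = h r c + wt a al.
Hypothesis K_z : forall a al, act (K i) (z a al) = q ^ wt a al *: z a al.

Lemma act_K_homog rr c g : homog rr c g -> act (K i) g = q ^ h rr c *: g.
Proof.
elim=> {rr c g} [rr c r0 c0|rr c|rr c e f g _ IHf _ IHg|rr c r' c' f a al hf IH hr hc].
- by rewrite act_K1 h0 // expr0z scale1r.
- by rewrite (rlin0 (act_lin _)) scaler0.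
- by rewrite act_lin IHf IHg scalerDr !scalerA mulrC.
- by rewrite act_KM IH K_z -scalerAl -scalerAr scalerA -expfzDr // (hD hr hc).
Qed.

Lemma act_Ki_homog rr c g : homog rr c g -> act (Ki i) g = q ^ (- h rr c) *: g.
Proof.
move=> hg; rewrite -{1}[g]scale1r -(expr0z q) -(subrr (h rr c)) addrC expfzDr //.
rewrite -scalerA -(act_K_homog hg) (rlinZ (act_lin _)) -act_mul UKiK act_unit //.
Qed.

Lemma act_Ki_z a al : act (Ki i) (z a al) = q ^ (- wt a al) *: z a al.
Proof.
rewrite (act_Ki_homog (homog_gen q a al)); congr (q ^ (- _) *: _).
rewrite (@hD (fun=> 0) (fun=> 0) _ _ a al) ?h0 ?add0r // => x; by rewrite add0r.
Qed.

Lemma act_EF j rr c g : homog rr c g ->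
  act (E i) (act (F j) g) = act (F j) (act (E i) g) + (i == j)%:R * qint q (h rr c) *: g.
Proof.
move=> hg; have := congr1 (act^~ g) (UEF q i j).
rewrite (rlinB (act_linl g)) (rlinZ (act_linl g)) (rlinB (act_linl g)) !act_mul.
rewrite (act_K_homog hg) (act_Ki_homog hg) => /eqP; rewrite subr_eq addrC => /eqP->.
by congr (_ + _); rewrite -scalerBl scalerA /qint -!mulrA; congr (_ * _ *: _); rewrite mulrC.
Qed.

Lemma act_E_shifts dr dc :
  (forall a al, homog (fun x => (x == a)%:R + dr x) (fun x => (x == al)%:R + dc x)
     (act (E i) (z a al))) -> shifts (act (E i)) dr dc.
Proof.
move=> hE rr c g; elim=> {rr c g} [rr c r0 c0|rr c|rr c e f g _ IHf _ IHg|
  rr c r' c' f a al hf IH hr hc].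
- by rewrite act_E1; apply: homog0.
- by rewrite (rlin0 (act_lin _)); apply: homog0.
- by rewrite act_lin; apply: homogL.
rewrite act_EM (act_K_homog hf) -scalerAl addrC; apply: homogL.
  by apply: homog_ext (homog_mul hf (hE a al)) _ _ => x; rewrite ?hr ?hc addrA.
by apply: homogM IH _ _ => x; rewrite ?hr ?hc addrAC.
Qed.
End Weights.

Lemma act_counit_E i : (forall a al, const_term (act (E i) (z a al)) = 0) ->
  forall g, const_term (act (E i) g) = 0.
Proof.
move=> hE; have cl := @const_term_lin k n q; apply: (@zgen_spanning k n q).
- by move=> e f g hf hg; rewrite act_lin cl hf hg scaler0 addr0.
- by rewrite act_E1 (rlin0 cl).
- by move=> f a al _; rewrite act_EM (rlinD cl) const_termz const_termM hE mulr0 addr0.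
Qed.
End ModuleAlgebra.

Lemma scale_lin (k : fieldType) (V W : lmodType k) (c : k) (f : V -> W) :
  linear f -> linear (fun v => c *: f v).
Proof. by move=> lf a u v; rewrite lf scalerDr !scalerA mulrC. Qed.

(** The nodes 0, ..., N-1 of the Dynkin diagram act on rows, the node N is the middle
one, and the nodes after N act on columns in the reverse order: the node N.*2 - j
lowers column j to column j+1. *)
Section Nodes.
Variable N : nat.
Local Notation n := N.+1.
Local Notation rk := (n.*2.-1).

Lemma rank_gt0 : (0 < rk)%N. Proof. by rewrite doubleS. Qed.

Definition node (j : nat) : 'I_rk := insubd (Ordinal rank_gt0) j.

Lemma nodeE j : (j < rk)%N -> node j = j :> nat.
Proof. by move=> jr; rewrite val_insubd jr. Qed.

Lemma node_val (i : 'I_rk) : node i = i.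
Proof. by apply: val_inj; rewrite /= nodeE. Qed.

Lemma ltn_rank j : (j < rk)%N = (j <= N.*2)%N.
Proof. by rewrite doubleS. Qed.

Section ByNode.
Variables (X : Type) (row : nat -> X) (mid : X) (col : nat -> X).

Definition by_node (i : 'I_rk) : X :=
  if (i < N)%N then row i else if i == N :> nat then mid else col (N.*2 - i)%N.

Lemma by_node_row j : (j < N)%N -> by_node (node j) = row j.
Proof. by move=> jN; rewrite /by_node nodeE ?jN // ltn_rank; lia. Qed.

Lemma by_node_mid : by_node (node N) = mid.
Proof. by rewrite /by_node nodeE ?ltnn ?eqxx // ltn_rank; lia. Qed.

Lemma by_node_col j : (j < N)%N -> by_node (node (N.*2 - j)) = col j.
Proof.
move=> jN; rewrite /by_node nodeE ?ltn_rank; last by lia.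
rewrite (_ : (N.*2 - j < N)%N = false); last by lia.
rewrite (_ : (N.*2 - j == N)%N = false); last by lia.
by congr col; lia.
Qed.
End ByNode.

Lemma node_cases (P : 'I_rk -> Prop) : (forall j, (j < N)%N -> P (node j)) ->
  P (node N) -> (forall j, (j < N)%N -> P (node (N.*2 - j))) -> forall i, P i.
Proof.
move=> Pr Pm Pc i; rewrite -(node_val i); have := ltn_ord i; rewrite ltn_rank => iN.
have [iN'|iN'|->//] := ltngtP i N; first exact: Pr.
by rewrite (_ : nat_of_ord i = N.*2 - (N.*2 - i))%N; [apply: Pc; lia | lia].
Qed.

Lemma node_mid_row j : (j < N)%N -> (node j == node N) = false.
Proof. by move=> jN; rewrite -val_eqE /= !nodeE ?ltn_rank; lia. Qed.

Lemma node_mid_col j : (j < N)%N -> (node (N.*2 - j) == node N) = false.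
Proof. by move=> jN; rewrite -val_eqE /= !nodeE ?ltn_rank; lia. Qed.

End Nodes.

Section InitialAction.
Variables (R : realType) (q : R).
Hypothesis hq : 0 < q < 1.
Variable N : nat.
Local Open Scope complex_scope.
Local Notation k := (R[i]).
Local Notation Q := (Cq q).
Local Notation n := N.+1.
Local Notation rk := (n.*2.-1).
Local Notation A := (qmat n Q).
Local Notation z := (@zgen k n Q).
Local Notation mx := (ord_max : 'I_n).
Local Notation U := (Uq rk Q).
Local Notation E := (@UE k rk Q).
Local Notation F := (@UF k rk Q).
Local Notation K := (@UK k rk Q).
Local Notation Ki := (@UKi k rk Q).
Local Notation s := (Cqpow q (1 / 2)).
Local Notation node := (node N).
Local Notation by_node := (@by_node N _).

Variable act : U -> A -> A.
Hypothesis hact : is_initial_action act (Cq_neq0 hq).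

Let act_alg : is_module_algebra (Cq_neq0 hq) act. Proof. by case: hact. Qed.
Let Q0 := Cq_neq0 hq.

Let s0 : s != 0. Proof. exact: Cqpow_neq0. Qed.
Let ss : s * s = Q. Proof. exact: Cqpow_half. Qed.
Let sV : Cqpow q (- (1 / 2)) = s^-1. Proof. exact: CqpowN. Qed.

(** The exponents of q by which the K of a node acts on an element of given
content. *)
Definition row_wt (j : nat) (r c : 'I_n -> int) : int := r (inord j) - r (inord j.+1).
Definition col_wt (j : nat) (r c : 'I_n -> int) : int := c (inord j) - c (inord j.+1).
Definition mid_wt (r c : 'I_n -> int) : int := r mx + c mx.

Let zwt (h : ('I_n -> int) -> ('I_n -> int) -> int) (a al : 'I_n) :=
  h (fun x => (x == a)%:R) (fun x => (x == al)%:R).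

Definition additive_wt (h : ('I_n -> int) -> ('I_n -> int) -> int) :=
  (forall r c, (forall x, r x = 0) -> (forall x, c x = 0) -> h r c = 0) /\
  (forall r c r' c' a al, (forall x, r' x = r x + (x == a)%:R) ->
     (forall x, c' x = c x + (x == al)%:R) -> h r' c' = h r c + zwt h a al).

Lemma row_wt_add j : additive_wt (row_wt j).
Proof.
split=> [r c r0 c0|r c r' c' a al hr hc]; rewrite /zwt /row_wt ?r0 ?subrr // !hr.
by ring.
Qed.
Lemma col_wt_add j : additive_wt (col_wt j).
Proof.
split=> [r c r0 c0|r c r' c' a al hr hc]; rewrite /zwt /col_wt ?c0 ?subrr // !hc.
by ring.
Qed.
Lemma mid_wt_add : additive_wt mid_wt.
Proof.
split=> [r c r0 c0|r c r' c' a al hr hc]; rewrite /zwt /mid_wt ?r0 ?c0 ?addr0 // hr hc.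
by ring.
Qed.

Let delta_inord (j : nat) (a : 'I_n) : (j <= N)%N -> ((inord j : 'I_n) == a) = (j == a :> nat).
Proof. by move=> jN; rewrite -val_eqE /= inordK. Qed.

Lemma K_row_z j a al : (j < N)%N ->
  act (K (node j)) (z a al) = Q ^ zwt (row_wt j) a al *: z a al.
Proof.
move=> jN; have jr : (j < rk)%N by rewrite ltn_rank; lia.
have [_ hl _ _] := hact; have ni := nodeE jr.
have [|-> _ _ _ _] := hl (node j) _ a al; first by rewrite ni.
rewrite /zwt /row_wt !delta_inord ?ni //; last by lia.
rewrite !eqSS [j == _]eq_sym [j.+1 == _]eq_sym.
have [aj|aj] := eqVneq (a : nat) j; first by rewrite aj ltn_eqF.
by case: (_ == _); rewrite ?expr0z.
Qed.

Lemma K_col_z j a al : (j < N)%N ->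
  act (K (node (N.*2 - j))) (z a al) = Q ^ zwt (col_wt j) a al *: z a al.
Proof.
move=> jN; have jr : (N.*2 - j < rk)%N by rewrite ltn_rank; lia.
have [_ _ hr _] := hact; have ni := nodeE jr.
have [||-> _ _ _ _] := hr (node (N.*2 - j)) (N - j)%N _ _ a al.
- by lia.
- by rewrite ni; lia.
rewrite /zwt /col_wt !delta_inord //; last by lia.
rewrite (_ : n - (N - j) = j.+1)%N; last by lia.
rewrite !eqSS [j == _]eq_sym [j.+1 == _]eq_sym.
have [aj|aj] := eqVneq (al : nat) j; first by rewrite aj ltn_eqF.
by case: (_ == _); rewrite ?expr0z.
Qed.

Lemma K_mid_z a al : act (K (node N)) (z a al) = Q ^ zwt mid_wt a al *: z a al.
Proof.
have Nr : (N < rk)%N by rewrite ltn_rank; lia.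
have [_ _ _ hm] := hact; have ni := nodeE Nr.
have [||-> _ _] := hm (node N) mx _ _ a al; rewrite ?ni //.
rewrite /zwt /mid_wt ![mx == _]eq_sym.
by case: (a == mx); case: (al == mx); rewrite /= ?expr0z ?expr1z ?exprnP.
Qed.

Lemma F_row_z j a al : (j < N)%N ->
  act (F (node j)) (z a al) = ((a == inord j)%:R * s) *: z (inord j.+1) al.
Proof.
move=> jN; have jr : (j < rk)%N by rewrite ltn_rank; lia.
have [_ hl _ _] := hact; have ni := nodeE jr.
have [|_ Fz F0 _ _] := hl (node j) _ a al; first by rewrite ni.
rewrite eq_sym delta_inord //; last by lia.
have [aj|aj] := eqVneq j (a : nat).
  by rewrite [_%:R * _]mul1r -(Fz _ (inord j.+1)) ?ni ?inordK //; lia.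
by rewrite mul0r scale0r F0 // ni => -[] /esym/eqP; rewrite (negPf aj).
Qed.

Lemma F_col_z j a al : (j < N)%N ->
  act (F (node (N.*2 - j))) (z a al) = ((al == inord j)%:R * s) *: z a (inord j.+1).
Proof.
move=> jN; have jr : (N.*2 - j < rk)%N by rewrite ltn_rank; lia.
have [_ _ hr _] := hact; have ni := nodeE jr.
have [||_ Fz F0 _ _] := hr (node (N.*2 - j)) (N - j)%N _ _ a al; first by lia.
  by rewrite ni; lia.
have e : (n - (N - j) = j.+1)%N by lia.
rewrite eq_sym delta_inord //; last by lia.
have [aj|aj] := eqVneq j (al : nat).
  by rewrite [_%:R * _]mul1r -(Fz _ (inord j.+1)) ?e ?inordK //; lia.
by rewrite mul0r scale0r F0 // e => -[] /esym/eqP; rewrite (negPf aj).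
Qed.

Lemma F_mid_z a al : act (F (node N)) (z a al) = (((a == mx) && (al == mx))%:R * s) *: 1.
Proof.
have Nr : (N < rk)%N by rewrite ltn_rank; lia.
have [_ _ _ hm] := hact; have ni := nodeE Nr.
have [||_ -> _] := hm (node N) mx _ _ a al; rewrite ?ni //.
by case: (_ && _); rewrite ?[_%:R * _]mul1r ?[_%:R * _]mul0r ?scale0r.
Qed.

Lemma E_row_z j a al : (j < N)%N ->
  act (E (node j)) (z a al) = ((a == inord j.+1)%:R * s^-1) *: z (inord j) al.
Proof.
move=> jN; have jr : (j < rk)%N by rewrite ltn_rank; lia.
have [_ hl _ _] := hact; have ni := nodeE jr.
have [|_ _ _ Ez E0] := hl (node j) _ a al; first by rewrite ni.
rewrite eq_sym delta_inord //.
have [aj|aj] := eqVneq j.+1 (a : nat).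
  by rewrite [_%:R * _]mul1r -sV -(Ez _ (inord j)) ?ni ?inordK //; lia.
by rewrite mul0r scale0r E0 // ni => -[] /esym/eqP; rewrite (negPf aj).
Qed.

Lemma E_col_z j a al : (j < N)%N ->
  act (E (node (N.*2 - j))) (z a al) = ((al == inord j.+1)%:R * s^-1) *: z a (inord j).
Proof.
move=> jN; have jr : (N.*2 - j < rk)%N by rewrite ltn_rank; lia.
have [_ _ hr _] := hact; have ni := nodeE jr.
have [||_ _ _ Ez E0] := hr (node (N.*2 - j)) (N - j)%N _ _ a al; first by lia.
  by rewrite ni; lia.
have e : (n - (N - j) = j.+1)%N by lia.
rewrite eq_sym delta_inord //.
have [aj|aj] := eqVneq j.+1 (al : nat).
  by rewrite [_%:R * _]mul1r -sV -(Ez _ (inord j)) ?e ?inordK //; lia.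
by rewrite mul0r scale0r E0 // e => -[] /esym/eqP; rewrite (negPf aj).
Qed.

(** The three cases of the definition of the action agree with one formula, since
z_n^n q-commutes with the generators of the last row and of the last column. *)
Lemma E_mid_z a al : act (E (node N)) (z a al) =
  (- (s^-1 * (if a == mx then Q else 1))) *: (z a mx * z mx al).
Proof.
have Nr : (N < rk)%N by rewrite ltn_rank; lia.
have [_ _ _ hm] := hact; have ni := nodeE Nr.
have [||_ _ ->] := hm (node N) mx _ _ a al; rewrite ?ni //.
have mxE (i : 'I_n) : (i == mx) = (i == N :> nat) by rewrite -val_eqE.
have ltmx (i : 'I_n) : i != mx -> (i < mx)%N by rewrite mxE /=; have := ltn_ord i; lia.
have [_ r2 _ _] := zgen_qrel n Q.
have sQ : s^-1 * Q = s by rewrite -[Q in LHS]ss mulKf.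
rewrite sV; have [->|am] := eqVneq a mx; have [->|alm] := eqVneq al mx => /=.
- by rewrite expr2 sQ scaleNr.
- by rewrite sQ scaleNr.
- by rewrite (r2 a mx mx) ?ltmx // mulr1 scaleNr scalerA sQ.
- by rewrite mulr1 scaleNr.
Qed.

Definition lower_row j (g : A) : A := s^-1 *: act (F (node j)) g.
Definition lower_col j (g : A) : A := s^-1 *: act (F (node (N.*2 - j))) g.
Definition lower_mid (g : A) : A := s^-1 *: act (F (node N)) g.
Definition raise_mid (g : A) : A := - s *: act (E (node N)) g.
Definition raise_col j (g : A) : A := s *: act (E (node (N.*2 - j))) g.

Let alin := act_lin act_alg.

Lemma Ki_z i h a al : additive_wt h ->
  (forall a al, act (K i) (z a al) = Q ^ zwt h a al *: z a al) ->
  act (Ki i) (z a al) = Q ^ (- zwt h a al) *: z a al.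
Proof. by case=> h0 hD hK; apply: (act_Ki_z act_alg h0 hD hK). Qed.

Let inord_neq j : (j < N)%N -> (inord j == inord j.+1 :> 'I_n) = false.
Proof. by move=> jN; rewrite -val_eqE /= !inordK; lia. Qed.

Lemma lower_row_op j : (j < N)%N -> is_row_op z (inord j) (inord j.+1) (lower_row j).
Proof.
move=> jN; split.
- exact: (scale_lin _ (alin _)).
- by rewrite /lower_row (act_F1 act_alg) scaler0.
move=> g c ga; rewrite /lower_row (act_FM act_alg) F_row_z //.
rewrite (Ki_z _ _ (row_wt_add j)) => [|a al]; last exact: K_row_z.
rewrite scalerDr -!scalerAr !scalerA mulrCA mulVf // mulr1 -scalerAl scalerA.
congr (_ *: _ + _); rewrite mulrC; congr (_ * _).
rewrite /zwt /row_wt /rowwt ![_ == c]eq_sym.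
have [->|cj] := eqVneq c (inord j); first by rewrite inord_neq.
by case: (_ == _).
Qed.

Lemma lower_col_op j : (j < N)%N -> is_row_op (swap z) (inord j) (inord j.+1) (lower_col j).
Proof.
move=> jN; split.
- exact: (scale_lin _ (alin _)).
- by rewrite /lower_col (act_F1 act_alg) scaler0.
move=> g c ga; rewrite /lower_col /swap (act_FM act_alg) F_col_z //.
rewrite (Ki_z _ _ (col_wt_add j)) => [|a al]; last exact: K_col_z.
rewrite scalerDr -!scalerAr !scalerA mulrCA mulVf // mulr1 -scalerAl scalerA.
congr (_ *: _ + _); rewrite mulrC; congr (_ * _).
rewrite /zwt /col_wt /rowwt ![_ == c]eq_sym.
have [->|cj] := eqVneq c (inord j); first by rewrite inord_neq.
by case: (_ == _).
Qed.

Lemma lower_mid_op : is_corner_op z mx lower_mid.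
Proof.
split.
- exact: (scale_lin _ (alin _)).
- by rewrite /lower_mid (act_F1 act_alg) scaler0.
move=> g c ga; rewrite /lower_mid (act_FM act_alg) F_mid_z.
rewrite (Ki_z _ _ mid_wt_add) => [|a al]; last exact: K_mid_z.
rewrite scalerDr -!scalerAr !scalerA mulrCA mulVf // !mulr1 -scalerAl scalerA.
congr (_ *: _ + _); rewrite mulrC; congr (_ * _).
rewrite /zwt /mid_wt /cornerwt ![mx == _]eq_sym opprD expfzDr //.
by case: (c == mx); case: (ga == mx).
Qed.

Lemma K_homog i h r c g : additive_wt h ->
  (forall a al, act (K i) (z a al) = Q ^ zwt h a al *: z a al) ->
  homog r c g -> act (K i) g = Q ^ h r c *: g.
Proof. by case=> h0 hD hK; apply: (act_K_homog act_alg h0 hD hK). Qed.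

Lemma EF_homog i j h r c g : additive_wt h ->
  (forall a al, act (K i) (z a al) = Q ^ zwt h a al *: z a al) -> homog r c g ->
  act (E i) (act (F j) g) = act (F j) (act (E i) g) + ((i == j)%:R * qint Q (h r c)) *: g.
Proof.
case=> h0 hD hK hg; exact: (act_EF act_alg h0 hD hK).
Qed.

Lemma initial_conformal_ops :
  conformal_ops lower_row lower_col lower_mid raise_mid raise_col.
Proof.
split.
- exact: Q0.
- exact: Cq_sq.
- exact: Cq_root.
- exact: lower_row_op.
- exact: lower_col_op.
- exact: lower_mid_op.
- move=> i j ij jN g; rewrite /lower_row !(rlinZ (alin _)) -!(act_mul act_alg) UFF //.
  by rewrite /adjacent !nodeE ?ltn_rank; lia.
- by apply: (scale_lin _ (alin _)).
- by rewrite /raise_mid (act_E1 act_alg) scaler0.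
- move=> r c g a al hg; rewrite /raise_mid (act_EM act_alg) E_mid_z.
  rewrite (K_homog mid_wt_add K_mid_z hg) scalerDr -!scalerAr -!scalerAl !scalerA.
  congr (_ + _ *: _); rewrite /mid_wt.
  by rewrite mulrNN mulVKf // mulrC.
- move=> r c g hg; rewrite /raise_mid /lower_mid !(rlinZ (alin _)).
  rewrite (EF_homog _ mid_wt_add K_mid_z hg) eqxx /mid_wt; lfield constr:(k).
- by move=> j jN; apply: (scale_lin _ (alin _)).
- move=> j jN r c g hg; rewrite /raise_col; apply: homogZ; move: r c g hg.
  have [h0 hD] := col_wt_add j.
  apply: (act_E_shifts act_alg h0 hD) => [a al|a al]; first exact: K_col_z.
  rewrite E_col_z //; have [->|_] := eqVneq al (inord j.+1); last first.
    by rewrite mul0r scale0r; apply: homog0.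
  by apply: homogZ; apply: homog_ext (homog_gen _ _ _) _ _ => x; rewrite ?addr0 //; ring.
- move=> j r c g jN hg; rewrite /raise_col /lower_col !(rlinZ (alin _)).
  rewrite (EF_homog _ (col_wt_add j) _ hg) => [|a al]; last exact: K_col_z.
  by rewrite eqxx /col_wt; lfield constr:(k).
Qed.

Let e_ (j : nat) (x : 'I_n) : int := (x == inord j)%:R.

(** The data of a node in uniform notation: the weight, and the change [raise_dr],
[raise_dc] of the row and column contents under E. *)
Definition node_wt := by_node row_wt mid_wt col_wt.
Definition raise_dr :=
  by_node (fun j x => e_ j x - e_ j.+1 x) (e_ N) (fun _ _ => 0).
Definition raise_dc :=
  by_node (fun _ _ => 0) (e_ N) (fun j x => e_ j x - e_ j.+1 x).
Definition lower_node i (g : A) : A := s^-1 *: act (F i) g.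
Definition raise_node i (g : A) : A := s *: act (E i) g.

Lemma node_wt_add i : additive_wt (node_wt i).
Proof.
elim/node_cases: i => [j jN||j jN]; rewrite /node_wt.
- by rewrite by_node_row //; apply: row_wt_add.
- by rewrite by_node_mid; apply: mid_wt_add.
- by rewrite by_node_col //; apply: col_wt_add.
Qed.

Lemma K_node_z i a al :
  act (K i) (z a al) = Q ^ zwt (node_wt i) a al *: z a al.
Proof.
elim/node_cases: i => [j jN||j jN]; rewrite /node_wt.
- by rewrite by_node_row //; apply: K_row_z.
- by rewrite by_node_mid; apply: K_mid_z.
- by rewrite by_node_col //; apply: K_col_z.
Qed.

Lemma K_node_homog i r c g : homog r c g -> act (K i) g = Q ^ node_wt i r c *: g.
Proof. by move=> hg; apply: (K_homog (node_wt_add i)) => // a al; apply: K_node_z. Qed.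

Lemma node_wt_shift i r c (m : int) :
  node_wt i (fun x => r x - m) (fun x => c x - m) =
  node_wt i r c - (if i == node N then m + m else 0).
Proof.
elim/node_cases: i => [j jN||j jN]; rewrite /node_wt ?eqxx.
- by rewrite by_node_row // node_mid_row // /row_wt; ring.
- by rewrite by_node_mid /mid_wt; ring.
- by rewrite by_node_col // node_mid_col // /col_wt; ring.
Qed.

Let inord_mx : inord N = mx.
Proof. by apply: val_inj; rewrite /= inordK. Qed.

Lemma node_wt_raise i r c (m : int) :
  node_wt i (fun x => r x + m * raise_dr i x) (fun x => c x + m * raise_dc i x) =
  node_wt i r c + (m + m).
Proof.
elim/node_cases: i => [j jN||j jN]; rewrite /node_wt /raise_dr /raise_dc.
- have jj := inord_neq jN; have jj1 : (inord j.+1 == inord j :> 'I_n) = false by rewrite eq_sym.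
  by rewrite !by_node_row // /row_wt /e_ !eqxx jj jj1 /=; ring.
- by rewrite !by_node_mid /mid_wt /e_ inord_mx !eqxx /=; ring.
- have jj := inord_neq jN; have jj1 : (inord j.+1 == inord j :> 'I_n) = false by rewrite eq_sym.
  by rewrite !by_node_col // /col_wt /e_ !eqxx jj jj1 /=; ring.
Qed.

Lemma E_node_shift i : shifts (act (E i)) (raise_dr i) (raise_dc i).
Proof.
have [h0 hD] := node_wt_add i.
apply: (act_E_shifts act_alg h0 hD) => [a al|a al]; first exact: K_node_z.
elim/node_cases: i h0 hD => [j jN||j jN] _ _; rewrite /raise_dr /raise_dc.
- rewrite !by_node_row // E_row_z //.
  have [->|_] := eqVneq a (inord j.+1); last by rewrite mul0r scale0r; apply: homog0.
  by apply: homogZ; apply: homog_ext (homog_gen _ _ _) _ _ => x; rewrite /e_ ?addr0 //; ring.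
- rewrite !by_node_mid // E_mid_z //; apply: homogZ.
  apply: homog_ext (homog_mul (homog_gen _ _ _) (homog_gen _ _ _)) _ _ => x.
    by rewrite /e_ inord_mx.
  by rewrite /e_ inord_mx addrC.
- rewrite !by_node_col // E_col_z //.
  have [->|_] := eqVneq al (inord j.+1); last by rewrite mul0r scale0r; apply: homog0.
  by apply: homogZ; apply: homog_ext (homog_gen _ _ _) _ _ => x; rewrite /e_ ?addr0 //; ring.
Qed.

Lemma lowering_node f : lowering lower_row lower_col lower_mid f -> exists i, f = lower_node i.
Proof.
by case=> [j _|j _|]; [exists (node j) | exists (node (N.*2 - j)) | exists (node N)].
Qed.

Lemma node_lowering i : lowering lower_row lower_col lower_mid (lower_node i).
Proof.
elim/node_cases: i => [j jN||j jN].
- by move: jN; apply: lowering_row.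
- exact: lowering_corner.
- by move: jN; apply: lowering_col.
Qed.

Lemma lower_node_shift i :
  shifts (lower_node i) (fun x => - raise_dr i x) (fun x => - raise_dc i x).
Proof.
rewrite /raise_dr /raise_dc; elim/node_cases: i => [j jN||j jN].
- apply: shifts_eq (row_op_shifts (lower_row_op jN)) _ _ => x; rewrite by_node_row ?oppr0 //.
  by rewrite opprB.
- by apply: shifts_eq (corner_op_shifts lower_mid_op) _ _ => x; rewrite by_node_mid /e_ inord_mx.
- apply: shifts_eq (col_op_shifts (lower_col_op jN)) _ _ => x; rewrite by_node_col ?oppr0 //.
  by rewrite opprB.
Qed.

Lemma const_term_lower i g : i != node N -> const_term (lower_node i g) = 0.
Proof.
have sz := @zgen_spanning k n Q.
elim/node_cases: i => [j jN _||j jN _]; rewrite ?eqxx //.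
- by apply: (const_term_row sz _ (lower_row_op jN)) => f a al; apply: const_termz.
- by apply: (const_term_row (spanning_swap sz) _ (lower_col_op jN)) => f a al; apply: const_termz.
Qed.

Lemma const_term_E i g : const_term (act (E i) g) = 0.
Proof.
have cl := @const_term_lin k n Q.
apply: (act_counit_E act_alg) => a al.
have cz b be : const_term (z b be) = 0 by rewrite -[z b be]mul1r const_termz.
elim/node_cases: i => [j jN||j jN].
- by rewrite E_row_z // (rlinZ cl) cz scaler0.
- by rewrite E_mid_z (rlinZ cl) const_termz scaler0.
- by rewrite E_col_z // (rlinZ cl) cz scaler0.
Qed.
End InitialAction.

(** The scalar identity behind the choice lambda = n - l: here [s] is q^(1/2), [c] is
q^(2 lambda), and [x] is the eigenvalue of K_n. *)
Lemma invariant_coef (k : fieldType) (s q c x y : k) :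
  s != 0 -> q * q - 1 != 0 -> s * s = q -> c * x = y ->
  - s^-1 * (q * (x - y) / (q * q - 1)) - s * ((1 - c) / (1 - q ^+ 2)) * x = 0.
Proof.
move=> s0 q2 sq <-; have q2' : 1 - q * q != 0 by rewrite -opprB oppr_eq0.
by rewrite expr2 -sq in q2 q2' *; field; rewrite q2' q2 s0.
Qed.

(** * The twisted actions and the powers of the wave operator *)
Section Morphism.
Variables (R : realType) (q : R).
Hypothesis hq : 0 < q < 1.
Variable N : nat.
Local Open Scope complex_scope.
Local Notation k := (R[i]).
Local Notation Q := (Cq q).
Local Notation n := N.+1.
Local Notation rk := (n.*2.-1).
Local Notation A := (qmat n Q).
Local Notation z := (@zgen k n Q).
Local Notation mx := (ord_max : 'I_n).
Local Notation U := (Uq rk Q).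
Local Notation E := (@UE k rk Q).
Local Notation F := (@UF k rk Q).
Local Notation K := (@UK k rk Q).
Local Notation Ki := (@UKi k rk Q).
Local Notation s := (Cqpow q (1 / 2)).
Local Notation node := (node N).

Variable act : U -> A -> A.
Hypothesis hact : is_initial_action act (Cq_neq0 hq).
Variable D : 'I_n -> 'I_n -> A -> A.
Hypothesis calc : is_calculus z D.
Variable l : nat.

Let act_alg : is_module_algebra (Cq_neq0 hq) act. Proof. by case: hact. Qed.
Let alin := act_lin act_alg.
Let ops := initial_conformal_ops hact.
Local Notation T := (iter l (box D)).
Local Notation lower := (lower_node act).
Let s0 : s != 0. Proof. exact: Cqpow_neq0. Qed.
Let Q0 := Cq_neq0 hq.

Lemma box_iter_lin : linear T.
Proof. exact: iter_lin (box_lin calc). Qed.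
Let Tlin := box_iter_lin.

Lemma box_iter_lower i g :
  T (lower i g) = (if i == node N then Q ^ (- (l%:Z + l%:Z)) else 1) *: lower i (T g).
Proof.
move: i; apply: node_cases => [j jN||j jN].
- rewrite node_mid_row // scale1r.
  by elim: l => //= m ->; apply: (box_fr ops calc jN).
- rewrite eqxx opprD expfzDr //; elim: l => [|m IH]; first by rewrite oppr0 !expr0z mulr1 scale1r.
  rewrite [LHS]/= IH (rlinZ (box_lin calc)) -/(lower_mid act _) (box_fm ops calc) scalerA.
  by congr (_ *: _); rewrite -!invr_expz -!exprnP exprS !invfM; set x := (_ ^+ _)^-1; rewrite mulrC mulrACA.
- rewrite node_mid_col // scale1r.
  by elim: l => //= m ->; apply: (box_fc ops calc jN).
Qed.

Lemma box_iter_shifts : shifts T (fun=> - l%:Z) (fun=> - l%:Z).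
Proof.
elim: l => [|m IH] r c g hg; first by apply: homog_ext hg _ _ => x; rewrite oppr0 addr0.
apply: homog_ext (box_shifts ops calc (IH _ _ _ hg)) _ _ => x; rewrite intS; ring.
Qed.

(** The scalar q^x that the twisted action inserts at the middle node. *)
Definition twist (i : 'I_rk) (x : R) : k := if i == node N then Cqpow q x else 1.

Lemma twist_neq0 i x : twist i x != 0.
Proof. by rewrite /twist; case: ifP => _; rewrite ?oner_eq0 ?Cqpow_neq0. Qed.

Section Twisted.
Variables (lam : R) (p : U -> A -> A).
Hypothesis hp : is_twisted_action act lam p.

Lemma twisted_lin xi : linear (p xi).
Proof. by have [[]] := hp. Qed.
Lemma twisted_linl g : linear (p^~ g).
Proof. by have [[]] := hp. Qed.
Lemma twisted1 g : p 1 g = g.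
Proof. by have [[]] := hp. Qed.
Lemma twistedM xi eta g : p (xi * eta) g = p xi (p eta g).
Proof. by have [[]] := hp. Qed.

Let midE (i : 'I_rk) : (i == node N) = (i == N :> nat).
Proof. by rewrite -val_eqE /= nodeE // ltn_rank; lia. Qed.

Lemma twistedE i g :
  [/\ p (K i) g = twist i lam *: act (K i) g,
      p (F i) g = twist i (- lam) *: act (F i) g &
      p (E i) g = act (E i) g - (if i == node N then
        s * ((1 - Cqpow q (2 * lam)) / (1 - Q ^+ 2)) else 0) *: (act (K i) g * z mx mx)].
Proof.
have [_ hside hmid] := hp; rewrite /twist.
have [iN|iN] := eqVneq i (node N).
  have [||-> _ -> ->] := hmid i mx g => //.
  by move/eqP: iN; rewrite midE => /eqP ->.
have [|-> _ -> ->] := hside i g; last by rewrite !scale1r scale0r subr0.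
by move=> -[] /eqP; rewrite -midE (negPf iN).
Qed.

Lemma twisted_K_homog i r c g : homog r c g ->
  p (K i) g = (twist i lam * Q ^ node_wt i r c) *: g.
Proof. by move=> hg; have [-> _ _] := twistedE i g; rewrite (K_node_homog hact i hg) scalerA. Qed.

Lemma twisted_F i g : p (F i) g = (s * twist i (- lam)) *: lower i g.
Proof.
have [_ -> _] := twistedE i g; by rewrite /lower_node scalerA mulrAC divff // mul1r.
Qed.

Lemma twisted_E_shift i : shifts (p (E i)) (raise_dr i) (raise_dc i).
Proof.
move=> r c g hg; have [_ _ ->] := twistedE i g; rewrite addrC -scaleNr.
have [->|_] := eqVneq; last first.
  by rewrite oppr0 scale0r add0r; apply: E_node_shift hact _ _ _ _ hg.
apply: homogL; last exact: E_node_shift hact _ _ _ _ hg.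
rewrite (K_node_homog hact _ hg) -scalerAl; apply: homogZ.
apply: homogM hg _ _ => x; rewrite /raise_dr /raise_dc by_node_mid;
  congr (_ + (_ == _)%:R); apply: val_inj; by rewrite /= inordK.
Qed.

Lemma const_term_twisted_E i g : const_term (p (E i) g) = 0.
Proof.
have cl := @const_term_lin k n Q; have [_ _ ->] := twistedE i g.
by rewrite (rlinB cl) (rlinZ cl) (const_term_E hact) const_termz scaler0 subr0.
Qed.
End Twisted.

Section Intertwining.
Variables (p p' : U -> A -> A).
Hypotheses (hp : is_twisted_action act (n%:R - l%:R) p)
           (hp' : is_twisted_action act (n%:R + l%:R) p').
Let pl := twisted_lin hp.
Let pl' := twisted_lin hp'.

Let QzD x y : Q ^ (x + y) = Q ^ x * Q ^ y. Proof. by rewrite expfzDr. Qed.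

(** The power T lowers the weight of the middle node by 2l, which accounts for the
difference between the two twists. *)
Lemma twist_wt i h :
  twist i (n%:R - l%:R) * Q ^ h =
  twist i (n%:R + l%:R) * Q ^ (h - (if i == node N then l%:Z + l%:Z else 0)).
Proof.
rewrite /twist; case: eqP => _; last by rewrite subr0.
rewrite QzD mulrCA -(Cqpow_int hq (- _)) -CqpowD // mulrC; congr (_ * Cqpow q _).
by rewrite rmorphN rmorphD /=; ring.
Qed.

Lemma intertwine_K i g : T (p (K i) g) = p' (K i) (T g).
Proof.
move: g; apply: homog_span => [e f g hf hg|r c g hg].
  by rewrite pl !Tlin hf hg pl'.
rewrite (twisted_K_homog hp i hg) (rlinZ Tlin) (twisted_K_homog hp' i (box_iter_shifts hg)).
by rewrite twist_wt node_wt_shift.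
Qed.

(** The inverse of K_i is determined by K_i, in both actions. *)
Lemma intertwine_Ki i g : T (p (Ki i) g) = p' (Ki i) (T g).
Proof.
rewrite -[LHS](twisted1 hp') -(UKiK Q i) (twistedM hp') -intertwine_K -(twistedM hp).
by rewrite UKKi (twisted1 hp).
Qed.

Lemma intertwine_F i g : T (p (F i) g) = p' (F i) (T g).
Proof.
rewrite (twisted_F hp) (rlinZ Tlin) box_iter_lower scalerA (twisted_F hp') -mulrA.
congr (_ * _ *: _); rewrite /twist; case: eqP => _; last by rewrite mulr1.
rewrite -Cqpow_int // -CqpowD //; congr (Cqpow q _).
by rewrite rmorphN rmorphD /=; ring.
Qed.

Definition E_defect i (g : A) : A := T (p (E i) g) - p' (E i) (T g).

Lemma E_defect_lin i : linear (E_defect i).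
Proof. by move=> e f g; rewrite /E_defect pl !Tlin pl' scalerBr opprD addrACA. Qed.

(** The commutator of E_i and F_j is a combination of K_i and its inverse, for which
the intertwining property is known. *)
Lemma E_defect_F i j g : p' (F j) (E_defect i g) = E_defect i (p (F j) g).
Proof.
have comm lam p0 (h0 : is_twisted_action act lam p0) v : p0 (F j) (p0 (E i) v) =
    p0 (E i) (p0 (F j) v) - ((i == j)%:R / (Q - Q^-1)) *: (p0 (K i) v - p0 (Ki i) v).
  have := congr1 (p0^~ v) (UEF Q i j); have pl0 := twisted_linl h0 v.
  rewrite (rlinB pl0) (rlinZ pl0) (rlinB pl0) !(twistedM h0) => <-.
  by rewrite subKr.
rewrite /E_defect (rlinB (pl' _)) -intertwine_F (comm _ _ hp) (comm _ _ hp').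
rewrite (rlinB Tlin) (rlinZ Tlin) (rlinB Tlin) intertwine_K intertwine_Ki intertwine_F.
by rewrite opprB addrA subrK.
Qed.

Lemma E_defect_lower i f : lowering (lower_row act) (lower_col act) (lower_mid act) f ->
  forall g, E_defect i (f g) = 0 -> f (E_defect i g) = 0.
Proof.
case/lowering_node => j -> g Lg; have := E_defect_F i j g.
rewrite (twisted_F hp) (twisted_F hp') (rlinZ (E_defect_lin i)) Lg scaler0.
move/eqP; rewrite scaler_eq0 mulf_eq0 (negPf s0) (negPf (twist_neq0 _ _)).
by move/eqP.
Qed.

Lemma E_defect_shifts i : shifts (E_defect i)
  (fun x => raise_dr i x - l%:Z) (fun x => raise_dc i x - l%:Z).
Proof.
move=> r c g hg; rewrite /E_defect addrC -[X in homog _ _ (X + _)]scaleN1r; apply: homogL.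
  apply: homog_ext (twisted_E_shift hp' _ (box_iter_shifts hg)) _ _ => x;
  by rewrite addrAC addrA.
by apply: homog_ext (box_iter_shifts (twisted_E_shift hp _ hg)) _ _ => x; rewrite addrA.
Qed.

Let phi (g : A) : k^o := const_term (T g).
Let phi_lin : linear phi.
Proof. by move=> e f g; rewrite /phi Tlin; apply: const_term_lin. Qed.
Let phi_lower i g : i != node N -> phi (lower i g) = 0.
Proof.
by move=> iN; rewrite /phi box_iter_lower (negPf iN) scale1r; apply: const_term_lower hact _ _ iN.
Qed.

Lemma lowering_nilpotent f r c g :
  lowering (lower_row act) (lower_col act) (lower_mid act) f -> homog r c g ->
  exists M, iter M f g = 0.
Proof.
move=> hf hg; have [M] : exists M : nat, height r c < M%:Z.
  by exists `|height r c|.+1; lia.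
elim: M r c g hg => [|M IH] r c g hg hM; first by exists 0; rewrite /= (height_neg hg).
have [r' [c' [hfg hh]]] := lowering_height ops hf hg.
have [|M' hM'] := IH _ _ _ hfg; first by lia.
by exists M'.+1; rewrite iterSr.
Qed.

(** The E_i and F_i of a side node form an sl_2 under which [phi] is invariant, and
an element on which [phi] of E_i g can be nonzero has weight -2. *)
Lemma invariant_E_side i r c g : i != node N -> homog r c g -> node_wt i r c = - 2 ->
  phi (act (E i) g) = 0.
Proof.
move=> iN hg hw.
pose W (h : int) (v : A) := exists r c, homog r c v /\ node_wt i r c = h.
have : phi (raise_node act i g) = 0.
  refine (@invariant_sl2 k Q A Q0 (Cq_sq hq) (Cq_root hq) W (raise_node act i) (lower i) phi _ _ _ _ _ _ g _ _).
  - exact: scale_lin (alin _).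
  - exact: phi_lin.
  - move=> h v [r' [c' [hv <-]]].
    exists (fun x => r' x + 1 * raise_dr i x), (fun x => c' x + 1 * raise_dc i x).
    split; last by rewrite (node_wt_raise hq); lia.
    by apply: homogZ; apply: homog_ext (E_node_shift hact i hv) _ _ => x; rewrite mul1r.
  - move=> h v [r' [c' [hv <-]]].
    exists (fun x => r' x + (-1) * raise_dr i x), (fun x => c' x + (-1) * raise_dc i x).
    split; last by rewrite (node_wt_raise hq); lia.
    by apply: homog_ext (lower_node_shift hact i hv) _ _ => x; rewrite mulN1r.
  - move=> h v [r' [c' [hv <-]]]; rewrite /raise_node /lower_node !(rlinZ (alin _)).
    rewrite (EF_homog hact i (node_wt_add i) _ hv) => [|a al]; last exact: K_node_z.
    by rewrite eqxx [true%:R * _]mul1r scalerA divff // scale1r scalerA mulVf // scale1r.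
  - by move=> v; apply: phi_lower.
  - by exists r, c.
  - exact: lowering_nilpotent (node_lowering act i) hg.
rewrite /raise_node (rlinZ phi_lin) => /eqP; rewrite scaler_eq0 (negPf s0) /=.
by move=> /eqP.
Qed.

(** The content of g in the last row and in the last column is l-1, so that K_n acts
on g by q^(2(l-1)) and [invariant_raising] applies. *)
Lemma invariant_E_mid r c g : homog r c g -> r mx = l%:Z - 1 -> c mx = l%:Z - 1 ->
  phi (p (E (node N)) g) = 0.
Proof.
move=> hg rm cm; have [_ _ ->] := twistedE hp (node N) g; rewrite eqxx.
rewrite (K_node_homog hact _ hg) (rlinB phi_lin) (rlinZ phi_lin) -scalerAl (rlinZ phi_lin).
rewrite /node_wt by_node_mid /mid_wt rm cm.
have rfr j f : (j < N)%N -> phi (lower_row act j f) = 0.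
  by move=> jN; apply: (phi_lower (i := node j)); rewrite node_mid_row.
have := invariant_raising ops phi_lin rfr hg; rewrite rm cm => /(_ erefl).
rewrite /raise_mid (rlinZ phi_lin) => h.
have -> : phi (act (E (node N)) g) = - s^-1 *: (- s *: phi (act (E (node N)) g)).
  by rewrite scalerA mulrNN mulVf // scale1r.
rewrite h !scalerA -scalerBl invariant_coef ?scale0r //; [exact: Cq_sq | exact: Cqpow_half |].
rewrite -Cqpow_int // -CqpowD // -expr2 -exprM -Cqpow_nat //; congr (Cqpow q _).
rewrite natrM !rmorphD !rmorphN /= -[N.+1%:R]natr1; ring.
Qed.

(** By [rigidity] it suffices to consider elements that T p(E_i) sends to constants.
The constant term of p'(E_i) is zero, so only the functional [phi] of p(E_i) g
matters. *)
Lemma intertwine_E i g : T (p (E i) g) = p' (E i) (T g).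
Proof.
apply/eqP; rewrite -subr_eq0; apply/eqP; rewrite -/(E_defect i g); move: g.
apply: (rigidity ops (E_defect_lin i) (E_defect_shifts i) (@E_defect_lower i)).
move=> r c g e hg hr hc /(congr1 (fun f => (const_term f : k^o))).
rewrite /E_defect (rlinB (@const_term_lin k n Q)) (const_term_twisted_E hp') subr0.
rewrite (rlinZ (@const_term_lin k n Q)) const_term1 -/(phi _) => he.
suff : phi (p (E i) g) = 0 by rewrite he => h; rewrite -[e]mulr1.
have [im|im] := eqVneq i (node N).
  move: hr hc; rewrite im /raise_dr /raise_dc !by_node_mid => hr hc.
  have mxE : (mx == inord N) = true by apply/eqP/val_inj; rewrite /= inordK.
  by apply: (invariant_E_mid hg); [have := hr mx | have := hc mx]; rewrite mxE /=; lia.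
have [_ _ ->] := twistedE hp i g; rewrite (negPf im) scale0r subr0.
apply: (invariant_E_side im hg).
have := node_wt_shift i (fun x => r x + 1 * raise_dr i x) (fun x => c x + 1 * raise_dc i x) l%:Z.
rewrite (negPf im) (node_wt_raise hq) (node_wt_add i).1 => [|x|x]; first by lia.
  by have := hr x; lia.
by have := hc x; lia.
Qed.

Lemma box_iter_morphism : is_module_morphism p p' T.
Proof.
split=> [|xi g]; first exact: Tlin.
elim/pclass_ind: xi g => t; rewrite pclassE; elim: t => [x|c|t IHt u IHu|t IHt u IHu] g /=.
- by case: x => i; [apply: intertwine_E | apply: intertwine_F | apply: intertwine_K |
    apply: intertwine_Ki].
- rewrite (rlinZ (twisted_linl hp _)) (rlinZ (twisted_linl hp' _)) (twisted1 hp) (twisted1 hp').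
  exact: rlinZ Tlin _ _.
- rewrite (rlinD (twisted_linl hp _)) (rlinD (twisted_linl hp' _)) (rlinD Tlin).
  by rewrite IHt IHu.
- by rewrite (twistedM hp) (twistedM hp') IHt IHu.
Qed.

End Intertwining.
End Morphism.

Theorem theorem4p1 (R : realType) (q : R) (hq : 0 < q < 1)
    (n : nat) (hn : (0 < n)%N)
    (act : Uq n.*2.-1 (Cq q) -> qmat n (Cq q) -> qmat n (Cq q))
    (hact : is_initial_action act (Cq_neq0 hq))
    (pi : R -> Uq n.*2.-1 (Cq q) -> qmat n (Cq q) -> qmat n (Cq q))
    (hpi : forall lam : R, is_twisted_action act lam (pi lam))
    (d : qmat n (Cq q) -> Omega n (Cq q)) (hd : is_differential d)
    (D : 'I_n -> 'I_n -> qmat n (Cq q) -> qmat n (Cq q))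
    (hD : are_partials d D)
    (l : nat) (hl : (0 < l)%N) :
  is_module_morphism (pi (n%:R - l%:R)) (pi (n%:R + l%:R)) (iter l (box D)).
Proof.
have q0 := Cq_neq0 hq.
have calc : is_calculus (@zgen _ n (Cq q)) D.
  split=> [a al|a al|a al f c ga].
  - exact: partial_lin q0 _ _ hd hD a al.
  - exact: partial1 q0 _ _ hd hD a al.
  rewrite (partialM q0 hd hD); congr (_ + _).
  by case: ifP; rewrite ?scale1r ?scale0r.
case: n hn act hact pi hpi d hd D hD calc => // N _ act hact pi hpi d _ D _ calc.
exact: (box_iter_morphism hact calc (hpi _) (hpi _)).
Qed.
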